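(* Let $p$ be a prime with $p\equiv 3 \pmod 4$ and $p>3$, and suppose that $10$ has multiplicative order exactly $(p-1)/2$ modulo $p$. Let $m\in\{1,\ldots,p-1\}$ be a quadratic residue modulo $p$, and write the decimal expansion $m/p=\sum_{j=1}^{\infty}a_j10^{-j}$ with digits $a_j\in\{0,\ldots,9\}$. For $k\in\{0,\ldots,9\}$ let $$n_k=|\{j : 1\le j\le (p-1)/2,\ a_j=k\}|.$$ Let $h_1$ be the class number of $\mathbb{Q}(\sqrt{-p})$ and $h_2$ the class number of $\mathbb{Q}(\sqrt{-5p})$. Then for $k=0,\ldots,4$, $$n_k=\frac12\left(\left\lfloor\frac{(k+1)p}{10}\right\rfloor-\left\lfloor\frac{kp}{10}\right\rfloor+\delta_k\right)\quad\text{and}\quad n_{9-k}=n_k-\delta_k,$$ where the numbers $\delta_k$ are given as follows. If $p\equiv 3\pmod 8$, then $$\delta_0=0,\quad \delta_1=\delta_4=\tfrac{3h_1}{2}-\tfrac{h_2}{4},\quad \delta_2=-\delta_1,\quad \delta_3=\tfrac{3h_1}{2}+\tfrac{h_2}{4}.$$ If $p\equiv 7\pmod 8$, then $$\delta_0=h_1-\tfrac{h_2}{2},\quad \delta_1=\tfrac{h_2}{4},\quad \delta_2=\tfrac{3h_2}{4},\quad \delta_3=\delta_4=-\delta_1.$$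
   Context: $\lfloor x\rfloor$ denotes the integer part of $x$. The digits $a_j$ are the (unique, non-terminating) base-10 digits of the rational number $m/p\in(0,1)$; $(a_1,\ldots,a_{(p-1)/2})$ is a period of this expansion. *)

(* Defs.v *)
From HB Require Import structures.
From mathcomp Require Import all_boot all_order all_algebra all_field.
From mathcomp Require Import finmap.
From mathcomp Require Import all_classical all_reals all_analysis.

Set Implicit Arguments.
Unset Strict Implicit.
Unset Printing Implicit Defensive.

Import Order.TTheory GRing.Theory Num.Theory.
Import numFieldNormedType.Exports.

Local Open Scope classical_set_scope.
Local Open Scope ring_scope.

(* Number fields are subfields of the algebraic closure algC of rat. *)
Definition quadratic_field (d : int) : set algC :=
  [set z | exists a b : rat, z = ratr a + ratr b * sqrtC (d%:~R)].

Definition ring_of_integers (K : set algC) : set algC :=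
  [set z | K z /\ z \in Aint].

(* 0 \in I and closure under opposite follow from the last clause, as any    *)
(* subring O contains 0 and -1.                                              *)
Definition nonzero_ideal (O I : set algC) : Prop :=
  [/\ I `<=` O,
      exists2 x, I x & x != 0,
      forall x y, I x -> I y -> I (x + y)
    & forall r x, O r -> I x -> I (r * x)].

Definition ideal_equiv (O I J : set algC) : Prop :=
  exists a b : algC, [/\ O a /\ a != 0, O b /\ b != 0 &
    [set a * x | x in I] = [set b * y | y in J]].

Definition ideal_class (O I : set algC) : set (set algC) :=
  [set J | nonzero_ideal O J /\ ideal_equiv O I J].

Definition ideal_classes (O : set algC) : set (set (set algC)) :=
  [set ideal_class O I | I in nonzero_ideal O].

(* fset_set is the underlying finite set; it would be empty on an infinite   *)
(* argument, but the class group of a number field is finite.                *)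
Definition class_number (K : set algC) : nat :=
  #|` fset_set (ideal_classes (ring_of_integers K))|%fset.

(* a j is the j-th digit after the decimal point; the value a 0 is unused.   *)
Definition decimal_expansion (R : realType) (x : R) (a : nat -> nat) : Prop :=
  (forall j, (0 < j)%N -> (a j < 10)%N) /\
  (fun n : nat => \sum_(1 <= j < n.+1) (a j)%:R / 10%:R ^+ j : R) @ \oo --> x.

Definition digit_count (a : nat -> nat) (N k : nat) : nat :=
  count (fun j => a j == k) (index_iota 1 N.+1).

Definition delta3 (h1 h2 : rat) (k : nat) : rat :=
  match k with
  | 0 => 0
  | 1 | 4 => 3%:R * h1 / 2%:R - h2 / 4%:R
  | 2 => - (3%:R * h1 / 2%:R - h2 / 4%:R)
  | 3 => 3%:R * h1 / 2%:R + h2 / 4%:R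
  | _ => 0
  end.

Definition delta7 (h1 h2 : rat) (k : nat) : rat :=
  match k with
  | 0 => h1 - h2 / 2%:R
  | 1 => h2 / 4%:R
  | 2 => 3%:R * h2 / 4%:R
  | 3 | 4 => - (h2 / 4%:R)
  | _ => 0
  end.

(* Only used for p congruent to 3 modulo 4, i.e. to 3 or 7 modulo 8, and     *)
(* for k <= 4.                                                               *)
Definition delta (p : nat) (h1 h2 : rat) (k : nat) : rat :=
  if (p %% 8 == 3)%N then delta3 h1 h2 k else delta7 h1 h2 k.

(* Main.v *)
(* Let chi be the quadratic character of Q(sqrt(-d)), for d = p and d = 5p. Both
   class numbers are given by h = L(0, chi) = - (sum of r chi(r), r < d) / d. To
   see this without complex analysis, let r(n) be the number of representations
   of n by representatives of all classes of forms, so that r(0) = h and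
   r(n) = 2 sum_(e | n) chi(e) for n > 0. The series r(n) - 4 r(n / 4) is a
   combination of alternating sums over lattice points and has Abel sum 0, while
   on the character side it is an explicit combination of the coefficients of
   eta(s) L(s, chi), whose Abel sum L(0, chi) / 2 is computed block by block.

   The digit a_(j+1) is the integer part of 10 r / p with r = 10^j m mod p, and
   10^j m runs through the quadratic residues. Thus 2 n_k is the number of
   integers in the k-th tenth of (0, p) plus the sum S_k of the Legendre symbol
   over it. The substitutions r -> -r, r -> 2r, the sums of [2r / p] and [5r / p]
   against the symbol (giving multiples of h_1), and the formula for h_2 reduced
   modulo p and 5 by the Chinese remainder theorem, determine all S_k. *)

Require Import Defs.
From mathcomp Require Import all_boot all_order all_algebra all_fingroup.
From mathcomp Require Import all_solvable all_field finmap.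
From mathcomp Require Import all_classical all_reals all_analysis.
From mathcomp Require Import zify ring lra.

Set Implicit Arguments.
Unset Strict Implicit.
Unset Printing Implicit Defensive.

Import Order.TTheory GRing.Theory Num.Theory.
Import numFieldNormedType.Exports.
Local Open Scope ring_scope.

(** * Abel summation over an archimedean field *)

(** Working at s = 0 rather than s = 1 keeps the class number formula rational: no pi and no square
    root occur, and Abel sums make sense over [rat]. The series of r(n) itself has no Abel sum,
    since sum r(n) x^n grows like C / (1 - x) with C an area. The series of 4 r(n / 4) is four times
    the same function at x^4 and has the same leading term, so the difference loses the growth and C
    never has to be known. For the Dirichlet series the subtraction is the factor 1 - 4^(1 - s) = (1
    - 2^(1 - s)) (1 + 2^(1 - s)): the first factor makes eta(s) out of zeta(s), and the second is 3
    at s = 0, matching the constant terms h - 4 h = - 3 h. The alternating lattice sums become small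
    only after averaging. A Cesaro mean of order j has weights of size N^j; differencing j times
    along the alternating variable leaves terms of size N^(j / 2) at O(N) points. This is o(N^j)
    from j = 3 on, which is why weights of order three are used. *)

Section AbelSummation.
Variable F : archiRealFieldType.
Implicit Types (b c : nat -> F) (s e L K : F).

Definition psum b s N : F := \sum_(n < N) b n * s ^+ n.

(* The limit of the power series is expressed through its partial sums, so that
   the notion makes sense over [rat]. *)
Definition abel_sum b L : Prop :=
  forall e, 0 < e -> exists2 d, 0 < d & forall s, 0 < s -> s < 1 -> 1 - d < s ->
    exists N0, forall N, (N0 <= N)%N -> `|psum b s N - L| <= e.

Definition poly_bounded b : Prop :=
  exists K j, 0 <= K /\ forall n, `|b n| <= K * n.+1%:R ^+ j.

Lemma abel_ext b c L : b =1 c -> abel_sum b L -> abel_sum c L.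
Proof.
move=> bc H e e0; have [d d0 Hd] := H e e0; exists d => // s s0 s1 sd.
have [N0 HN] := Hd s s0 s1 sd; exists N0 => N /HN; congr (`|_ - _| <= _).
by apply: eq_bigr => i _; rewrite bc.
Qed.

Lemma abelD b c L M : abel_sum b L -> abel_sum c M ->
  abel_sum (fun n => b n + c n) (L + M).
Proof.
move=> Hb Hc e e0; have e2 : 0 < e / 2 by lra.
have [d1 d10 H1] := Hb _ e2; have [d2 d20 H2] := Hc _ e2.
exists (Num.min d1 d2); first by rewrite lt_min d10.
move=> s s0 s1 sd.
have m1 : Num.min d1 d2 <= d1 by rewrite ge_min lexx.
have m2 : Num.min d1 d2 <= d2 by rewrite ge_min lexx orbT.
have [|N1 HN1] := H1 s s0 s1; first lra.
have [|N2 HN2] := H2 s s0 s1; first lra.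
exists (maxn N1 N2) => N; rewrite geq_max => /andP[/HN1 h1 /HN2 h2].
have -> : psum (fun n => b n + c n) s N - (L + M) =
  (psum b s N - L) + (psum c s N - M).
  rewrite /psum; under eq_bigr do rewrite mulrDl.
  by rewrite big_split /=; ring.
by apply: le_trans (ler_normD _ _) _; lra.
Qed.

Lemma abelZ b a L : abel_sum b L -> abel_sum (fun n => a * b n) (a * L).
Proof.
move=> Hb e e0; pose A := `|a| + 1; have A0 : 0 < A by rewrite /A ltr_wpDl.
have [|d d0 H1] := Hb (e / A); first by rewrite divr_gt0.
exists d => // s s0 s1 sd; have [N0 HN] := H1 s s0 s1 sd.
exists N0 => N /HN h.
have -> : psum (fun n => a * b n) s N - a * L = a * (psum b s N - L).
  rewrite /psum mulrBr mulr_sumr; congr (_ - _).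
  by apply: eq_bigr => i _; rewrite mulrA.
rewrite normrM.
apply: le_trans (_ : A * (e / A) <= _).
  by apply: ler_pM => //; rewrite /A lerDl.
by rewrite mulrC divfK // gt_eqF.
Qed.

Lemma abel0 : abel_sum (fun=> 0) 0.
Proof.
move=> e e0; exists 1 => // s _ _ _; exists 0%N => N _.
rewrite /psum big1 ?subrr ?normr0 ?(ltW e0) // => i _; exact: mul0r.
Qed.

Lemma abel_big (I : eqType) (r : seq I) (B : I -> nat -> F) (L : I -> F) :
  {in r, forall i, abel_sum (B i) (L i)} ->
  abel_sum (fun n => \sum_(i <- r) B i n) (\sum_(i <- r) L i).
Proof.
elim: r => [|i r IH] H.
  rewrite big_nil; apply: abel_ext abel0 => n; by rewrite big_nil.
rewrite big_cons; have Hr : {in r, forall i, abel_sum (B i) (L i)}.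
  by move=> j jr; apply: H; rewrite inE jr orbT.
apply: abel_ext (abelD (H i (mem_head _ _)) (IH Hr)) => n; by rewrite big_cons.
Qed.

Lemma abel_point a : abel_sum (fun n => if n is 0 then a else 0) a.
Proof.
move=> e e0; exists 1 => // s _ _ _; exists 1%N => -[//|N] _.
rewrite /psum big_ord_recl expr0 mulr1 big1; last by move=> i _; rewrite mul0r.
by rewrite addr0 subrr normr0 ltW.
Qed.

Lemma abel_uniq b L M : abel_sum b L -> abel_sum b M -> L = M.
Proof.
move=> H1 H2; apply/eqP; rewrite -subr_eq0 -normr_le0 leNgt; apply/negP => D.
set e := `|L - M| in D; have e3 : 0 < e / 3 by lra.
have [d1 d10 h1] := H1 _ e3; have [d2 d20 h2] := H2 _ e3.
(* Both estimates are compared at the single point [1 - m / 2]; the 1 in the minimum keeps it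
   positive. *)
pose m := Num.min 1 (Num.min d1 d2).
have m0 : 0 < m by rewrite !lt_min d10 d20 ltr01.
have [ma mb mc] : [/\ m <= 1, m <= d1 & m <= d2].
  by rewrite /m !ge_min !lexx !orbT.
have [|||N1 HN1] := h1 (1 - m / 2); try lra.
have [|||N2 HN2] := h2 (1 - m / 2); try lra.
have := HN1 _ (leq_maxl N1 N2); have := HN2 _ (leq_maxr N1 N2).
set S := psum _ _ _ => x y.
have : e <= `|S - L| + `|S - M|.
  rewrite [ `|S - L|]distrC /e; have -> : L - M = (L - S) + (S - M) by ring.
  exact: ler_normD.
lra.
Qed.

Lemma psum_double b s N :
  psum (fun n => if odd n then 0 else b n./2) s N = psum b (s ^+ 2) (uphalf N).
Proof.
rewrite /psum; elim: N => [|N IH]; first by rewrite !big_ord0.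
rewrite big_ord_recr /= IH uphalf_half; case: ifP => oN /=.
  by rewrite mul0r addr0 add1n.
rewrite add0n big_ord_recr /= -exprM; congr (_ + _ * _ ^+ _).
by have := odd_double_half N; rewrite oN; lia.
Qed.

(** The spread-out series at s is the series of [b] at s^2, and s > 1 - d / 2 implies s^2 > 1 -
    d. *)
Lemma abel_double b L : abel_sum b L ->
  abel_sum (fun n => if odd n then 0 else b n./2) L.
Proof.
move=> H e e0; have [d d0 Hd] := H e e0; exists (d / 2); first lra.
move=> s s0 s1 sd.
have [|||N0 HN] := Hd (s ^+ 2).
- by rewrite exprn_gt0.
- by rewrite expr2; nra.
- rewrite expr2; have : 0 <= (1 - s) ^+ 2 by rewrite sqr_ge0.
  by rewrite expr2; lra.
exists N0.*2 => N hN; rewrite psum_double; apply: HN; lia.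
Qed.

Lemma bernoulli_le (y : F) n : -1 <= y -> 1 + n%:R * y <= (1 + y) ^+ n.
Proof.
move=> y0; elim: n => [|n IH]; first by rewrite mul0r addr0 expr0.
rewrite exprS -natr1; apply: le_trans (_ : (1 + y) * (1 + n%:R * y) <= _).
  have : 0 <= n%:R * y ^+ 2 by rewrite mulr_ge0 // sqr_ge0.
  by rewrite expr2; lra.
by apply: ler_wpM2l => //; lra.
Qed.

(** Bernoulli's inequality for 1 / s = 1 + y gives s^N <= 1 / (1 + N y), and the archimedean
    property supplies N. *)
Lemma expr_small s e : 0 <= s -> s < 1 -> 0 < e ->
  exists N0, forall N, (N0 <= N)%N -> s ^+ N <= e.
Proof.
move=> s0 s1 e0; have [->|sn0] := eqVneq s 0.
  by exists 1%N => N hN; rewrite expr0n; case: N hN => // N _; exact: ltW.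
have sp : 0 < s by rewrite lt_neqAle eq_sym sn0.
pose y := s^-1 - 1; have y0 : 0 < y by rewrite subr_gt0 invf_gt1.
have z0 : 0 <= e^-1 / y by rewrite divr_ge0 ?invr_ge0 ?ltW.
exists (Num.bound (e^-1 / y)) => N hN.
have : e^-1 / y < N%:R.
  by apply: lt_le_trans (archi_boundP z0) _; rewrite ler_nat.
rewrite ltr_pdivrMr // => h.
have := bernoulli_le N (_ : -1 <= y).
have -> : 1 + y = s^-1 by rewrite /y; ring.
move=> /(_ ltac:(lra)) h2; rewrite -[s]invrK exprVn.
rewrite -[e]invrK lef_pV2 ?posrE ?invr_gt0 ?exprn_gt0 ?invr_gt0 //; lra.
Qed.

Lemma geom_partial s N : 0 <= s -> s < 1 -> \sum_(n < N) s ^+ n <= (1 - s)^-1.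
Proof.
move=> s0 s1; have s2 : 0 < 1 - s by lra.
rewrite -(ler_pM2l s2) divff ?gt_eqF //.
have -> : (1 - s) * (\sum_(n < N) s ^+ n) = 1 - s ^+ N.
  by rewrite -[1 - s]opprB mulNr -subrX1 opprB.
by rewrite gerBl exprn_ge0.
Qed.

(* Polynomial growth is absorbed by passing from [s] to a larger ratio [q < 1],
   found rationally by Bernoulli's inequality. *)
Lemma poly_bounded_geom b s : poly_bounded b -> 0 < s -> s < 1 ->
  exists q C, [/\ 0 < q, q < 1, 0 <= C & forall n, `|b n| * s ^+ n <= C * q ^+ n].
Proof.
move=> [K [j [K0 Hb]]] s0 s1.
have j0 : 0 < j.+1%:R :> F by rewrite ltr0n.
pose y := (1 - s) / j.+1%:R; have y0 : 0 < y by rewrite divr_gt0 //; lra.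
have yj : j.+1%:R * y = 1 - s by rewrite mulrC divfK // gt_eqF.
have y1 : y < 1.
  rewrite ltr_pdivrMr // mul1r; apply: lt_le_trans (_ : 1 <= _); first lra.
  by rewrite ler1n.
pose q := 1 - y; have q0 : 0 < q by rewrite /q; lra.
have q1 : q < 1 by rewrite /q; lra.
have sq : s <= q ^+ j.+1.
  have := @bernoulli_le (- y) j.+1; rewrite mulrN yj /q.
  have -> : 1 - (1 - s) = s by ring.
  by apply; lra.
(* Since (n + 1) q^n <= 1 + q + ... + q^n <= 1 / (1 - q), each of the j factors n + 1 is paid for by
   one q^n; as s <= q^(j + 1), one factor q^n remains. *)
exists q, (K * (1 - q)^-1 ^+ j); split => //.
  by rewrite mulr_ge0 // exprn_ge0 // invr_ge0; lra.
move=> n.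
have nq : n.+1%:R * q ^+ n <= (1 - q)^-1.
  apply: le_trans (geom_partial n.+1 (ltW q0) q1).
  have -> : n.+1%:R * q ^+ n = \sum_(i < n.+1) q ^+ n.
    by rewrite sumr_const card_ord mulr_natl.
  apply: ler_sum => i _; apply: ler_wiXn2l; try lra.
  by rewrite -ltnS.
apply: le_trans (_ : K * n.+1%:R ^+ j * (q ^+ j.+1) ^+ n <= _).
  apply: ler_pM => //; first by rewrite exprn_ge0 ?ltW.
  by apply: lerXn2r => //; rewrite ?nnegrE ?exprn_ge0 ?ltW.
have -> : K * n.+1%:R ^+ j * (q ^+ j.+1) ^+ n = K * (n.+1%:R * q ^+ n) ^+ j * q ^+ n.
  by rewrite -exprM mulSn exprD exprMn -exprM (mulnC n j); ring.
apply: ler_wpM2r; first by rewrite exprn_ge0 ?ltW.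
apply: ler_wpM2l => //; apply: lerXn2r => //; rewrite nnegrE.
  by rewrite mulr_ge0 // exprn_ge0 ?ltW.
by rewrite invr_ge0; lra.
Qed.

Lemma poly_bounded_small b s e : poly_bounded b -> 0 < s -> s < 1 -> 0 < e ->
  exists N0, forall N, (N0 <= N)%N -> `|b N| * s ^+ N <= e.
Proof.
move=> Hb s0 s1 e0; have [q [C [q0 q1 C0 H]]] := poly_bounded_geom Hb s0 s1.
have C1 : 0 < C + 1 by lra.
have [|N0 HN] := @expr_small q (e / (C + 1)) (ltW q0) q1; first by rewrite divr_gt0.
exists N0 => N /HN h; apply: le_trans (H N) _.
apply: le_trans (_ : (C + 1) * (e / (C + 1)) <= _); last by rewrite mulrC divfK // gt_eqF.
by apply: ler_pM => //; rewrite ?lerDl // exprn_ge0 // ltW.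
Qed.

(** * Iterated partial sums and Cesaro summation *)

Definition csum b N : F := \sum_(n < N.+1) b n.

(** Summation by parts. The last summand is the boundary term, which tends to 0 when [b] is
    polynomially bounded. *)
Lemma psum_csum b s N : psum b s N.+1 =
  (1 - s) * psum (csum b) s N.+1 + csum b N * s ^+ N.+1.
Proof.
elim: N => [|N IH]; first by rewrite /psum /csum !big_ord1 expr0 expr1; ring.
rewrite {1}/psum big_ord_recr -/(psum _ _ _) /= IH.
rewrite [psum _ s N.+2]/psum big_ord_recr -/(psum _ _ _) /=.
rewrite [csum b N.+1]/csum big_ord_recr -/(csum b N) /=.
by rewrite !(exprS s N.+1); ring.
Qed.

Lemma poly_bounded_csum b : poly_bounded b -> poly_bounded (csum b).
Proof.
move=> [K [j [K0 H]]]; exists K, j.+1; split => // n.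
apply: le_trans (ler_norm_sum _ _ _) _.
apply: le_trans (_ : \sum_(i < n.+1) K * n.+1%:R ^+ j <= _).
  apply: ler_sum => i _; apply: le_trans (H i) _; apply: ler_wpM2l => //.
  by apply: lerXn2r; rewrite ?nnegrE ?ler0n // ler_nat.
by rewrite sumr_const card_ord exprSr mulrA mulr_natr.
Qed.

Lemma abel_csum_le b s (N : nat) : (forall n, 0 <= b n) -> 0 < s ->
  (1 - s) * psum (csum b) s N <= psum b s N.
Proof.
move=> b0 s0; case: N => [|N]; first by rewrite /psum !big_ord0 mulr0.
rewrite [leRHS]psum_csum lerDl mulr_ge0 ?exprn_ge0 ?(ltW s0) //.
by rewrite /csum sumr_ge0.
Qed.

Lemma csum_iter_bin b k N :
  iter k.+1 csum b N = \sum_(n < N.+1) 'C(N - n + k, k)%:R * b n.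
Proof.
elim: k N => [|k IHk] N.
  by apply: eq_bigr => i _; rewrite bin0 mul1r.
rewrite iterS /csum; under eq_bigr do rewrite IHk.
elim: N => [|N IHN]; first by rewrite !big_ord1 /= subn0 !binn.
rewrite big_ord_recr /= IHN [RHS]big_ord_recr /= [X in _ + X]big_ord_recr /=.
rewrite subnn !add0n !binn addrA -big_split /=; congr (_ + _).
apply: eq_bigr => i _; rewrite -mulrDl -natrD; congr (_%:R * _).
have le_iN : (i <= N)%N by rewrite -ltnS.
by rewrite (subSn le_iN) [in RHS]addSn binS addSnnS.
Qed.

Lemma psum_csum_near b s e : poly_bounded b -> 0 < s -> s < 1 -> 0 < e ->
  exists N0, forall N, (N0 <= N)%N ->
    `|psum b s N - (1 - s) * psum (csum b) s N| <= e.
Proof.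
move=> Hb s0 s1 e0.
have [N0 HN] := poly_bounded_small (poly_bounded_csum Hb) s0 s1 e0.
exists N0.+1 => -[//|N] hN; rewrite psum_csum addrAC subrr add0r normrM.
apply: le_trans (HN N hN); apply: ler_wpM2l => //.
by rewrite ger0_norm ?exprn_ge0 ?(ltW s0) // exprS ler_piMl ?exprn_ge0 ?(ltW s0) ?(ltW s1).
Qed.

Lemma psum_csum_iter_near b s e k : poly_bounded b -> 0 < s -> s < 1 -> 0 < e ->
  exists N0, forall N, (N0 <= N)%N ->
    `|psum b s N - (1 - s) ^+ k * psum (iter k csum b) s N| <= e.
Proof.
move=> Hb s0 s1; elim: k e => [|k IH] e e0.
  by exists 0%N => N _; rewrite expr0 mul1r subrr normr0 ltW.
have e2 : 0 < e / 2 by lra.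
have [N1 H1] := IH _ e2.
have Hk : poly_bounded (iter k csum b).
  by elim: k {IH H1} => //= k; exact: poly_bounded_csum.
have [N2 H2] := psum_csum_near Hk s0 s1 e2.
exists (maxn N1 N2) => N; rewrite geq_max => /andP[/H1 h1 /H2 h2].
have -> : psum b s N - (1 - s) ^+ k.+1 * psum (iter k.+1 csum b) s N =
  (psum b s N - (1 - s) ^+ k * psum (iter k csum b) s N) +
  (1 - s) ^+ k * (psum (iter k csum b) s N - (1 - s) * psum (csum (iter k csum b)) s N).
  by rewrite exprSr iterS; ring.
apply: le_trans (ler_normD _ _) _.
suff : `|(1 - s) ^+ k * (psum (iter k csum b) s N
         - (1 - s) * psum (csum (iter k csum b)) s N)| <= e / 2 by lra.
rewrite normrM; apply: le_trans h2; rewrite ler_piMl //.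
rewrite ger0_norm ?exprn_ge0 ?exprn_ile1 //; lra.
Qed.

(** The binomials are the (k + 1)-fold partial sums of 1, 0, 0, ..., and each partial summation of a
    nonnegative sequence is compensated by one factor 1 - s. *)
Lemma psum_bin_le s N k : 0 < s -> s < 1 ->
  (1 - s) ^+ k.+1 * psum (fun n => 'C(n + k, k)%:R) s N <= 1.
Proof.
move=> s0 s1; pose u n : F := if n is 0 then 1 else 0.
have E n j : 'C(n + j, j)%:R = iter j.+1 csum u n.
  rewrite csum_iter_bin big_ord_recl subn0 mulr1 big1 ?addr0 // => i _.
  by rewrite mulr0.
have u0 : forall n, 0 <= u n by case.
have it0 j n : 0 <= iter j csum u n.
  by elim: j n => //= j IH n; rewrite /csum sumr_ge0.
apply: le_trans (_ : psum u s N <= _); last first.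
  case: N => [|N]; first by rewrite /psum big_ord0.
  rewrite /psum big_ord_recl big1 ?addr0 ?expr0 ?mulr1 // => i _; exact: mul0r.
have -> : psum (fun n => 'C(n + k, k)%:R) s N = psum (iter k.+1 csum u) s N.
  by apply: eq_bigr => i _; rewrite E.
elim: k.+1 => [|j IH]; first by rewrite expr0 mul1r.
apply: le_trans IH; rewrite exprSr -mulrA; apply: ler_wpM2l.
  by rewrite exprn_ge0 //; lra.
exact: (abel_csum_le _ (it0 j) s0).
Qed.

(** Cesaro summability implies Abel summability. Passing to (k + 2)-fold partial sums brings in the
    factor (1 - s)^(k + 2), which just balances the series of binomial weights. The bounded part K
    contributes only K (1 - s)^(k + 1), small near s = 1. *)
Lemma cesaro_abel0 b k : poly_bounded b ->
  (forall e, 0 < e -> exists2 K, 0 <= K &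
     forall n, `|iter k.+2 csum b n| <= e * 'C(n + k.+1, k.+1)%:R + K) ->
  abel_sum b 0.
Proof.
move=> Hb H e e0; have e3 : 0 < e / 3 by lra.
have [K K0 HK] := H _ e3.
have K1 : 0 < K + 1 by lra.
exists (e / 3 / (K + 1)); first by rewrite divr_gt0.
move=> s s0 s1 sd.
have [N0 HN] := psum_csum_iter_near k.+2 Hb s0 s1 e3.
exists N0 => N /HN; rewrite subr0; set A := psum b s N; set B := psum _ s N => h.
suff : `|(1 - s) ^+ k.+2 * B| <= e / 3 + e / 3.
  have : `|A| <= `|A - (1 - s) ^+ k.+2 * B| + `|(1 - s) ^+ k.+2 * B|.
    by rewrite -{1}[A](subrK ((1 - s) ^+ k.+2 * B)); exact: ler_normD.
  lra.
have s2 : 0 < 1 - s by lra.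
rewrite normrM ger0_norm ?exprn_ge0 ?(ltW s2) //.
have hB : `|B| <= e / 3 * psum (fun n => 'C(n + k.+1, k.+1)%:R) s N + K * (1 - s)^-1.
  apply: le_trans (ler_norm_sum _ _ _) _.
  apply: le_trans (_ : \sum_(i < N) (e / 3 * ('C(i + k.+1, k.+1)%:R * s ^+ i) + K * s ^+ i) <= _).
    apply: ler_sum => i _; rewrite normrM [ `|s ^+ i|]ger0_norm ?exprn_ge0 ?(ltW s0) //.
    rewrite mulrA -mulrDl; apply: ler_wpM2r; first by rewrite exprn_ge0 ?ltW.
    exact: HK.
  rewrite big_split /= -!mulr_sumr lerD2l; apply: ler_wpM2l => //.
  exact: geom_partial (ltW s0) s1.
apply: le_trans (ler_wpM2l _ hB) _; first by rewrite exprn_ge0 ?ltW.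
rewrite mulrDr; apply: lerD.
  rewrite mulrCA -[leRHS]mulr1; apply: ler_wpM2l; first lra.
  exact: psum_bin_le.
have -> : (1 - s) ^+ k.+2 * (K / (1 - s)) = (1 - s) ^+ k.+1 * K.
  by rewrite exprSr -mulrA; congr (_ * _); rewrite mulrC divfK ?gt_eqF.
apply: le_trans (_ : (1 - s) * (K + 1) <= _); last first.
  by rewrite -ler_pdivlMr //; lra.
rewrite exprS -mulrA; apply: ler_wpM2l; first lra.
apply: le_trans (_ : 1 * K <= _); last lra.
by apply: ler_wpM2r => //; rewrite exprn_ile1 //; lra.
Qed.

End AbelSummation.

(** * Alternating sums over values of a quadratic form *)

Section IntervalSums.
Variable V : zmodType.
Implicit Types (G : int -> V) (M : nat).

Definition zsum M G : V := \sum_(i < M.*2.+1) G (i%:Z - M%:Z).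

Lemma zsumS M G : zsum M.+1 G = G (- M.+1%:Z) + zsum M G + G M.+1%:Z.
Proof.
rewrite /zsum doubleS big_ord_recr big_ord_recl /= -/(zsum M _).
congr (G _ + _ + G _); try lia.
by apply: eq_bigr => i _; congr G; rewrite /bump; lia.
Qed.

Lemma eq_zsum M G H : G =1 H -> zsum M G = zsum M H.
Proof. by move=> GH; apply: eq_bigr => i _; exact: GH. Qed.

Lemma zsum_widen M M' G : (M <= M')%N ->
  (forall x, (M < `|x|)%N -> G x = 0) -> zsum M' G = zsum M G.
Proof.
move=> le_MM' G0; elim: M' le_MM' => [|M' IH]; first by rewrite leqn0 => /eqP ->.
rewrite leq_eqVlt => /orP[/eqP -> //|lt_M].
by rewrite zsumS IH // !G0 ?addr0 ?add0r //; lia.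
Qed.

Lemma zsum_shift M G : (forall x, (M <= `|x|)%N -> G x = 0) ->
  zsum M (fun x => G (x + 1)) = zsum M G.
Proof.
move=> G0; rewrite /zsum [RHS]big_ord_recl [LHS]big_ord_recr /=.
rewrite [X in _ + X = _]G0 ?[X in _ = X + _]G0 ?addr0 ?add0r; try lia.
by apply: eq_bigr => i _; congr G; rewrite /bump; lia.
Qed.

Lemma zsumD M G H : zsum M (fun x => G x + H x) = zsum M G + zsum M H.
Proof. exact: big_split. Qed.

Lemma zsumN M G : zsum M (fun x => - G x) = - zsum M G.
Proof. exact: sumrN. Qed.

Lemma zsum0 M G : (forall x, G x = 0) -> zsum M G = 0.
Proof. by move=> G0; rewrite /zsum big1. Qed.

Lemma zsum_exchange M M' (G : int -> int -> V) :
  zsum M (fun x => zsum M' (G x)) = zsum M' (fun y => zsum M (G^~ y)).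
Proof. exact: exchange_big. Qed.

End IntervalSums.

Lemma zsum_even (V : zmodType) M (G : int -> V) :
  (forall x, odd `|x| -> G x = 0) ->
  zsum M.*2 G = zsum M (fun x => G (2 * x)).
Proof.
move=> G0; elim: M => [|M IH]; first by rewrite /zsum !big_ord1; congr G; lia.
rewrite doubleS !zsumS IH [X in _ + (X + _ + _)]G0; last by lia.
rewrite [X in _ + (_ + _ + X) + _]G0; last by lia.
by rewrite add0r addr0; congr (G _ + _ + G _); lia.
Qed.

Lemma zsum_norm_le (R : numDomainType) M (G : int -> R) K :
  (forall x, (`|x| <= M)%N -> `|G x| <= K) -> `|zsum M G| <= M.*2.+1%:R * K.
Proof.
move=> H; apply: le_trans (ler_norm_sum _ _ _) _.
apply: le_trans (_ : \sum_(i < M.*2.+1) K <= _).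
  by apply: ler_sum => i _; apply: H; have := ltn_ord i; lia.
by rewrite sumr_const card_ord mulr_natl.
Qed.

Definition parity_sign (x : int) : int := (-1) ^+ odd `|x|.

Lemma parity_signS x : parity_sign (x + 1) = - parity_sign x.
Proof.
rewrite /parity_sign; have -> : odd `|x + 1| = ~~ odd `|x| by lia.
by case: odd.
Qed.

Lemma norm_parity_sign x : `|parity_sign x| = 1.
Proof. by rewrite /parity_sign; case: odd. Qed.

Lemma le_add_mul (D : nat) (u w : int) : (0 < D)%N -> 0 <= u -> 0 <= w ->
  u <= w + D%:Z * u.
Proof. nia. Qed.

(** * Signed representation numbers of a positive definite form *)

Section AlternatingForm.
Variables (A B C : nat).
Hypothesis posdef : (B ^ 2 < 4 * A * C)%N.

Definition qform (x y : int) : int := A%:Z * x ^+ 2 + B%:Z * x * y + C%:Z * y ^+ 2.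

Lemma qform_disc x y :
  4 * A%:Z * qform x y = (2 * A%:Z * x + B%:Z * y) ^+ 2 + (4 * A * C - B ^ 2)%N%:Z * y ^+ 2.
Proof.
have -> : (4 * A * C - B ^ 2)%N%:Z = 4 * A%:Z * C%:Z - B%:Z ^+ 2 by lia.
by rewrite /qform; ring.
Qed.

Lemma qform_disc' x y :
  4 * C%:Z * qform x y = (2 * C%:Z * y + B%:Z * x) ^+ 2 + (4 * A * C - B ^ 2)%N%:Z * x ^+ 2.
Proof.
have -> : (4 * A * C - B ^ 2)%N%:Z = 4 * A%:Z * C%:Z - B%:Z ^+ 2 by lia.
by rewrite /qform; ring.
Qed.

Lemma posdef_A_gt0 : (0 < A)%N. Proof. by move: posdef; case: A. Qed.
Lemma posdef_C_gt0 : (0 < C)%N. Proof. by move: posdef; case: C => //; rewrite muln0. Qed.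

Lemma qform_bound_y (x y : int) : y ^+ 2 <= 4 * A%:Z * qform x y.
Proof. by rewrite qform_disc; apply: le_add_mul; rewrite ?sqr_ge0 // subn_gt0. Qed.

Lemma qform_bound_x (x y : int) : x ^+ 2 <= 4 * C%:Z * qform x y.
Proof. by rewrite qform_disc'; apply: le_add_mul; rewrite ?sqr_ge0 // subn_gt0. Qed.

Lemma qform_ge0 (x y : int) : 0 <= qform x y.
Proof.
have A0 := posdef_A_gt0; have := le_trans (sqr_ge0 y) (qform_bound_y x y).
by rewrite pmulr_rge0 //; lia.
Qed.

(** A common bound for the factors 4 A and 4 C in [qform_bound_y] and [qform_bound_x], so that q(x,
    y) <= N confines both coordinates at once. *)
Definition qscale : nat := 4 * (A + B + C).

Lemma qform_small (x y : int) M N : qform x y <= N%:Z -> (qscale * N < M ^ 2)%N ->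
  (`|x| < M)%N /\ (`|y| < M)%N.
Proof.
move=> h1 h2; have hx := qform_bound_x x y; have hy := qform_bound_y x y.
have := qform_ge0 x y; move: h1 h2 hx hy; rewrite /qscale; move: (qform x y) => q.
move=> h1 h2 hx hy q0.
have h3 : x ^+ 2 < M%:Z ^+ 2 by nia.
have h4 : y ^+ 2 < M%:Z ^+ 2 by nia.
by split; nia.
Qed.

Variable sg : int -> int -> int.
Hypothesis sg1 : forall x y, `|sg x y| = 1.
Hypothesis sgS : forall x y, sg (x + 1) y = - sg x y.

Definition zsum2 M (G : int -> int -> int) : int := zsum M (fun x => zsum M (G x)).

Definition signed_count_upto M n : int := zsum2 M (fun x y => if qform x y == n%:Z then sg x y else 0).

(* [6 * 'C(u + 3, 3)], the weight of third order Cesaro summation. *)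
Definition cesaro_weight (u : int) : int := if 0 <= u then (u + 1) * (u + 2) * (u + 3) else 0.

(** A shift of x by one negates an alternating sum, so the third difference acts on it as (1 + 1)^3
    = 8. The margin 3 in the hypothesis ensures that no shift moves a nonzero term out of the
    box. *)
Lemma alternating_diff3 M (G : int -> int -> int) :
  (forall x y, (M <= `|x| + 3)%N -> G x y = 0) ->
  8 * zsum2 M (fun x y => sg x y * G x y) =
  zsum2 M (fun x y => sg x y * (G x y - 3 * G (x + 1) y + 3 * G (x + 2) y - G (x + 3) y)).
Proof.
move=> G0.
have sh (j : nat) : (j <= 3)%N ->
  zsum2 M (fun x y => sg x y * G (x + j%:Z) y) =
  (-1) ^+ j * zsum2 M (fun x y => sg x y * G x y).
  elim: j => [|j IH] hj.
    rewrite expr0 mul1r; apply: eq_zsum => x; apply: eq_zsum => y; by rewrite addr0.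
  rewrite exprS -mulrA -IH ?(ltnW hj) // mulN1r.
  have := @zsum_shift _ M (fun x => zsum M (fun y => sg x y * G (x + j%:Z) y)).
  rewrite /zsum2 => <-; last first.
    by move=> x hx; apply: zsum0 => y; rewrite G0 ?mulr0 //; lia.
  rewrite -[RHS]zsumN; apply: eq_zsum => x; rewrite -zsumN; apply: eq_zsum => y.
  by rewrite sgS mulNr opprK; congr (_ * G _ _); lia.
have e1 := sh 1%N isT; have e2 := sh 2%N isT; have e3 := sh 3%N isT.
have -> : 8 * zsum2 M (fun x y => sg x y * G x y) =
  zsum2 M (fun x y => sg x y * G x y) - (zsum2 M (fun x y => sg x y * G (x + 1) y) *+ 3)
  + zsum2 M (fun x y => sg x y * G (x + 2) y) *+ 3 - zsum2 M (fun x y => sg x y * G (x + 3) y).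
  by rewrite e1 e2 e3; ring.
rewrite !mulrS mulr0n !addr0 /zsum2 -!zsumD -!zsumN -!zsumD.
apply: eq_zsum => x; rewrite -!zsumD -!zsumN -!zsumD.
by apply: eq_zsum => y; ring.
Qed.

(** The cubic vanishes at -1, -2 and -3, so cutting it off below 0 changes nothing down to -3. *)
Lemma cesaro_weightE (u : int) : -3 <= u -> cesaro_weight u = (u + 1) * (u + 2) * (u + 3).
Proof.
move=> h; rewrite /cesaro_weight; case: ifP => // h2.
have : [|| u == -1, u == -2 | u == -3] by lia.
by case/or3P => /eqP ->; ring.
Qed.

Lemma norm_mul_le (x y a b : int) : `|x| <= a -> `|y| <= b -> `|x * y| <= a * b.
Proof. by move=> h1 h2; rewrite normrM; apply: ler_pM. Qed.

Lemma lin_form_bound (a b c M : nat) (x y : int) : (`|x| <= M)%N -> (`|y| <= M)%N ->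
  `|2 * a%:Z * x + b%:Z * y| <= (4 * (a + b + c))%N%:Z * M%:Z.
Proof.
move=> hx hy; have : `|2 * a%:Z * x| <= (2 * a%:Z) * M%:Z by apply: norm_mul_le; lia.
have : `|b%:Z * y| <= b%:Z * M%:Z by apply: norm_mul_le; lia.
by move: (_ * x) (_ * y) => u v; clear; nia.
Qed.

Lemma cesaro_weight_le (u X : int) : 1 <= X -> u <= 12 * X -> 0 <= cesaro_weight u <= (15 * X) ^+ 3.
Proof.
move=> X1 hu; rewrite /cesaro_weight; case: ifP => h0; last first.
  by rewrite lexx exprn_ge0 //; lia.
apply/andP; split; first by rewrite !mulr_ge0 //; lia.
have -> : (15 * X) ^+ 3 = (15 * X) * (15 * X) * (15 * X) by ring.
by apply: ler_pM; rewrite ?mulr_ge0 //; try lia; apply: ler_pM; lia.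
Qed.

(** To be read with u = N - q(x, y), l = 2 A x + B y and a = A, so that the four arguments are N -
    q(x + j, y) for j = 0, ..., 3. If all of them lie in the range of the polynomial, u^2 cancels
    and u survives only in the products u a l and u a a. Otherwise one argument is below -3; any two
    differ by at most 12 X, so all are at most 12 X and each weight is small by itself. *)
Lemma cesaro_weight_diff3 (u l a X : int) : 1 <= X -> `|l| <= X -> 0 <= a <= X -> `|u * a| <= X ^+ 2 ->
  `|cesaro_weight u - 3 * cesaro_weight (u - l - a) + 3 * cesaro_weight (u - 2 * l - 4 * a) - cesaro_weight (u - 3 * l - 9 * a)|
    <= 8 * (15 * X) ^+ 3.
Proof.
move=> X1 hl /andP[a0 ha] hua.
have X3 : 1 <= X ^+ 3 by rewrite -[1](expr1n _ 3); apply: lerXn2r; rewrite ?nnegrE; lia.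
have X15 : 200 * X ^+ 3 <= (15 * X) ^+ 3.
  have -> : (15 * X) ^+ 3 = 225 * (15 * X ^+ 3) by ring.
  lia.
case: (boolP [&& -3 <= u, -3 <= u - l - a, -3 <= u - 2 * l - 4 * a & -3 <= u - 3 * l - 9 * a]).
  case/and4P => /cesaro_weightE -> /cesaro_weightE -> /cesaro_weightE -> /cesaro_weightE ->.
  have -> : (u + 1) * (u + 2) * (u + 3) - 3 * ((u - l - a + 1) * (u - l - a + 2) * (u - l - a + 3)) +
    3 * ((u - 2 * l - 4 * a + 1) * (u - 2 * l - 4 * a + 2) * (u - 2 * l - 4 * a + 3)) -
    (u - 3 * l - 9 * a + 1) * (u - 3 * l - 9 * a + 2) * (u - 3 * l - 9 * a + 3) =
    - 36 * (u * a * l) - 108 * (u * a * a) + 6 * (l * l * l) + 108 * (l * l * a)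
    + 450 * (l * a * a) + 540 * (a * a * a) - 72 * (l * a) - 216 * (a * a) by ring.
  have na : `|a| <= X by lia.
  have m1 := norm_mul_le hua hl; have m2 := norm_mul_le hua na.
  have ll := norm_mul_le hl hl; have la := norm_mul_le hl na; have aa := norm_mul_le na na.
  have m3 := norm_mul_le ll hl; have m4 := norm_mul_le ll na; have m5 := norm_mul_le la na.
  have m6 := norm_mul_le aa na.
  have E : X * X * X = X ^+ 3 by ring.
  have E2 : X ^+ 2 * X = X ^+ 3 by ring.
  have XX : X * X <= X ^+ 3 by rewrite -E ler_peMr // mulr_ge0; lia.
  rewrite E2 in m1 m2; rewrite E in m3 m4 m5 m6.
  move: m1 m2 m3 m4 m5 m6 la aa XX X3 X15.
  move: (u * a * l) (u * a * a) (l * l * l) (l * l * a) (l * a * a) (a * a * a) (l * a) (a * a) (X * X) (X ^+ 3) ((15 * X) ^+ 3).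
  move=> *; lia.
move=> hneg.
have [h0 h1 h2 h3] : [/\ u <= 12 * X, u - l - a <= 12 * X, u - 2 * l - 4 * a <= 12 * X
   & u - 3 * l - 9 * a <= 12 * X].
  by split; lia.
move: (cesaro_weight_le X1 h0) (cesaro_weight_le X1 h1) (cesaro_weight_le X1 h2) (cesaro_weight_le X1 h3).
move: (cesaro_weight u) (cesaro_weight (u - l - a)) (cesaro_weight (u - 2 * l - 4 * a)) (cesaro_weight (u - 3 * l - 9 * a)) ((15 * X) ^+ 3) => *; lia.
Qed.

(** Large enough for X = [qscaleK] * t to satisfy the hypotheses of [cesaro_weight_diff3] at every
    point of the box of half-width [qscale] * t + 4. *)
Definition qscaleK : nat := (qscale * (qscale + 4) ^ 2).+1.

(* The alternating sign turns the weight, of size [t ^ 6], into its third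
   difference along [x], of size only [t ^ 3], over [O(t ^ 2)] points. *)
Lemma alternating_cesaro_bound (N t : nat) : (0 < t)%N -> (N < t ^ 2)%N ->
  `|8 * zsum2 (qscale * t + 4) (fun x y => sg x y * cesaro_weight (N%:Z - qform x y))| <=
  ((qscale.*2 + 9) ^ 2 * (8 * (15 * qscaleK) ^ 3))%N%:Z * t%:Z ^+ 5.
Proof.
move=> t0 Nt; set M := (_ + 4)%N; have A0 := posdef_A_gt0; have C0 := posdef_C_gt0.
have q0 : (0 < qscale)%N by rewrite /qscale; lia.
rewrite alternating_diff3; last first.
  move=> x y hx; rewrite /cesaro_weight ifF //; apply/negP => h.
  have [||h2 _] := @qform_small x y (qscale * t).+1 N; [lia | nia |].
  by rewrite /M in hx; lia.
pose X : int := (qscaleK * t)%N%:Z.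
have X1 : 1 <= X by rewrite /X /qscaleK; nia.
pose K2 : int := M.*2.+1%:Z * (8 * (15 * X) ^+ 3).
have MK : (M <= (qscale + 4) * t)%N by rewrite /M; nia.
have q1 : (qscale = 4 * (A + B + C))%N by [].
have H : `|zsum2 M (fun x y => sg x y * (cesaro_weight (N%:Z - qform x y) - 3 * cesaro_weight (N%:Z - qform (x + 1) y)
    + 3 * cesaro_weight (N%:Z - qform (x + 2) y) - cesaro_weight (N%:Z - qform (x + 3) y)))| <= M.*2.+1%:R * K2.
  apply: zsum_norm_le => x hx; rewrite /K2.
  have -> : M.*2.+1%:Z = M.*2.+1%:R by rewrite natz.
  apply: zsum_norm_le => y hy; rewrite normrM sg1 mul1r.
  pose l := 2 * A%:Z * x + B%:Z * y.
  have e1 : N%:Z - qform (x + 1) y = (N%:Z - qform x y) - l - A%:Z by rewrite /qform /l; ring.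
  have e2 : N%:Z - qform (x + 2) y = (N%:Z - qform x y) - 2 * l - 4 * A%:Z by rewrite /qform /l; ring.
  have e3 : N%:Z - qform (x + 3) y = (N%:Z - qform x y) - 3 * l - 9 * A%:Z by rewrite /qform /l; ring.
  rewrite e1 e2 e3; apply: cesaro_weight_diff3 => //.
  - have h1 : `|l| <= qscale%:Z * M%:Z by apply: lin_form_bound.
    apply: le_trans h1 _; rewrite /X /qscaleK; nia.
  - rewrite /X /qscaleK; nia.
  - have n0 := qform_ge0 x y.
    have n1 : qform x y <= qscale%:Z * M%:Z ^+ 2.
      have hxx : x ^+ 2 <= M%:Z ^+ 2 by rewrite -[x ^+ 2]real_normK ?num_real // lerXn2r ?nnegrE //; lia.
      have hyy : y ^+ 2 <= M%:Z ^+ 2 by rewrite -[y ^+ 2]real_normK ?num_real // lerXn2r ?nnegrE //; lia.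
      have hxy : `|x * y| <= M%:Z * M%:Z by apply: norm_mul_le; lia.
      rewrite /qform q1 -mulrA.
      have -> : M%:Z ^+ 2 = M%:Z * M%:Z by ring.
      have := expr2 M%:Z; move: hxx hyy hxy; move: (x ^+ 2) (y ^+ 2) (x * y) => a b c.
      move: (M%:Z ^+ 2) => m2 ? ? ? E; nia.
    have n2 : `|N%:Z - qform x y| <= qscaleK%:Z * t%:Z ^+ 2.
      have h3 : qscale%:Z * M%:Z ^+ 2 <= (qscale * (qscale + 4) ^ 2)%N%:Z * t%:Z ^+ 2.
        have -> : (qscale * (qscale + 4) ^ 2)%N%:Z * t%:Z ^+ 2 =
          qscale%:Z * ((qscale + 4) * t)%N%:Z ^+ 2 by lia.
        by apply: ler_wpM2l => //; apply: lerXn2r; rewrite ?nnegrE //; lia.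
      rewrite /qscaleK; set qk := (qscale * _)%N in h3 *.
      have : N%:Z < t%:Z ^+ 2 by lia.
      have -> : qk.+1%:Z * t%:Z ^+ 2 = qk%:Z * t%:Z ^+ 2 + t%:Z ^+ 2.
        by rewrite -addn1 PoszD mulrDl mul1r.
      move: h3 n1 n0; clear; move: (_ * M%:Z ^+ 2) (qk%:Z * t%:Z ^+ 2) (t%:Z ^+ 2) (qform x y).
      by move=> *; lia.
    apply: le_trans (_ : qscaleK%:Z * t%:Z ^+ 2 * qscaleK%:Z <= _).
      have AK : (A <= qscaleK)%N by rewrite /qscaleK q1; clear; nia.
      by apply: norm_mul_le => //; lia.
    by rewrite [leLHS](_ : _ = X ^+ 2) // /X PoszM; ring.
apply: le_trans H _; rewrite /K2 /X.
have h5 : (M.*2.+1 <= (qscale.*2 + 9) * t)%N by rewrite /M; nia.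
have -> : ((qscale.*2 + 9) ^ 2 * (8 * (15 * qscaleK) ^ 3))%N%:Z * t%:Z ^+ 5 =
  ((qscale.*2 + 9) * t)%N%:Z * (((qscale.*2 + 9) * t)%N%:Z * (8 * (15 * (qscaleK * t)%N%:Z) ^+ 3)).
  by move: qscale qscaleK => q1' q2'; lia.
rewrite natz; apply: ler_pM => //; try lia.
apply: ler_wpM2r; last lia.
by rewrite mulr_ge0 // exprn_ge0.
Qed.

(** By [signed_countE] every box with M^2 > [qscale] * n gives the same value; this half-width
    qualifies for all n, including 0. *)
Definition signed_count n : int := signed_count_upto (qscale * n.+1) n.

Lemma qscale_gt0 : (0 < qscale)%N.
Proof. by have := posdef_A_gt0; rewrite /qscale; lia. Qed.

Lemma signed_count_widen M M' n : (M <= M')%N -> (qscale * n < M ^ 2)%N -> signed_count_upto M' n = signed_count_upto M n.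
Proof.
move=> MM' hM; rewrite /signed_count_upto /zsum2.
have out (x y : int) : (M < `|x|)%N || (M < `|y|)%N -> (qform x y == n%:Z) = false.
  move=> h; apply/negP => /eqP e; have [||h1 h2] := @qform_small x y M n => //.
    by rewrite e.
  by move: h; rewrite !ltnNge (ltnW h1) (ltnW h2).
rewrite (@zsum_widen _ M) //; last by move=> x hx; apply: zsum0 => y; rewrite out ?hx.
by apply: eq_zsum => x; apply: zsum_widen => // y hy; rewrite out ?hy ?orbT.
Qed.

Lemma signed_countE M n : (qscale * n < M ^ 2)%N -> signed_count_upto M n = signed_count n.
Proof.
move=> hM; have q0 := qscale_gt0.
rewrite -(signed_count_widen (leq_maxl M (qscale * n.+1)) hM).
by rewrite /signed_count -(signed_count_widen (leq_maxr M (qscale * n.+1))) //; nia.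
Qed.

Lemma bin3_cesaro_weight m : ('C(m + 3, 3) * 6)%N%:Z = cesaro_weight m%:Z.
Proof.
have := bin_ffact (m + 3) 3; rewrite (_ : 3`! = 6)%N // => ->.
rewrite cesaro_weightE; last lia.
rewrite !ffactnS ffactn0 muln1.
have -> : (m + 3).-1.-1 = (m + 1)%N by lia.
have -> : (m + 3).-1 = (m + 2)%N by lia.
lia.
Qed.

Lemma signed_count_cesaro M N : (qscale * N < M ^ 2)%N ->
  \sum_(n < N.+1) ('C(N - n + 3, 3) * 6)%N%:Z * signed_count n =
  zsum2 M (fun x y => sg x y * cesaro_weight (N%:Z - qform x y)).
Proof.
move=> hM.
transitivity (\sum_(n < N.+1) zsum2 M (fun x y =>
    if qform x y == n%:Z then sg x y * cesaro_weight (N%:Z - qform x y) else 0)).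
  apply: eq_bigr => n _; have nN : (n <= N)%N by rewrite -ltnS.
  rewrite -(@signed_countE M); last by nia.
  rewrite bin3_cesaro_weight /signed_count_upto /zsum2 /zsum mulr_sumr; apply: eq_bigr => i _.
  rewrite mulr_sumr; apply: eq_bigr => j _; case: eqP => [->|_]; last by rewrite mulr0.
  by rewrite mulrC; congr (_ * cesaro_weight _); lia.
rewrite /zsum2 /zsum exchange_big; apply: eq_bigr => i _.
rewrite exchange_big; apply: eq_bigr => j _.
set x := (_ - _ : int); set y := (_ - _ : int).
have := qform_ge0 x y; case: (leP (qform x y) N%:Z) => h h0.
  have hn : (`|qform x y| < N.+1)%N by lia.
  rewrite (bigD1 (Ordinal hn)) //= big1 ?addr0 => [|k /eqP nk].
    by rewrite ifT //; apply/eqP; lia.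
  by rewrite ifF //; apply/eqP => e; apply: nk; apply: val_inj => /=; lia.
rewrite big1 => [|k _].
  by rewrite /cesaro_weight ifF ?mulr0 //; lia.
by rewrite /cesaro_weight; case: ifP => // _; rewrite ifF ?mulr0 //; lia.
Qed.

Lemma signed_count_growth n : `|signed_count n| <= ((qscale.*2.+1 * n.+1) ^ 2)%N%:Z.
Proof.
rewrite /signed_count /signed_count_upto; set M := (_ * _)%N.
apply: le_trans (_ : M.*2.+1%:R * (M.*2.+1%:R * 1) <= _).
  apply: zsum_norm_le => x _; apply: zsum_norm_le => y _.
  by case: ifP => _; rewrite ?sg1 ?normr0.
by rewrite !natz mulr1 -PoszM mulnn lez_nat leq_sqr /M; nia.
Qed.

Section Abel.
Variable F : archiRealFieldType.

Lemma signed_count_poly_bounded : poly_bounded (fun n => (signed_count n)%:~R : F).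
Proof.
exists (qscale.*2.+1%:R ^+ 2), 2%N; split; first by rewrite exprn_ge0.
move=> n; have := signed_count_growth n.
by rewrite -(ler_int F) intr_norm -pmulrn natrX natrM exprMn.
Qed.

Lemma signed_count_cesaro_bound : exists K : nat, forall N t, (0 < t)%N -> (N < t ^ 2)%N ->
  `|iter 4 (@csum F) (fun n => (signed_count n)%:~R) N| <= K%:R * t%:R ^+ 5.
Proof.
exists ((qscale.*2 + 9) ^ 2 * (8 * (15 * qscaleK) ^ 3))%N => N t t0 Nt.
have := alternating_cesaro_bound t0 Nt; rewrite -signed_count_cesaro; last by have := qscale_gt0; nia.
set K := (_ * _)%N => H.
have -> : iter 4 (@csum F) (fun n => (signed_count n)%:~R) N =
  (\sum_(n < N.+1) ('C(N - n + 3, 3) * 6)%N%:Z * signed_count n)%:~R / 6.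
  rewrite csum_iter_bin rmorph_sum mulr_suml; apply: eq_bigr => n _ /=.
  by rewrite intrM -pmulrn natrM; field.
move: H; move: (\sum_(n < _) _) => S H.
have : (`|8 * S|)%:~R <= (K%:Z * t%:Z ^+ 5)%:~R :> F by rewrite ler_int.
rewrite intr_norm intrM rmorphM rmorphXn /= -!pmulrn normrM normr_nat => h.
rewrite normrM normfV normr_nat; have := normr_ge0 (S%:~R : F); lra.
Qed.

Lemma sqrt_nat N : exists t, (t ^ 2 <= N < t.+1 ^ 2)%N.
Proof.
elim: N => [|N [t ht]]; first by exists 0%N.
by case: (ltnP N.+1 (t.+1 ^ 2)) => h; [exists t | exists t.+1]; lia.
Qed.

(** With t the integer square root of N, the fourfold partial sums are O(t^5), while the binomial
    weights grow like t^6 / 6. *)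
Lemma signed_count_abel : abel_sum (fun n => (signed_count n)%:~R : F) 0.
Proof.
apply: (@cesaro_abel0 _ _ 2) signed_count_poly_bounded _ => e e0.
have [K HK] := signed_count_cesaro_bound.
(* 192 = 2^5 * 6: the power of 2 comes from t + 1 <= 2 t, the 6 from N^3 <= 6 ['C(N + 3, 3)]. The
   range t <= T goes into the additive constant. *)
have T0 : 0 <= 192 * K%:R / e by rewrite divr_ge0 ?mulr_ge0 // ltW.
pose T := (Num.bound (192 * K%:R / e)).+1.
have hT : 192 * K%:R <= e * T%:R.
  have := archi_boundP T0; rewrite ltr_pdivrMr // => h.
  apply: le_trans (ltW h) _; rewrite mulrC; apply: ler_wpM2l; first exact: ltW.
  by rewrite ler_nat.
exists (K%:R * T.+1%:R ^+ 5); first by rewrite mulr_ge0 ?exprn_ge0.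
move=> N; have [t /andP[tN Nt]] := sqrt_nat N.
apply: le_trans (HK N t.+1 _ Nt) _ => //.
case: (leqP t T) => tT.
  apply: le_trans (_ : K%:R * T.+1%:R ^+ 5 <= _).
    by apply: ler_wpM2l => //; apply: lerXn2r; rewrite ?nnegrE // ler_nat.
  by rewrite lerDr mulr_ge0 // ltW.
apply: le_trans (_ : e * 'C(N + 3, 3)%:R <= _); last first.
  by rewrite lerDl mulr_ge0 ?exprn_ge0.
have t0 : (0 < t)%N by rewrite (leq_trans _ tT).
have h1 : t.+1%:R ^+ 5 <= (2 * t%:R) ^+ 5 :> F.
  by apply: lerXn2r; rewrite ?nnegrE ?mulr_ge0 // -natrM ler_nat; lia.
have h2 : t%:R ^+ 6 <= 6 * 'C(N + 3, 3)%:R :> F.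
  rewrite -natrX -natrM ler_nat mulnC.
  have := bin3_cesaro_weight N; rewrite cesaro_weightE; last lia.
  move=> h; have : (N ^ 3 <= 'C(N + 3, 3) * 6)%N by nia.
  apply: leq_trans; rewrite (_ : 6 = 2 * 3)%N // expnM leq_exp2r //.
apply: le_trans (_ : K%:R * (2 * t%:R) ^+ 5 <= _); first exact: ler_wpM2l.
apply: le_trans (_ : e * (t%:R ^+ 6 / 6) <= _); last first.
  by apply: ler_wpM2l; [exact: ltW | lra].
have h3 : 192 * K%:R <= e * t%:R.
  apply: le_trans hT _; apply: ler_wpM2l; first exact: ltW.
  by rewrite ler_nat ltnW.
have -> : K%:R * (2 * t%:R) ^+ 5 = (192 * K%:R) * (t%:R ^+ 5 / 6) :> F by field.
have -> : e * (t%:R ^+ 6 / 6) = (e * t%:R) * (t%:R ^+ 5 / 6) by field.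
by apply: ler_wpM2r => //; rewrite divr_ge0 ?exprn_ge0.
Qed.

End Abel.
End AlternatingForm.

Lemma zsum_delta M (x0 : int) (G : int -> int) : (`|x0| <= M)%N ->
  zsum M (fun x => if x == x0 then G x else 0) = G x0.
Proof.
move=> h; have hi : (absz (x0 + M%:Z)%R < M.*2.+1)%N by lia.
rewrite /zsum (bigD1 (Ordinal hi)) //= big1 => [|i /eqP ne].
  have -> : (absz (x0 + M%:Z))%:Z - M%:Z = x0 by lia.
  by rewrite eqxx addr0.
rewrite ifF //; apply/eqP => e; apply: ne; apply: val_inj => /=; lia.
Qed.

(** The two points differ because one coordinate is nonzero. They will stand for a generator and its
    negative, that is, for the units 1 and -1. *)
Lemma zsum2_pair M (x0 y0 : int) : (`|x0| <= M)%N -> (`|y0| <= M)%N -> (x0 != 0) || (y0 != 0) ->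
  zsum2 M (fun x y => (((x == x0) && (y == y0)) || ((x == - x0) && (y == - y0)) : nat)%:Z) = 2.
Proof.
move=> hx hy nz.
have E (u v : int) : (`|u| <= M)%N -> (`|v| <= M)%N ->
    zsum2 M (fun x y => if x == u then (if y == v then 1 else 0 : int) else 0 : int) = 1.
  move=> hu hv; transitivity (zsum M (fun x => if x == u then zsum M (fun y => if y == v then 1 else 0 : int) else 0 : int)).
    apply: eq_zsum => x; case: eqP => // _; exact: zsum0.
  by rewrite zsum_delta // zsum_delta.
have e1 := E x0 y0 hx hy; have e2 : zsum2 M (fun x y => if x == - x0 then
  (if y == - y0 then 1 else 0 : int) else 0 : int) = 1 by apply: E; rewrite abszN.
rewrite -[RHS]/(1 + 1 : int) -[X in _ = X + _]e1 -[X in _ = _ + X]e2.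
rewrite /zsum2 -zsumD; apply: eq_zsum => x; rewrite -zsumD; apply: eq_zsum => y.
by move: nz; case: (x =P x0); case: (y =P y0); case: (x =P - x0); case: (y =P - y0) => //=; clear; lia.
Qed.

(** * Unsigned representation numbers *)

Section RepresentationNumbers.
Variables (A B C : nat).
Hypothesis posdef : (B ^ 2 < 4 * A * C)%N.

Definition form_count := signed_count A B C (fun _ _ => 1).

Lemma form_countE M n : (qscale A B C * n < M ^ 2)%N ->
  zsum2 M (fun x y => if qform A B C x y == n%:Z then 1 else 0) = form_count n.
Proof. exact: signed_countE. Qed.

(* [(-1) ^ x + (-1) ^ y + (-1) ^ (x + y)] is [3] if [x] and [y] are both even
   and [-1] otherwise. *)
Lemma form_count_alternating n :
  signed_count A B C (fun x _ => parity_sign x) n + signed_count C B A (fun x _ => parity_sign x) n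
  + signed_count A B C (fun x y => parity_sign (x + y)) n =
  (if (4 %| n)%N then 4 * form_count (n %/ 4) else 0) - form_count n.
Proof.
pose M := (qscale A B C * n.+1)%N; have q0 := qscale_gt0 posdef.
have hM : (qscale A B C * n < M.*2 ^ 2)%N by rewrite /M; nia.
have hM4 : (qscale A B C * (n %/ 4) < M ^ 2)%N.
  by have := leq_div n 4; rewrite /M; nia.
have posdef' : (B ^ 2 < 4 * C * A)%N by rewrite mulnAC.
have hM' : (qscale C B A * n < M.*2 ^ 2)%N.
  by rewrite (_ : qscale C B A = qscale A B C) // /qscale addnAC addnC addnA addnAC; lia.
rewrite -!(signed_countE posdef _ hM) -(signed_countE posdef' _ hM') -(form_countE hM) -(form_countE hM4).
(* The sign (-1)^y is handled through the form with the variables exchanged, because the Cesaro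
   estimate takes differences along the first variable only. *)
have -> : signed_count_upto C B A (fun x _ => parity_sign x) M.*2 n =
  zsum2 M.*2 (fun x y => if qform A B C x y == n%:Z then parity_sign y else 0).
  rewrite /signed_count_upto /zsum2 zsum_exchange; apply: eq_zsum => x; apply: eq_zsum => y.
  by rewrite (_ : qform C B A y x = qform A B C x y) // /qform; ring.
apply/eqP; rewrite -subr_eq opprK; apply/eqP.
transitivity (zsum2 M.*2 (fun x y =>
    if qform A B C x y == n%:Z then (if odd `|x| || odd `|y| then 0 else 4) else 0)).
  rewrite /signed_count_upto /zsum2 -!zsumD; apply: eq_zsum => x.
  rewrite -!zsumD; apply: eq_zsum => y; case: ifP => _ //.
  rewrite /parity_sign; have -> : odd `|x + y| = odd `|x| (+) odd `|y| by lia.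
  by case: (odd `|x|); case: (odd `|y|).
rewrite /zsum2 zsum_even => [|x ox]; last first.
  by apply: zsum0 => y; rewrite ox; case: ifP.
transitivity (zsum2 M (fun x y => if qform A B C (2 * x) (2 * y) == n%:Z then 4 else 0)).
  apply: eq_zsum => x; rewrite zsum_even => [|y oy]; last by rewrite oy orbT; case: ifP.
  apply: eq_zsum => y; have -> : odd `|2 * x| || odd `|2 * y| = false by lia.
  by [].
have E x y : qform A B C (2 * x) (2 * y) = 4 * qform A B C x y by rewrite /qform; ring.
case: ifP => h4.
  rewrite /zsum2 /zsum mulr_sumr; apply: eq_bigr => i _; rewrite mulr_sumr; apply: eq_bigr => j _.
  rewrite E; set q := qform _ _ _ _ _.
  have -> : (4 * q == n%:Z) = (q == (n %/ 4)%N%:Z) by move: h4; clear; lia.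
  by case: ifP; rewrite ?mulr1 ?mulr0.
apply: zsum0 => x; apply: zsum0 => y; rewrite E ifF //.
by move: h4; move: (qform _ _ _ _ _) => q; clear; lia.
Qed.

Lemma form_count_abel (F : archiRealFieldType) :
  abel_sum (fun n => (form_count n)%:~R - (if (4 %| n)%N then 4 * (form_count (n %/ 4))%:~R else 0) : F) 0.
Proof.
have posdef' : (B ^ 2 < 4 * C * A)%N by rewrite mulnAC.
have sgx : forall x y : int, parity_sign (x + 1) = - parity_sign x by move=> x _; exact: parity_signS.
have sgxy (x y : int) : parity_sign (x + 1 + y) = - parity_sign (x + y) by rewrite addrAC parity_signS.
have n1 (x y : int) : `|parity_sign x| = 1 by exact: norm_parity_sign.
have h1 := @signed_count_abel _ _ _ posdef (fun x _ => parity_sign x) n1 sgx F.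
have h2 := @signed_count_abel _ _ _ posdef' (fun x _ => parity_sign x) n1 sgx F.
have h3 := @signed_count_abel _ _ _ posdef (fun x y => parity_sign (x + y)) (fun x y => norm_parity_sign _) sgxy F.
have := abelZ (-1) (abelD (abelD h1 h2) h3); rewrite !addr0 mulr0.
apply: abel_ext => n; rewrite -!rmorphD form_count_alternating /= rmorphB /=.
by case: ifP => _; rewrite ?intrM ?rmorph0; ring.
Qed.

End RepresentationNumbers.

(** * The Abel sum attached to a periodic character *)

Section EtaTwist.
Variables (F : archiRealFieldType) (d : nat) (chi : nat -> F).
Implicit Types x s : F.
Hypotheses (d_gt0 : (0 < d)%N) (chi_per : forall n, chi (d + n)%N = chi n).
Hypotheses (chi_0 : chi 0 = 0) (chi_le1 : forall n, `|chi n| <= 1).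
Hypothesis chi_sum : \sum_(r < d) chi r = 0.

(* The Dirichlet coefficients of [eta(s) L(s, chi)], [eta] the alternating zeta function. *)
Definition eta_conv n : F := \sum_(1 <= m < n.+1 | (m %| n)%N) (-1) ^+ (n %/ m).-1 * chi m.

(* The value [L(0, chi)]. *)
Definition L_zero : F := - (\sum_(r < d) r%:R * chi r) / d%:R.

(** Since x / (1 + x) = x - x^2 + x^3 - ..., the power series of [eta_conv] is the Lambert series
    with terms chi(m) phi(s^m). *)
Definition phi (x : F) : F := x / (1 + x).

Lemma phi_le x : 0 <= x -> 0 <= phi x <= x.
Proof.
move=> x0; rewrite /phi divr_ge0 /=; [|lra|lra].
rewrite ler_pdivrMr; [nra|lra].
Qed.

Lemma alt_geom x J : 0 <= x ->
  `|\sum_(j < J) (-1) ^+ j * x ^+ j.+1 - phi x| <= x ^+ J.+1.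
Proof.
move=> x0; have x1 : 1 + x != 0 by rewrite gt_eqF //; lra.
have -> : \sum_(j < J) (-1) ^+ j * x ^+ j.+1 - phi x = - ((-1) ^+ J * x ^+ J.+1 / (1 + x)).
  elim: J => [|J IH]; first by rewrite big_ord0 /phi sub0r expr0 mul1r expr1.
  rewrite big_ord_recr /= addrAC IH !exprS; field.
  by [].
rewrite normrN normrM normfV normrM normrX normrN1 expr1n mul1r.
rewrite [ `|1 + x|]ger0_norm; last lra.
rewrite [ `|x ^+ _|]ger0_norm ?exprn_ge0 //.
rewrite ler_pdivrMr; last lra.
by rewrite ler_peMr ?exprn_ge0 //; lra.
Qed.

Lemma psum_divisors s N :
  psum eta_conv s N = \sum_(1 <= m < N) chi m *
     \sum_(j < N.-1 %/ m) (-1) ^+ j * s ^+ (m * j.+1).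
Proof.
elim: N => [|N IH]; first by rewrite /psum big_ord0 big_geq.
rewrite /psum big_ord_recr -/(psum _ _ _) /= IH.
case: N {IH} => [|N]; first by rewrite /eta_conv !big_geq // add0r mul0r.
rewrite [RHS]big_nat_recr //= divnn /= big_ord1 expr0 mul1r muln1.
rewrite /eta_conv mulr_suml.
rewrite [X in _ + X = _]big_mkcond [X in _ + X = _]big_nat_recr //= dvdnn divnn /= expr0 mul1r addrA; congr (_ + _).
rewrite -big_split /= big_nat [RHS]big_nat; apply: eq_bigr => m /andP[m0 mN].
have Nm := divn_pred N.+1 m; rewrite /= in Nm.
case: ifP => h; rewrite h in Nm.
  have E : (N.+1 %/ m = (N %/ m).+1)%N.
    by rewrite Nm subn1 prednK // divn_gt0 // ltnW.
  rewrite E big_ord_recr /= mulrDr; congr (_ + _).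
  have -> : (m * (N %/ m).+1 = N.+1)%N by rewrite -E mulnC divnK.
  by ring.
by rewrite addr0 Nm subn0.
Qed.

Lemma psum_eta_near s N : 0 < s -> s < 1 ->
  `|psum eta_conv s N - \sum_(1 <= m < N) chi m * phi (s ^+ m)| <= N%:R * s ^+ N.
Proof.
move=> s0 s1; rewrite psum_divisors -sumrB.
apply: le_trans (ler_norm_sum _ _ _) _.
apply: le_trans (_ : \sum_(1 <= m < N) s ^+ N <= _); last first.
  rewrite sumr_const_nat -[leLHS]mulr_natl ler_wpM2r ?exprn_ge0 ?ler_nat ?leq_subr //.
  exact: ltW.
rewrite big_nat [leRHS]big_nat; apply: ler_sum => m /andP[m0 mN].
rewrite -mulrBr normrM -[leRHS]mul1r; apply: ler_pM => //.
under eq_bigr do rewrite exprM.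
apply: le_trans (alt_geom _ _) _; first by rewrite exprn_ge0 ?ltW.
rewrite -exprM; apply: ler_wiXn2l; [exact: ltW | exact: ltW |].
have := ltn_ceil N.-1 m0; rewrite mulnC; lia.
Qed.

Lemma one_subX_le s r : 0 <= s -> s <= 1 -> 0 <= 1 - s ^+ r <= r%:R * (1 - s).
Proof.
move=> s0 s1; rewrite subr_ge0 exprn_ile1 //=.
have := @bernoulli_le F (s - 1) r; have -> : 1 + (s - 1) = s by ring.
by move=> /(_ ltac:(lra)); lra.
Qed.

Lemma one_subX_ge s r : 0 <= s -> s <= 1 ->
  r%:R * (1 - s) - (1 - s ^+ r) <= r%:R ^+ 2 * (1 - s) ^+ 2.
Proof.
move=> s0 s1; elim: r => [|r IH]; first by rewrite expr0; lra.
have /andP[h0 h1] := one_subX_le r s0 s1.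
rewrite exprS -natr1; have r0 : 0 <= r%:R :> F by [].
have h2 : (1 - s) * (1 - s ^+ r) <= (1 - s) * (r%:R * (1 - s)).
  by apply: ler_wpM2l => //; lra.
have h3 : 0 <= (1 - s) ^+ 2 by rewrite exprn_ge0 //; lra.
have h4 : 0 <= r%:R * (1 - s) ^+ 2 by rewrite mulr_ge0.
rewrite !expr2 in IH h3 h4 *; lra.
Qed.

(** First order expansion in 1 - s: as x phi'(x) = x / (1 + x)^2, the decrease of phi from x to x
    s^r is proportional to r up to second order. *)
Lemma phi_diff x s r : 0 <= x -> x <= 1 -> 0 <= s -> s <= 1 ->
  `|phi x - phi (x * s ^+ r) - r%:R * (1 - s) * (x / (1 + x) ^+ 2)|
  <= 3 * r%:R ^+ 2 * (1 - s) ^+ 2 * x.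
Proof.
move=> x0 x1 s0 s1.
have /andP[t0 t1] := one_subX_le r s0 s1; have t2 := one_subX_ge r s0 s1.
set t := s ^+ r in t0 t1 t2 *; set y := r%:R * (1 - s) in t1 t2 *.
have tge : 0 <= t by rewrite exprn_ge0.
have y2 : r%:R ^+ 2 * (1 - s) ^+ 2 = y ^+ 2 by rewrite /y exprMn.
have y0 : 0 <= y by rewrite mulr_ge0 //; lra.
have xt : 0 <= x * t by rewrite mulr_ge0.
have n1 : 1 + x != 0 by rewrite gt_eqF //; lra.
have n2 : 1 + x * t != 0 by rewrite gt_eqF //; lra.
have -> : phi x - phi (x * t) - y * (x / (1 + x) ^+ 2) =
   x * ((1 - t - y) + x * (1 - t - y + y * (1 - t))) / ((1 + x) ^+ 2 * (1 + x * t)).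
  rewrite /phi; field.
  by rewrite n1 n2.
have D1 : 1 <= (1 + x) ^+ 2 * (1 + x * t).
  rewrite -[1]mulr1; apply: ler_pM => //; last lra.
  by rewrite expr2; nra.
rewrite normrM normfV [ `|_ * (1 + _)|]ger0_norm; last lra.
rewrite ler_pdivrMr; last lra.
apply: le_trans (_ : 3 * r%:R ^+ 2 * (1 - s) ^+ 2 * x <= _); last first.
  by apply: ler_peMr => //; rewrite !mulr_ge0 //; lra.
rewrite normrM (ger0_norm x0) mulrC; apply: ler_wpM2r => //.
rewrite -mulrA y2; rewrite y2 in t2.
have h1 : 0 <= y * (1 - t) <= y ^+ 2.
  by rewrite expr2 mulr_ge0 //=; apply: ler_wpM2l.
move: h1 t2; move: (y ^+ 2) (y * (1 - t)) => Y Z /andP[Z0 ZY] t2.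
by rewrite ler_norml; apply/andP; split; nra.
Qed.

(** The character sums to 0 over a period, so only the decreases of phi matter. To first order the
    decrease at r is r / d times that over the whole period, and - r chi(r) / d sums to L(0,
    chi). *)
Lemma block_estimate x s : 0 <= x -> x <= 1 -> 0 <= s -> s <= 1 ->
  `|\sum_(r < d) chi r * phi (x * s ^+ r) - L_zero * (phi x - phi (x * s ^+ d))|
  <= 6 * d%:R ^+ 3 * (1 - s) ^+ 2 * x.
Proof.
move=> x0 x1 s0 s1; have d0 : d%:R != 0 :> F by rewrite pnatr_eq0 -lt0n.
have dp : 0 < d%:R :> F by rewrite ltr0n.
pose D r := phi x - phi (x * s ^+ r).
have -> : \sum_(r < d) chi r * phi (x * s ^+ r) - L_zero * (phi x - phi (x * s ^+ d)) =
   \sum_(r < d) (- (chi r * (d%:R * D r - r%:R * D d) / d%:R)).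
  have -> : \sum_(r < d) chi r * phi (x * s ^+ r) =
     \sum_(r < d) (- (chi r * D r)).
    apply/eqP; rewrite -subr_eq0 -sumrB; apply/eqP.
    transitivity (\sum_(r < d) chi r * phi x); last by rewrite -mulr_suml chi_sum mul0r.
    by apply: eq_bigr => r _; rewrite /D; ring.
  rewrite /L_zero -/(D d) -mulrA mulNr opprK mulr_suml -big_split /=.
  by apply: eq_bigr => r _; field.
apply: le_trans (ler_norm_sum _ _ _) _.
apply: le_trans (_ : \sum_(r < d) 6 * d%:R ^+ 2 * (1 - s) ^+ 2 * x <= _); last first.
  rewrite sumr_const card_ord -[leLHS]mulr_natl.
  by rewrite le_eqVlt; apply/orP; left; apply/eqP; ring.
apply: ler_sum => r _; rewrite normrN normrM normfV (ger0_norm (ltW dp)).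
rewrite ler_pdivrMr // normrM -[leRHS]mul1r; apply: ler_pM => //.
have -> : d%:R * D r - r%:R * D d =
  d%:R * (D r - r%:R * (1 - s) * (x / (1 + x) ^+ 2)) - r%:R * (D d - d%:R * (1 - s) * (x / (1 + x) ^+ 2)).
  by move: (x / _) => w; ring.
have rd : r%:R <= d%:R :> F by rewrite ler_nat ltnW.
have r0 : 0 <= r%:R :> F by [].
have P : 0 <= (1 - s) ^+ 2 * x by rewrite mulr_ge0 // exprn_ge0 //; lra.
apply: le_trans (ler_normB _ _) _; rewrite !normrM (ger0_norm r0) (ger0_norm (ltW dp)).
have h1 : `|D r - r%:R * (1 - s) * (x / (1 + x) ^+ 2)| <= 3 * d%:R ^+ 2 * ((1 - s) ^+ 2 * x).
  apply: le_trans (phi_diff r x0 x1 s0 s1) _; rewrite -[leLHS]mulrA; apply: ler_wpM2r => //.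
  by apply: ler_wpM2l => //; rewrite lerXn2r ?nnegrE.
have h2 : `|D d - d%:R * (1 - s) * (x / (1 + x) ^+ 2)| <= 3 * d%:R ^+ 2 * ((1 - s) ^+ 2 * x).
  by apply: le_trans (phi_diff d x0 x1 s0 s1) _; rewrite -[leLHS]mulrA.
have -> : 6 * d%:R ^+ 2 * (1 - s) ^+ 2 * x * d%:R =
  d%:R * (3 * d%:R ^+ 2 * ((1 - s) ^+ 2 * x)) + d%:R * (3 * d%:R ^+ 2 * ((1 - s) ^+ 2 * x)) by ring.
apply: lerD; first exact: ler_wpM2l (ltW dp) _ _ h1.
exact: ler_pM.
Qed.

Lemma chi_blocks (g : nat -> F) K :
  \sum_(m < d * K) chi m * g m = \sum_(b < K) \sum_(r < d) chi r * g (d * b + r)%N.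
Proof.
have per b n : chi (d * b + n)%N = chi n.
  by elim: b => [|b IH]; rewrite ?muln0 // mulnS -addnA chi_per.
elim: K => [|K IH]; first by rewrite muln0 !big_ord0.
rewrite big_ord_recr /= -IH mulnS addnC big_split_ord /=; congr (_ + _).
by apply: eq_bigr => r _; rewrite per.
Qed.

(** The main terms telescope, starting from phi(1) = 1 / 2. The errors, of size (1 - s)^2 s^b in
    block b, add up to O(1 - s). *)
Lemma blocks_near s K : 0 < s -> s < 1 ->
  `|\sum_(m < d * K) chi m * phi (s ^+ m) - L_zero / 2|
  <= 6 * d%:R ^+ 3 * (1 - s) + `|L_zero| * s ^+ (d * K).
Proof.
move=> s0 s1; rewrite (chi_blocks (fun m => phi (s ^+ m))).
have tele : \sum_(b < K) L_zero * (phi (s ^+ (d * b)) - phi (s ^+ (d * b) * s ^+ d)) =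
   L_zero * (1 / 2 - phi (s ^+ (d * K))).
  rewrite -mulr_sumr; congr (_ * _); elim: K => [|K IH].
    by rewrite big_ord0 muln0 expr0 /phi; field.
  by rewrite big_ord_recr /= IH -exprD -mulnSr; ring.
have -> : \sum_(b < K) \sum_(r < d) chi r * phi (s ^+ (d * b + r)) - L_zero / 2 =
  \sum_(b < K) (\sum_(r < d) chi r * phi (s ^+ (d * b) * s ^+ r)
     - L_zero * (phi (s ^+ (d * b)) - phi (s ^+ (d * b) * s ^+ d))) - L_zero * phi (s ^+ (d * K)).
  rewrite sumrB tele; under eq_bigr do under eq_bigr do rewrite exprD.
  by field.
apply: le_trans (ler_normB _ _) _; apply: lerD; last first.
  rewrite normrM; apply: ler_wpM2l => //.
  have /andP[p0 p1] := phi_le (exprn_ge0 (d * K) (ltW s0)).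
  by rewrite ger0_norm.
apply: le_trans (ler_norm_sum _ _ _) _.
apply: le_trans (_ : \sum_(b < K) 6 * d%:R ^+ 3 * (1 - s) ^+ 2 * s ^+ b <= _).
  apply: ler_sum => b _.
  apply: le_trans (block_estimate _ _ _ _) _; rewrite ?exprn_ge0 ?exprn_ile1 ?(ltW s0) ?(ltW s1) //.
  apply: ler_wpM2l; first by rewrite !mulr_ge0 //; lra.
  apply: ler_wiXn2l; [exact: ltW | exact: ltW | exact: leq_pmull].
rewrite -mulr_sumr; have := geom_partial K (ltW s0) s1; set G := \sum_(_ < _) _ => hG.
apply: le_trans (_ : 6 * d%:R ^+ 3 * (1 - s) ^+ 2 * (1 - s)^-1 <= _).
  by apply: ler_wpM2l => //; rewrite !mulr_ge0 //; lra.
by rewrite expr2 mulrA mulfK // subr_eq0 gt_eqF.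
Qed.

Lemma eta_abel : abel_sum eta_conv (L_zero / 2).
Proof.
move=> e e0; have e4 : 0 < e / 4 by lra.
have Z0 : 0 < 6 * d%:R ^+ 3 + 1 :> F by rewrite ltr_wpDl // mulr_ge0 // exprn_ge0.
exists (e / 4 / (6 * d%:R ^+ 3 + 1)); first by rewrite divr_gt0.
move=> s s0 s1 sd.
have pb1 : poly_bounded (fun n => n%:R : F).
  by exists 1, 1%N; split => // n; rewrite mul1r expr1 normr_nat ler_nat.
have [N1 H1] := poly_bounded_small pb1 s0 s1 e4.
have L1 : 0 < `|L_zero| + 1 by rewrite ltr_wpDl.
have [|N2 H2] := @expr_small F s (e / 4 / (`|L_zero| + 1)) (ltW s0) s1; first by rewrite divr_gt0.
have dp : 0 < d%:R :> F by rewrite ltr0n.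
have [|N3 H3] := @expr_small F s (e / 4 / d%:R) (ltW s0) s1; first by rewrite divr_gt0.
(* Four errors of e / 4 each: the passage to the Lambert series ([N1]), the end of the telescoping
   sum ([N2]), the incomplete last period ([N3]) and the blocks (s close to 1). *)
exists (N1 + d * (N2 + N3).+1)%N => N hN.
have n1 : (N1 <= N)%N by apply: leq_trans hN; exact: leq_addr.
have N0 : (0 < N)%N by move: hN d_gt0; clear; nia.
have := H1 N n1; rewrite normr_nat => h1.
have h0 := psum_eta_near N s0 s1.
pose K := (N %/ d)%N; have NK := divn_eq N d.
have rd : (N %% d < d)%N by rewrite ltn_mod.
have K1 : (N2 + N3 < K)%N.
  by rewrite leq_divRL // mulnC; lia.
have dK : (N2 + N3 <= d * K)%N by nia.
have dK2 := leq_trans (leq_addr N3 N2) dK; have dK3 := leq_trans (leq_addl N2 N3) dK.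
have h2 := blocks_near K s0 s1.
have h3 : `|L_zero| * s ^+ (d * K) <= e / 4.
  have := H2 (d * K)%N dK2; rewrite ler_pdivlMr // => h.
  apply: le_trans h; rewrite mulrC; apply: ler_wpM2l; first by rewrite exprn_ge0 ?(ltW s0).
  by rewrite lerDl.
have h4 : `|\sum_(1 <= m < N) chi m * phi (s ^+ m) - \sum_(m < d * K) chi m * phi (s ^+ m)| <= e / 4.
  have -> : \sum_(1 <= m < N) chi m * phi (s ^+ m) = \sum_(m < N) chi m * phi (s ^+ m).
    by rewrite -(big_mkord xpredT (fun m => chi m * phi (s ^+ m))) big_ltn // chi_0 mul0r add0r.
  have EN M : M = (d * K + N %% d)%N -> \sum_(m < M) chi m * phi (s ^+ m) =
      \sum_(m < d * K) chi m * phi (s ^+ m)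
      + \sum_(i < N %% d) chi (d * K + i)%N * phi (s ^+ (d * K + i)).
    by move=> ->; rewrite big_split_ord.
  have EN' : N = (d * K + N %% d)%N by rewrite mulnC.
  rewrite (EN N EN') addrAC subrr add0r.
  apply: le_trans (ler_norm_sum _ _ _) _.
  apply: le_trans (_ : \sum_(i < N %% d) s ^+ (d * K) <= _).
    apply: ler_sum => i _; rewrite normrM -[leRHS]mul1r; apply: ler_pM => //.
    have /andP[p0 p1] := phi_le (exprn_ge0 (d * K + i) (ltW s0)).
    rewrite ger0_norm //; apply: le_trans p1 _.
    by apply: ler_wiXn2l; [exact: ltW | exact: ltW | exact: leq_addr].
  rewrite sumr_const card_ord -[leLHS]mulr_natl.
  have := H3 (d * K)%N dK3; rewrite ler_pdivlMr // => h.
  apply: le_trans h; rewrite mulrC; apply: ler_wpM2l; first by rewrite exprn_ge0 ?(ltW s0).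
  by rewrite ler_nat ltnW.
have h5 : 6 * d%:R ^+ 3 * (1 - s) <= e / 4.
  have : (1 - s) * (6 * d%:R ^+ 3 + 1) <= e / 4.
    by rewrite -ler_pdivlMr //; lra.
  apply: le_trans; rewrite mulrC; apply: ler_wpM2l; first lra.
  by rewrite lerDl.
have -> : psum eta_conv s N - L_zero / 2 =
  (psum eta_conv s N - \sum_(1 <= m < N) chi m * phi (s ^+ m))
  + (\sum_(1 <= m < N) chi m * phi (s ^+ m) - \sum_(m < d * K) chi m * phi (s ^+ m))
  + (\sum_(m < d * K) chi m * phi (s ^+ m) - L_zero / 2) by ring.
apply: le_trans (ler_normD _ _) _; have := ler_normD (psum eta_conv s N
  - \sum_(1 <= m < N) chi m * phi (s ^+ m)) (\sum_(1 <= m < N) chi m * phi (s ^+ m)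
  - \sum_(m < d * K) chi m * phi (s ^+ m)).
lra.
Qed.

End EtaTwist.

(** * Ideals of given norm and divisor sums *)

Lemma perm_divisorsM m n : (0 < m)%N -> (0 < n)%N -> coprime m n ->
  perm_eq (divisors (m * n)) [seq (x * y)%N | x <- divisors m, y <- divisors n].
Proof.
move=> m0 n0 co; have cop x y : x \in divisors m -> y \in divisors n -> coprime x y.
  rewrite -!dvdn_divisors // => xm yn; exact: coprime_dvdl xm (coprime_dvdr yn co).
apply: uniq_perm; first exact: divisors_uniq.
  apply: allpairs_uniq; rewrite ?divisors_uniq //.
  move=> [x y] [x' y'] /allpairsP[[a b] /= [ha hb [-> ->]]] /allpairsP[[a' b'] /= [ha' hb' [-> ->]]] e.
  have aa' : (a %| a')%N.
    by rewrite -(Gauss_dvdl _ (cop _ _ ha hb')) -e dvdn_mulr.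
  have a'a : (a' %| a)%N.
    by rewrite -(Gauss_dvdl _ (cop _ _ ha' hb)) e dvdn_mulr.
  have E : a = a' by apply/eqP; rewrite eqn_dvd aa' a'a.
  rewrite E in e *; congr (_, _); apply/eqP; rewrite -(@eqn_pmul2l a') ?e //.
  by move: ha'; rewrite -dvdn_divisors // => /dvdn_gt0; apply.
move=> z; rewrite -dvdn_divisors ?muln_gt0 ?m0 //; apply/idP/allpairsP.
  move=> zmn; have g0 : (0 < gcdn z m)%N by rewrite gcdn_gt0 m0 orbT.
  have zE : z = (gcdn z m * (z %/ gcdn z m))%N by rewrite mulnC divnK // dvdn_gcdl.
  exists (gcdn z m, z %/ gcdn z m)%N; split => //=; rewrite -dvdn_divisors ?dvdn_gcdr //.
  by rewrite -(dvdn_pmul2l g0) -zE muln_gcdl dvdn_gcd zmn dvdn_mulr.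
by move=> [[x y] /= [hx hy ->]]; apply: dvdn_mul; rewrite dvdn_divisors.
Qed.

Lemma perm_divisorsX q j : prime q ->
  perm_eq (divisors (q ^ j)) [seq (q ^ i)%N | i <- iota 0 j.+1].
Proof.
move=> pq; have q1 := prime_gt1 pq.
apply: uniq_perm; first exact: divisors_uniq.
  by rewrite map_inj_uniq ?iota_uniq // => x y /eqP; rewrite eqn_exp2l // => /eqP.
move=> z; rewrite -dvdn_divisors ?expn_gt0 ?(ltnW q1) //.
apply/(dvdn_pfactor _ _ pq)/mapP => [[i ij ->]|[i]].
  by exists i => //; rewrite mem_iota add0n ltnS.
by rewrite mem_iota add0n ltnS => /andP[_ ij] ->; exists i.
Qed.

(** * Roots of X^2 + X + k modulo a and the Dedekind zeta coefficients *)

Section RootCounting.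
Variable k : nat.

Definition is_root_mod (a b : nat) : bool := (a %| b ^ 2 + b + k)%N.

Definition root_count (a : nat) : nat := count (is_root_mod a) (iota 0 a).

Lemma is_root_modE a b : is_root_mod a (b %% a) = is_root_mod a b.
Proof.
rewrite /is_root_mod.
have -> : (b ^ 2 + b + k = a * ((b %/ a) * b + (b %/ a) * (b %% a) + b %/ a)
   + ((b %% a) ^ 2 + b %% a + k))%N.
  have := divn_eq b a; move: (b %/ a)%N (b %% a)%N => u v ->; lia.
by rewrite [RHS]dvdn_addr // dvdn_mulr.
Qed.

Lemma root_countM A B : (0 < A)%N -> (0 < B)%N -> coprime A B -> root_count (A * B) = (root_count A * root_count B)%N.
Proof.
move=> A0 B0 co; rewrite /root_count -!size_filter -(size_allpairs (fun x y => (x, y))).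
rewrite -(size_map (fun b => (b %% A, b %% B)%N)); apply: perm_size.
have split_root b : is_root_mod (A * B) b = is_root_mod A b && is_root_mod B b.
  exact: Gauss_dvd.
apply: uniq_perm.
- rewrite map_inj_in_uniq ?filter_uniq ?iota_uniq // => x y.
  rewrite !mem_filter !mem_iota !add0n => /andP[_ /andP[_ hx]] /andP[_ /andP[_ hy]] [e1 e2].
  have /eqP := chinese_remainder co x y; rewrite e1 e2 !eqxx /= => /eqP.
  by move/eqP; rewrite !modn_small // => /eqP.
- by apply: allpairs_uniq; rewrite ?filter_uniq ?iota_uniq // => -[? ?] [? ?] _ _.
move=> [x y]; apply/mapP/allpairsP.
  move=> [b]; rewrite mem_filter mem_iota split_root => /andP[/andP[hA hB] _] [-> ->].
  exists (b %% A, b %% B)%N => /=; split=> //.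
    by rewrite mem_filter is_root_modE hA mem_iota add0n ltn_mod.
  by rewrite mem_filter is_root_modE hB mem_iota add0n ltn_mod.
move=> [[u v] /=]; rewrite !mem_filter !mem_iota !add0n.
move=> [/andP[hA /andP[_ uA]] /andP[hB /andP[_ vB]] [-> ->]].
pose c := (chinese A B u v %% (A * B))%N.
have cA : (c %% A = u)%N.
  by rewrite /c modn_dvdm ?dvdn_mulr // chinese_modl // modn_small.
have cB : (c %% B = v)%N.
  by rewrite /c modn_dvdm ?dvdn_mull // chinese_modr // modn_small.
exists c; last by rewrite cA cB.
rewrite mem_filter split_root -(is_root_modE A) -(is_root_modE B) cA cB hA hB /=.
by rewrite mem_iota add0n ltn_mod muln_gt0 A0.
Qed.

Section PrimePower.
Variable q : nat.
Hypothesis q_prime : prime q.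

Lemma disc_root b : (4 * (b ^ 2 + b + k) = (b.*2.+1) ^ 2 + 4 * k - 1)%N.
Proof. lia. Qed.

(** Hensel lifting. By 4 (b^2 + b + k) = (2 b + 1)^2 + (4 k - 1), a prime not dividing 4 k - 1
    cannot divide the derivative 2 b + 1 at a root, so reduction is a bijection on roots. The
    argument includes q = 2. *)
Lemma root_count_lift j : ~~ (q %| 4 * k - 1)%N -> (0 < k)%N -> (0 < j)%N -> root_count (q ^ j.+1) = root_count (q ^ j).
Proof.
move=> qD k0 j0; rewrite /root_count -!size_filter.
rewrite -(size_map (fun b => b %% q ^ j)%N); apply: perm_size.
have q0 := prime_gt0 q_prime; have Q0 : (0 < q ^ j)%N by rewrite expn_gt0 q0.
have qQ : (q %| q ^ j)%N by rewrite -[X in (X %| _)%N]expn1 dvdn_exp2l.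
have unit b : (q %| b ^ 2 + b + k)%N -> coprime q b.*2.+1.
  move=> h; rewrite prime_coprime //; apply: contra qD => h2.
  have : (q %| (b.*2.+1) ^ 2 + (4 * k - 1))%N.
    by rewrite (_ : _ + _ = 4 * (b ^ 2 + b + k))%N ?dvdn_mull // disc_root; lia.
  by rewrite dvdn_addr // expnS dvdn_mulr.
apply: uniq_perm.
- rewrite map_inj_in_uniq ?filter_uniq ?iota_uniq //.
  have inj x y : (x <= y)%N -> (y < q ^ j.+1)%N -> is_root_mod (q ^ j.+1) x ->
     is_root_mod (q ^ j.+1) y -> (x %% q ^ j = y %% q ^ j)%N -> x = y.
    move=> xy yl rx ry e.
    have dxy : (q ^ j %| y - x)%N by rewrite -eqn_mod_dvd //; apply/eqP.
    have dq : (q ^ j.+1 %| (y - x) * (x + y).+1)%N.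
      have -> : ((y - x) * (x + y).+1 = (y ^ 2 + y + k) - (x ^ 2 + x + k))%N.
        by move: xy; clear; nia.
      exact: dvdn_sub.
    have co : coprime (q ^ j.+1) (x + y).+1.
      rewrite coprime_pexpl //.
      have -> : ((x + y).+1 = x.*2.+1 + (y - x))%N by move: xy; clear; lia.
      have /unit : (q %| x ^ 2 + x + k)%N.
        by apply: dvdn_trans rx; rewrite expnS dvdn_mulr.
      have /dvdnP[z ->] : (q %| y - x)%N by exact: dvdn_trans dxy.
      by rewrite addnC /coprime gcdnMDl.
    move: dq; rewrite Gauss_dvdl // => h.
    case: (posnP (y - x)) => [|hp]; first by move: xy; clear; lia.
    by have := dvdn_leq hp h; move: yl xy hp; clear; lia.
  move=> x y; rewrite !mem_filter !mem_iota !add0n.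
  move=> /andP[rx /andP[_ hx]] /andP[ry /andP[_ hy]] e.
  by case: (leqP x y) => [|/ltnW] h; [exact: inj | apply/esym; exact: inj].
- by rewrite filter_uniq ?iota_uniq.
move=> b; apply/mapP/idP.
  move=> [x]; rewrite !mem_filter !mem_iota !add0n => /andP[rx _] ->.
  rewrite is_root_modE ltn_mod Q0 leq0n !andbT.
  by apply: dvdn_trans rx; rewrite expnS dvdn_mull.
rewrite mem_filter mem_iota add0n => /andP[rb /andP[_ bl]].
have /dvdnP[u hu] := rb.
have co : coprime b.*2.+1 q.
  by rewrite coprime_sym; apply: unit; exact: dvdn_trans rb.
(* A multiple of 2 b + 1 congruent to - u modulo q. Its quotient t by 2 b + 1 solves the linear
   congruence for the correction t q^j. *)
pose z := chinese b.*2.+1 q 0 (q.-1 * u).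
have z1 : (b.*2.+1 %| z)%N by rewrite /dvdn /z chinese_modl // mod0n.
have z2 : (q %| u + z)%N.
  rewrite /dvdn -modnDmr /z chinese_modr // modnDmr.
  have -> : (u + q.-1 * u = q * u)%N by rewrite -mulSn prednK.
  by rewrite modnMr.
have /dvdnP[t ht] := z1.
exists (b + (t %% q) * q ^ j)%N; last by rewrite addnC modnMDl modn_small.
rewrite mem_filter mem_iota add0n; apply/andP; split.
  rewrite /is_root_mod.
  have -> : ((b + t %% q * q ^ j) ^ 2 + (b + t %% q * q ^ j) + k =
     q ^ j * (u + (t %% q) * b.*2.+1 + (t %% q) ^ 2 * q ^ j))%N.
    by move: hu; clear; move: (q ^ j)%N (t %% q)%N => Q T; lia.
  rewrite expnSr dvdn_pmul2l // dvdn_addl; last by rewrite dvdn_mull.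
  rewrite /dvdn -modnDmr modnMml modnDmr -ht; exact: z2.
rewrite leq0n /= expnS; have := ltn_pmod t q0; move: (t %% q)%N => T hT.
by apply: leq_trans (_ : T.+1 * q ^ j <= _)%N; [rewrite mulSn ltn_add2r | rewrite leq_mul2r hT orbT].
Qed.

(** Completing the square, a root modulo q^2 has q dividing (2 b + 1)^2, hence q^2 dividing it,
    hence q^2 dividing 4 k - 1. *)
Lemma root_count_ramified j : (0 < k)%N -> (q %| 4 * k - 1)%N -> ~~ (q ^ 2 %| 4 * k - 1)%N -> root_count (q ^ j.+2) = 0%N.
Proof.
move=> k0 qD q2D; apply/eqP; rewrite -leqn0 leqNgt -has_count; apply/hasPn => b _.
apply: contra q2D => h.
have h2 : (q ^ 2 %| 4 * (b ^ 2 + b + k))%N.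
  by rewrite dvdn_mull //; apply: dvdn_trans h; rewrite dvdn_exp2l.
have e : (4 * (b ^ 2 + b + k) = (b.*2.+1) ^ 2 + (4 * k - 1))%N by rewrite disc_root; lia.
have hq : (q %| b.*2.+1 ^ 2)%N.
  by rewrite -(dvdn_addl _ qD) -e; apply: dvdn_trans h2; rewrite expnS dvdn_mulr.
rewrite Euclid_dvdX // in hq; case/andP: hq => hq _.
have hq2 : (q ^ 2 %| b.*2.+1 ^ 2)%N by rewrite dvdn_exp2r.
by rewrite -(dvdn_addr _ hq2) -e.
Qed.

End PrimePower.

(* An ideal of norm [n] is [c (Z a + Z (b + omega))] with [c ^ 2 a = n] and [b]
   a root of [X ^ 2 + X + k] modulo [a]. *)
Definition idealcount n : nat := \sum_(c <- divisors n | (c ^ 2 %| n)%N) root_count (n %/ c ^ 2).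

Lemma idealcountM A B : (0 < A)%N -> (0 < B)%N -> coprime A B ->
  idealcount (A * B) = (idealcount A * idealcount B)%N.
Proof.
move=> A0 B0 co; rewrite /idealcount big_mkcond (perm_big _ (perm_divisorsM A0 B0 co)) /=.
rewrite big_allpairs_dep /= big_distrl /= [RHS]big_mkcond /=.
rewrite big_seq_cond [RHS]big_seq_cond; apply: eq_bigr => x; rewrite andbT => hx.
have xA : (x %| A)%N by rewrite dvdn_divisors.
case: ifP => h; last first.
  rewrite big1_seq // => y /andP[_ hy]; case: ifP => // h2; move: h.
  have yB : (y %| B)%N by rewrite dvdn_divisors.
  have : (x ^ 2 %| A * B)%N by apply: dvdn_trans h2; rewrite expnMn dvdn_mulr.
  by rewrite Gauss_dvdl ?coprimeXl // ?(coprime_dvdl xA) // => ->.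
rewrite big_distrr /= -big_mkcond big_seq_cond [RHS]big_seq_cond.
have E y : y \in divisors B -> ((x * y) ^ 2 %| A * B)%N = (y ^ 2 %| B)%N.
  move=> hy; have yB : (y %| B)%N by rewrite dvdn_divisors.
  apply/idP/idP => [h2|h2]; last by rewrite expnMn dvdn_mul.
  have : (y ^ 2 %| A * B)%N by apply: dvdn_trans h2; rewrite expnMn dvdn_mull.
  by rewrite Gauss_dvdr // coprimeXl // coprime_sym (coprime_dvdr yB).
apply: eq_big => y; first by case: (boolP (y \in divisors B)) => //= /E ->.
move=> /andP[hy h2]; rewrite E // in h2.
have -> : (A * B %/ (x * y) ^ 2 = (A %/ x ^ 2) * (B %/ y ^ 2))%N.
  rewrite -{1}(divnK h) -{1}(divnK h2) mulnACA -expnMn mulnK //.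
  by rewrite expn_gt0 muln_gt0 (dvdn_gt0 A0 xA) (dvdn_gt0 B0) // dvdn_divisors.
apply: root_countM.
- have x20 : (0 < x ^ 2)%N by rewrite expn_gt0 (dvdn_gt0 A0 xA).
  by rewrite (divn_gt0 _ x20); exact: dvdn_leq A0 h.
- have y20 : (0 < y ^ 2)%N by rewrite expn_gt0 (dvdn_gt0 B0) // dvdn_divisors.
  by rewrite (divn_gt0 _ y20); exact: dvdn_leq B0 h2.
- by apply: coprime_dvdl (dvdn_div h) _; apply: coprime_dvdr (dvdn_div h2) co.
Qed.

Variable chi : nat -> int.
Hypothesis k_gt0 : (0 < k)%N.
Hypothesis disc_sqfree : forall q, prime q -> ~~ (q ^ 2 %| 4 * k - 1)%N.
Hypothesis chi1 : chi 1 = 1.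
Hypothesis chiM : forall m n, chi (m * n) = chi m * chi n.
Hypothesis chi_split : forall q, prime q -> (root_count q)%:Z = 1 + chi q.
Hypothesis chi_ram : forall q, prime q -> (chi q == 0) = (q %| 4 * k - 1)%N.
Hypothesis chi_val : forall n, [|| chi n == 0, chi n == 1 | chi n == -1].

Definition divsum n : int := \sum_(e <- divisors n) chi e.

Lemma divsumM A B : (0 < A)%N -> (0 < B)%N -> coprime A B -> divsum (A * B) = divsum A * divsum B.
Proof.
move=> A0 B0 co; rewrite /divsum (perm_big _ (perm_divisorsM A0 B0 co)) big_allpairs_dep /=.
rewrite mulr_suml; apply: eq_bigr => x _; rewrite mulr_sumr; apply: eq_bigr => y _; exact: chiM.
Qed.

Lemma divsumX q j : prime q -> divsum (q ^ j) = \sum_(i < j.+1) chi q ^+ i.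
Proof.
move=> pq; rewrite /divsum (perm_big _ (perm_divisorsX j pq)) big_map.
rewrite -[iota 0 _]/(index_iota 0 j.+1) big_mkord; apply: eq_bigr => i _.
elim: (i : nat) => [|n IH]; first by rewrite expr0.
by rewrite expnS chiM IH exprS.
Qed.

Lemma idealcountX q j : prime q -> idealcount (q ^ j) = (\sum_(i < j.+1 | (i.*2 <= j)%N) root_count (q ^ (j - i.*2)))%N.
Proof.
move=> pq; have q1 := prime_gt1 pq.
rewrite /idealcount (perm_big _ (perm_divisorsX j pq)) big_map.
rewrite -[iota 0 _]/(index_iota 0 j.+1) big_mkord; apply: eq_big => i.
  by rewrite -expnM dvdn_Pexp2l // muln2.
by rewrite -expnM dvdn_Pexp2l // muln2 => h; rewrite -expnB // (ltnW q1).
Qed.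

Lemma root_count_pow q j : prime q -> (root_count (q ^ j.+1))%:Z = if chi q == 0 then (j == 0)%N%:Z else 1 + chi q.
Proof.
move=> pq; rewrite chi_ram //; case: ifP => h.
  case: j => [|j]; last by rewrite root_count_ramified // disc_sqfree.
  by rewrite expn1 chi_split //; move: h; rewrite -chi_ram // => /eqP ->.
elim: j => [|j IH]; first by rewrite expn1 chi_split.
by rewrite root_count_lift // h.
Qed.

(** Both sides satisfy the same recursion in steps of two. The ideals of norm q^(j + 2) divisible by
    q correspond to those of norm q^j; the others are the roots modulo q^(j + 2), whose number is
    chi(q)^(j + 1) + chi(q)^(j + 2) for each of the three values of chi(q). *)
Lemma idealcount_pow q j : prime q -> (idealcount (q ^ j))%:Z = divsum (q ^ j).
Proof.
move=> pq; rewrite idealcountX // divsumX //.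
have [n] := ubnP j; elim: n j => // n IHn [|[|j]] hj.
- by rewrite big_mkcond /= !big_ord1 /= expn0 expr0 /root_count /= /is_root_mod dvd1n.
- have -> : (\sum_(i < 2 | i.*2 <= 1) root_count (q ^ (1 - i.*2)) = root_count q)%N.
    by rewrite (bigD1 ord0) //= big1 ?addn0 ?subn0 ?expn1 // => -[[|[|i]] hi].
  by rewrite chi_split // !big_ord_recr big_ord0 /= add0r expr0 expr1.
rewrite big_mkcond big_ord_recl /= subn0 big_ord_recr /=.
rewrite ifF; last by rewrite /bump; lia.
rewrite addn0 PoszD; have -> : (\sum_(i < j.+1) (if (bump 0 i).*2 <= j.+2 then root_count (q ^ (j.+2 - (bump 0 i).*2)) else 0) =
   \sum_(i < j.+1 | (i.*2 <= j)%N) root_count (q ^ (j - i.*2)))%N.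
  rewrite [RHS]big_mkcond; apply: eq_bigr => i _; rewrite /bump /= add1n doubleS !ltnS.
  by rewrite !subSS.
rewrite IHn; last by lia.
rewrite root_count_pow // [RHS]big_ord_recr [X in _ = X + _]big_ord_recr /=.
by case/or3P: (chi_val q) => /eqP ->; rewrite ?eqxx /= ?expr0n ?expr1n /= ?exprS; move: (\sum_(i < _) _) => S;
  rewrite ?[(-1) * _]mulN1r; lia.
Qed.

Lemma idealcount_divsum n : (0 < n)%N -> (idealcount n)%:Z = divsum n.
Proof.
have [m] := ubnP n; elim: m n => // m IH n hm n0.
case: (leqP n 1) => n1.
  have -> : n = 1%N by lia.
  have := @idealcount_pow 2 0 isT; by rewrite expn0.
have pq := pdiv_prime n1; set q := pdiv n in pq.
have q1 := prime_gt1 pq.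
have [j j1 [r co e]] : exists2 j, (0 < j)%N & exists2 r, coprime q r & n = (r * q ^ j)%N.
  exists (logn q n); first by rewrite logn_gt0 mem_primes pq n0 pdiv_dvd.
  by have [r co e] := pfactor_coprime pq n0; exists r.
have r0 : (0 < r)%N by case: r e co => // e; move: n0; rewrite e.
have Q0 : (0 < q ^ j)%N by rewrite expn_gt0 (ltnW q1).
have co' : coprime r (q ^ j) by rewrite coprime_sym coprimeXl.
rewrite e idealcountM // divsumM // PoszM idealcount_pow // IH //.
have : (1 < q ^ j)%N by rewrite -(expn0 q) ltn_exp2l.
by move: hm; rewrite e; nia.
Qed.

End RootCounting.

(** * Splitting of primes via Gauss periods *)

(** For odd prime p this is the Legendre symbol, taken from Euler's criterion. *)
Definition leg (p n : nat) : int :=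
  if (p %| n)%N then 0 else if (n%:R : 'F_p) ^+ (p.-1)./2 == 1 then 1 else -1.

Section Legendre.
Variable p : nat.
Hypothesis p_prime : prime p.

Lemma Fp_nat_eq0 n : ((n%:R : 'F_p) == 0) = (p %| n)%N.
Proof. by rewrite -(dvdn_pcharf (pchar_Fp p_prime)). Qed.

Lemma Fp_natE (u : 'F_p) : (nat_of_ord u)%:R = u.
Proof. exact: natr_Zp. Qed.

Lemma Fp_val_nat n : nat_of_ord (n%:R : 'F_p) = (n %% p)%N.
Proof. exact: val_Fp_nat. Qed.

Hypothesis p_odd : odd p.

Lemma Fp_half_sqr (u : 'F_p) : u != 0 -> (u ^+ (p.-1)./2) ^+ 2 = 1.
Proof.
move=> u0; rewrite -exprM muln2; have -> : ((p.-1)./2).*2 = p.-1 by move: p_odd; clear; lia.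
apply: (mulfI u0); rewrite mulr1 -exprS prednK ?prime_gt0 //.
by rewrite -{2}(expf_card u) card_Fp.
Qed.

Lemma Fp_half (u : 'F_p) : u != 0 -> (u ^+ (p.-1)./2 == 1) || (u ^+ (p.-1)./2 == -1).
Proof. by move=> /Fp_half_sqr/eqP; rewrite sqrf_eq1. Qed.

Lemma Fp_m1 : (-1 : 'F_p) != 1.
Proof.
rewrite eq_sym -subr_eq0 opprK -[1 + 1]/(2%:R) Fp_nat_eq0 gtnNdvd //.
by have := prime_gt1 p_prime; move: p_odd; clear; lia.
Qed.

Lemma legM m n : leg p (m * n) = leg p m * leg p n.
Proof.
rewrite /leg Euclid_dvdM //; case: (boolP (p %| m)%N) => [|hm] /=; first by rewrite mul0r.
case: (boolP (p %| n)%N) => [|hn] /=; first by rewrite mulr0.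
rewrite natrM exprMn.
have := @Fp_half m%:R; have := @Fp_half n%:R; rewrite !Fp_nat_eq0 => /(_ hn) en /(_ hm) em.
have f1 := negbTE Fp_m1.
by case/orP: en => /eqP ->; case/orP: em => /eqP ->;
  rewrite ?mulr1 ?mul1r ?mulrNN ?mulr1 ?eqxx ?f1 ?eqxx.
Qed.

Lemma leg1 : leg p 1 = 1.
Proof. by rewrite /leg expr1n eqxx Euclid_dvd1. Qed.

Lemma leg_mod n : leg p (n %% p) = leg p n.
Proof.
rewrite /leg; have -> : (p %| n %% p)%N = (p %| n)%N by rewrite /dvdn modn_mod.
by have -> : ((n %% p)%:R : 'F_p) = n%:R by rewrite -[LHS]Fp_natE -[RHS]Fp_natE !Fp_val_nat modn_mod.
Qed.

Lemma legD n : leg p (p + n) = leg p n.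
Proof. by rewrite -leg_mod modnDl leg_mod. Qed.

Lemma leg_val n : [|| leg p n == 0, leg p n == 1 | leg p n == -1].
Proof. by rewrite /leg; case: ifP => // _; case: ifP. Qed.

Lemma leg_eq0 n : (leg p n == 0) = (p %| n)%N.
Proof. by rewrite /leg; case: ifP => // _; case: ifP. Qed.

Lemma leg_prime_eq0 q : prime q -> (leg p q == 0) = (q == p).
Proof. by move=> pq; rewrite leg_eq0 dvdn_prime2 // eq_sym. Qed.

End Legendre.

(** * Roots modulo q read off from the Frobenius action *)

Section RootsModPrime.
Variables (q k : nat).
Hypothesis q_prime : prime q.

Lemma root_count_ram1 : (0 < k)%N -> (q %| 4 * k - 1)%N -> root_count k q = 1%N.
Proof.
move=> k0 qD; have q0 := prime_gt0 q_prime.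
have q_odd : odd q.
  case/dvdnP: qD => z hz; have : odd (z * q) by rewrite -hz; lia.
  by rewrite oddM => /andP[].
rewrite /root_count; transitivity (count_mem (q.-1./2) (iota 0 q)); last first.
  by rewrite count_uniq_mem ?iota_uniq // mem_iota; move: q_odd; clear; case: q => // n; lia.
apply: eq_in_count => b; rewrite mem_iota add0n => /andP[_ bq].
have e : (4 * (b ^ 2 + b + k) = (b.*2.+1) ^ 2 + (4 * k - 1))%N by lia.
have co4 : coprime q 4 by rewrite (@coprime_pexpr 2 q 2) // coprimen2.
rewrite /is_root_mod -(Gauss_dvdr _ co4) e dvdn_addl // Euclid_dvdX //= andbT.
apply/idP/eqP => [|->]; last by have -> : (q.-1./2.*2.+1 = q)%N by move: q_odd q0; clear; lia.
case/dvdnP => -[|[|z]]; move: q_odd bq; clear; nia.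
Qed.

Variable L : finFieldType.
Hypothesis charL : q \in [pchar L].

Lemma pchar_nat_inj i j : (i < q)%N -> (j < q)%N -> i%:R = j%:R :> L -> i = j.
Proof.
wlog ij : i j / (i <= j)%N => [H iq jq e|].
  by case: (leqP i j) => [|/ltnW] h; [exact: H | apply/esym; exact: H].
move=> iq jq e; have : (q %| j - i)%N by rewrite (dvdn_pcharf charL) natrB // e subrr.
by case: (posnP (j - i)) => [|h /(dvdn_leq h)]; move: ij jq; clear; lia.
Qed.

(** The q images of integers are already roots of X^q - X, whose degree leaves room for no other. *)
Lemma frob_fixed_nat (x : L) : x ^+ q = x -> exists2 b, (b < q)%N & x = b%:R.
Proof.
move=> hx; case: (boolP [exists b : 'I_q, x == b%:R]) => [/existsP[b /eqP ->]|].
  by exists b.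
rewrite negb_exists => /forallP H.
pose s := x :: [seq (b%:R : L) | b <- iota 0 q].
have q1 := prime_gt1 q_prime.
have P0 : ('X^q - 'X : {poly L}) != 0.
  by rewrite -size_poly_gt0 size_polyDl size_polyXn // size_polyN size_polyX.
have rt : all (root ('X^q - 'X)) s.
  have R (y : L) : y ^+ q = y -> root ('X^q - 'X) y.
    by move=> hy; rewrite /root !hornerE hy subrr.
  rewrite /s /= R //=; apply/allP => y /mapP[b _ ->]; apply: R.
  by rewrite -(pFrobenius_autE charL) pFrobenius_aut_nat.
have us : uniq s.
  rewrite /s /=; apply/andP; split.
    apply/mapP => -[b]; rewrite mem_iota add0n => /andP[_ bq] e.
    by have := H (Ordinal bq); rewrite e eqxx.
  rewrite map_inj_in_uniq ?iota_uniq //.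
  move=> i j; rewrite !mem_iota !add0n => /andP[_ hi] /andP[_ hj]; exact: pchar_nat_inj.
have := max_poly_roots P0 rt us.
by rewrite size_polyDl size_polyXn ?size_polyN ?size_polyX // /s /= size_map size_iota ltnn.
Qed.

Variable th : L.
Hypothesis th_root : th ^+ 2 + th + k%:R = 0.
Hypothesis k_gt0 : (0 < k)%N.
Hypothesis qD : ~~ (q %| 4 * k - 1)%N.

Lemma th_neq : th != -1 - th.
Proof.
apply: contra qD => /eqP e; rewrite (dvdn_pcharf charL) natrB; last lia.
have -> : (4 * k)%:R - 1%:R = 4 * (th ^+ 2 + th + k%:R) - (2 * th + 1) ^+ 2 by rewrite natrM; ring.
by rewrite th_root {1}mulr2n !mulrDl !mul1r {1}e subrK; apply/eqP; ring.
Qed.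

Lemma is_root_modL b : is_root_mod k q b = (b%:R == th) || (b%:R == -1 - th).
Proof.
rewrite /is_root_mod (dvdn_pcharf charL) -[X in X || _]subr_eq0 -[X in _ || X]subr_eq0 -mulf_eq0.
congr (_ == 0); rewrite !natrD natrX.
have -> : k%:R = - th ^+ 2 - th.
  by apply/eqP; rewrite -subr_eq0; apply/eqP; rewrite -[RHS]th_root; ring.
by ring.
Qed.

(** Frobenius exchanges the two distinct roots th and -1 - th, while a root in the prime field would
    be fixed. *)
Lemma root_count_inert : th ^+ q = -1 - th -> root_count k q = 0%N.
Proof.
move=> e; apply/eqP; rewrite -leqn0 leqNgt -has_count; apply/hasPn => b _.
have nb : (b%:R : L) ^+ q = b%:R by rewrite -(pFrobenius_autE charL) pFrobenius_aut_nat.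
rewrite is_root_modL; apply/negP => /orP[] /eqP h.
  by have := th_neq; rewrite -e -h nb eqxx.
have : th = -1 - b%:R by rewrite h; ring.
move=> h2; have := th_neq; rewrite -e {2}h2 -(pFrobenius_autE charL) rmorphB rmorphN1 /=.
by rewrite pFrobenius_aut_nat -h2 eqxx.
Qed.

Lemma root_count_split : th ^+ q = th -> root_count k q = 2.
Proof.
move=> e; have [b1 h1 e1] := frob_fixed_nat e.
have e' : (-1 - th) ^+ q = -1 - th.
  by rewrite -(pFrobenius_autE charL) rmorphB rmorphN1 /= pFrobenius_autE e.
have [b2 h2 e2] := frob_fixed_nat e'.
have b12 : b1 != b2 by apply: contra th_neq => /eqP b; rewrite {1}e1 e2 b.
rewrite /root_count; transitivity (count (predU (pred1 b1) (pred1 b2)) (iota 0 q)).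
  apply: eq_in_count => b; rewrite mem_iota add0n => /andP[_ bq].
  rewrite is_root_modL e2 e1 /=; congr (_ || _).
    by apply/eqP/eqP => [/pchar_nat_inj|->]; [apply|].
  by apply/eqP/eqP => [/pchar_nat_inj|->]; [apply|].
have := count_predUI (pred1 b1) (pred1 b2) (iota 0 q).
rewrite (@eq_count _ (predI _ _) pred0) => [|x]; last first.
  by rewrite /=; case: eqP => // ->; exact: negbTE.
by rewrite count_pred0 addn0 !count_uniq_mem ?iota_uniq // !mem_iota h1 h2.
Qed.

End RootsModPrime.

Lemma exists_unity_root (p : nat) (L : finFieldType) : prime p -> (p %| #|L|.-1)%N ->
  exists2 z : L, z ^+ p = 1 & z != 1.
Proof.
move=> pp hd; have [|x _ ox] := @Cauchy _ p [set: {unit L}]%G pp.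
  by rewrite card_finField_unit.
exists (val x).
  by rewrite -FinRing.val_unitX -ox expg_order.
apply/eqP => x1; have : x = 1%g by apply: val_inj.
by move=> e; move: ox pp; rewrite e order1 => <-.
Qed.

(** In the field with q^phi(n) elements, n divides the order of the multiplicative group by Euler's
    theorem. One field has to serve all primes dividing n: for n = 5 p, periods of both kinds get
    multiplied. *)
Lemma exists_field_unity_roots (q n : nat) : prime q -> coprime q n -> (1 < n)%N ->
  exists2 L : finFieldType, q \in [pchar L] &
    forall p, prime p -> (p %| n)%N -> exists2 z : L, z ^+ p = 1 & z != 1.
Proof.
move=> pq co n1; have t0 : (0 < totient n)%N by rewrite totient_gt0 ltnW.
have [L charL cardL] := pPrimePowerField pq t0; exists L => // p pp pn.
apply: exists_unity_root => //; apply: dvdn_trans pn _.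
rewrite cardL -subn1 -eqn_mod_dvd ?expn_gt0 ?prime_gt0 //.
exact/eqP/Euler_exp_totient.
Qed.

(** * The quadratic Gauss periods for p congruent to 3 modulo 4 *)

Section GaussPeriod.
Variables (p : nat) (L : finFieldType).
Hypotheses (p_prime : prime p) (p_mod4 : (p %% 4 = 3)%N).
Variable z : L.
Hypotheses (zp : z ^+ p = 1) (z1 : z != 1).

Let p_odd : odd p. Proof. by move: p_mod4; clear; lia. Qed.

Let h := (p.-1)./2.
Definition zexp (u : 'F_p) : L := z ^+ (nat_of_ord u).

Lemma zexp_nat n : zexp n%:R = z ^+ n.
Proof. by rewrite /zexp Fp_val_nat // -[RHS](expr_mod _ zp). Qed.

Lemma zexpD u v : zexp (u + v) = zexp u * zexp v.
Proof. by rewrite -[u]Fp_natE // -[v]Fp_natE // -natrD !zexp_nat exprD. Qed.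

Lemma zexp0 : zexp 0 = 1.
Proof. by rewrite -[0]/(0%:R) zexp_nat. Qed.

Lemma zexp_sum : \sum_u zexp u = 0.
Proof.
have e : z * (\sum_u zexp u) = \sum_u zexp u.
  rewrite mulr_sumr [RHS](reindex_inj (addrI 1)) /=; apply: eq_bigr => u _.
  by rewrite zexpD; congr (_ * _); rewrite -[1]/(1%:R) zexp_nat expr1.
apply/eqP; have : (z - 1) * (\sum_u zexp u) == 0 by rewrite mulrBl mul1r e subrr.
by rewrite mulf_eq0 subr_eq0 (negbTE z1).
Qed.

Definition is_res (u : 'F_p) : bool := u ^+ h == 1.
Definition is_nonres (u : 'F_p) : bool := u ^+ h == -1.

Lemma half_gt0 : (0 < h)%N.
Proof. by rewrite /h; move: p_mod4; clear; lia. Qed.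

Lemma is_res0 : is_res 0 = false.
Proof. by rewrite /is_res expr0n gtn_eqF ?half_gt0 //= eq_sym oner_eq0. Qed.
Lemma is_nonres0 : is_nonres 0 = false.
Proof. by rewrite /is_nonres expr0n gtn_eqF ?half_gt0 //= eq_sym oppr_eq0 oner_eq0. Qed.
Lemma is_res_neq0 u : is_res u -> u != 0.
Proof. by case: eqP => // ->; rewrite is_res0. Qed.
Lemma is_nonres_neq0 u : is_nonres u -> u != 0.
Proof. by case: eqP => // ->; rewrite is_nonres0. Qed.
Lemma is_nonresE u : u != 0 -> is_nonres u = ~~ is_res u.
Proof.
move=> u0; have m1 := negbTE (Fp_m1 p_prime p_odd).
have := Fp_half p_prime p_odd u0; rewrite /is_nonres /is_res -/h.
by case: (eqVneq (u ^+ h) 1) => [->|_] /=; [rewrite eq_sym m1 | move=> ->].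
Qed.

Lemma is_resM c u : is_res c -> is_res (c * u) = is_res u.
Proof. by rewrite /is_res exprMn => /eqP ->; rewrite mul1r. Qed.
Lemma is_resMN c u : is_nonres c -> is_res (c * u) = is_nonres u.
Proof. by rewrite /is_res /is_nonres exprMn => /eqP ->; rewrite mulN1r eqr_oppLR. Qed.
Lemma is_nonresMN c u : is_nonres c -> is_nonres (c * u) = is_res u.
Proof. by rewrite /is_res /is_nonres exprMn => /eqP ->; rewrite mulN1r eqr_opp. Qed.
Lemma is_nonres_m1 : is_nonres (-1).
Proof. by rewrite /is_nonres -signr_odd; have -> : odd h by rewrite /h; move: p_mod4; clear; lia. Qed.
Lemma is_res_opp u : is_res (- u) = is_nonres u.
Proof. by rewrite -mulN1r is_resMN ?is_nonres_m1. Qed.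

Definition gauss_period : L := \sum_(u | is_res u) zexp u.
Definition gauss_period' : L := \sum_(u | is_nonres u) zexp u.

Lemma gauss_period_sum : gauss_period' = -1 - gauss_period.
Proof.
have := zexp_sum; rewrite (bigD1 0) //= zexp0 (bigID is_res) /=.
have -> : \sum_(u | (u != 0) && is_res u) zexp u = gauss_period.
  by apply: eq_bigl => u; case: (boolP (is_res u)) => [/is_res_neq0 ->|]; rewrite ?andbF.
have -> : \sum_(u | (u != 0) && ~~ is_res u) zexp u = gauss_period'.
  apply: eq_bigl => u; case: (eqVneq u 0) => [->|u0]; first by rewrite is_nonres0.
  by rewrite is_nonresE.
move=> /eqP; rewrite addrA addrC addr_eq0 => /eqP ->; ring.
Qed.

Lemma card_is_res : #|[pred u | is_res u]| = h.
Proof.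
have e : #|[pred u | is_res u]| = #|[pred u | is_nonres u]|.
  rewrite -!sum1_card [LHS](reindex_inj oppr_inj) /=.
  by apply: eq_bigl => u; rewrite !inE is_res_opp.
have : #|'F_p| = (1 + (#|[pred u | is_res u]| + #|[pred u | is_nonres u]|))%N.
  rewrite -!sum1_card (bigD1 0) //= (bigID is_res) /=; congr (_ + (_ + _))%N.
    by apply: eq_bigl => u; rewrite inE; case: (boolP (is_res u)) => [/is_res_neq0 ->|]; rewrite ?andbF.
  apply: eq_bigl => u; rewrite inE; case: (eqVneq u 0) => [->|u0]; first by rewrite is_nonres0.
  by rewrite is_nonresE.
by rewrite -e card_Fp // /h; move: #|_| => n; clear; lia.
Qed.

Definition consecutive_residues : nat := #|[pred s | is_res s && is_res (s - 1)]|.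

(** Inversion preserves residues and replaces s - 1 by - (s - 1) / s, which for a residue s has the
    opposite character because -1 is a nonresidue. *)
Lemma consecutive_residuesE : consecutive_residues = #|[pred s | is_res s && is_nonres (s - 1)]|.
Proof.
rewrite /consecutive_residues -!sum1_card [LHS](reindex_inj invr_inj) /=; apply: eq_bigl => s; rewrite !inE.
have iv u : is_res u^-1 = is_res u by rewrite /is_res exprVn invr_eq1.
rewrite iv; case: (boolP (is_res s)) => //= Rs; have s0 := is_res_neq0 Rs.
have -> : s^-1 - 1 = s^-1 * - (s - 1) by rewrite opprB mulrBr mulr1 mulVf.
by rewrite is_resM ?iv // is_res_opp.
Qed.

Lemma half_consecutive : h = consecutive_residues.*2.+1.
Proof.
have R1 : is_res 1 by rewrite /is_res expr1n.
rewrite -card_is_res -addnn {2}consecutive_residuesE /consecutive_residues -!sum1_card (bigD1 1) //= (bigID (fun s => is_res (s - 1))) /=.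
rewrite add1n; congr (_ + _).+1; apply: eq_bigl => s; rewrite !inE.
  by case: eqP => [->|]; rewrite ?subrr ?is_res0 ?andbF ?andbT.
case: eqP => [->|/eqP s1]; first by rewrite subrr is_nonres0 !andbF.
by rewrite andbT is_nonresE // subr_eq0.
Qed.

Lemma gauss_period_mul t : is_res t -> \sum_(c | is_res c) zexp (c * t) = gauss_period.
Proof.
move=> Rt; rewrite /gauss_period [RHS](reindex_inj (mulIf (is_res_neq0 Rt))) /=.
by apply: eq_bigl => u; rewrite mulrC is_resM.
Qed.

Lemma gauss_period_mulN t : is_nonres t -> \sum_(c | is_res c) zexp (c * t) = gauss_period'.
Proof.
move=> Nt; rewrite /gauss_period' [RHS](reindex_inj (mulIf (is_nonres_neq0 Nt))) /=.
by apply: eq_bigl => u; rewrite mulrC is_nonresMN.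
Qed.

(** As -1 is a nonresidue, the product is the sum of z^(c (s - 1)) over residues c and s. The terms
    with s = 1 give (p - 1) / 2; the other s produce both periods equally often, and the periods add
    up to -1. By [half_consecutive] the difference is the stated number. *)
Lemma gauss_period_prod : gauss_period * gauss_period' = consecutive_residues.+1%:R.
Proof.
have e1 : gauss_period' = \sum_(c | is_res c) zexp (- c).
  by rewrite -(gauss_period_mulN is_nonres_m1); apply: eq_bigr => c _; rewrite mulrN1.
have -> : gauss_period * gauss_period' = \sum_(c | is_res c) \sum_(s | is_res s) zexp (c * (s - 1)).
  rewrite e1 mulr_sumr; apply: eq_bigr => c Rc.
  rewrite mulr_suml (reindex_inj (mulfI (is_res_neq0 Rc))) /=.
  by apply: eq_big => s; [rewrite is_resM | rewrite mulrBr mulr1 zexpD].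
rewrite exchange_big /= (bigD1 1) /=; last by rewrite /is_res expr1n.
have -> : \sum_(c | is_res c) zexp (c * (1 - 1)) = h%:R.
  rewrite subrr; under eq_bigr do rewrite mulr0 zexp0.
  by rewrite -card_is_res -sum1_card natr_sum.
rewrite (bigID (fun s => is_res (s - 1))) /=.
have -> : \sum_(s | is_res s && (s != 1) && is_res (s - 1)) \sum_(c | is_res c) zexp (c * (s - 1)) = consecutive_residues%:R * gauss_period.
  transitivity (\sum_(s | is_res s && is_res (s - 1)) gauss_period).
    apply: eq_big => s; last by move=> /andP[_]; exact: gauss_period_mul.
    by case: eqP => [->|]; rewrite ?subrr ?is_res0 ?andbF ?andbT.
  by rewrite sumr_const mulr_natl.
have -> : \sum_(s | is_res s && (s != 1) && ~~ is_res (s - 1)) \sum_(c | is_res c) zexp (c * (s - 1)) = consecutive_residues%:R * gauss_period'.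
  transitivity (\sum_(s | is_res s && is_nonres (s - 1)) gauss_period').
    have E s : is_res s && (s != 1) && ~~ is_res (s - 1) = is_res s && is_nonres (s - 1).
      case: eqP => [->|/eqP s1]; first by rewrite subrr is_nonres0 !andbF.
      by rewrite andbT is_nonresE // subr_eq0.
    apply: eq_big => s; first exact: E.
    by rewrite E => /andP[_]; exact: gauss_period_mulN.
  by rewrite sumr_const consecutive_residuesE mulr_natl.
have -> : h%:R = consecutive_residues%:R + consecutive_residues%:R + 1 :> L by rewrite half_consecutive -addnn -natr1 natrD.
by rewrite gauss_period_sum -natr1; ring.
Qed.

Lemma gauss_period_root : gauss_period ^+ 2 + gauss_period + ((p + 1) %/ 4)%:R = 0.
Proof.
have -> : ((p + 1) %/ 4 = consecutive_residues.+1)%N by have := half_consecutive; rewrite /h; move: p_mod4; clear; lia.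
by rewrite -gauss_period_prod gauss_period_sum; ring.
Qed.

Variable q : nat.
Hypotheses (q_prime : prime q) (charL : q \in [pchar L]) (qp : q != p).

Lemma zexp_frob u : zexp u ^+ q = zexp (q%:R * u).
Proof. by rewrite -[u]Fp_natE // -natrM !zexp_nat -exprM mulnC. Qed.

(* In characteristic [q] the Frobenius permutes the two periods according to [(q / p)]. *)
Lemma gauss_period_frob : gauss_period ^+ q = if leg p q == 1 then gauss_period else -1 - gauss_period.
Proof.
have q0 : (q%:R : 'F_p) != 0.
  by rewrite Fp_nat_eq0 // dvdn_prime2 // eq_sym.
have -> : gauss_period ^+ q = \sum_(c | is_res c) zexp (c * q%:R).
  rewrite -(pFrobenius_autE charL) rmorph_sum /=; apply: eq_bigr => u _.
  by rewrite pFrobenius_autE zexp_frob mulrC.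
rewrite /leg -Fp_nat_eq0 // (negbTE q0) -/h -/(is_res q%:R).
case: (boolP (is_res q%:R)) => hq /=; first exact: gauss_period_mul.
by rewrite -gauss_period_sum; apply: gauss_period_mulN; rewrite is_nonresE.
Qed.

End GaussPeriod.

(** This contains reciprocity for p: in characteristic q the Gauss period is a root of X^2 + X + (p
    + 1) / 4, and for q other than p Frobenius fixes it exactly if q is a residue modulo p. The
    prime 2 needs no separate treatment. *)
Lemma root_count_leg p q : prime p -> (p %% 4 = 3)%N -> prime q ->
  (root_count ((p + 1) %/ 4) q)%:Z = 1 + leg p q.
Proof.
move=> pp p3 pq; have p_odd : odd p by move: p3; clear; lia.
set k := ((p + 1) %/ 4)%N; have k0 : (0 < k)%N by rewrite /k; move: p3; clear; lia.
have kD : (4 * k - 1 = p)%N by rewrite /k; move: p3; clear; lia.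
have [qp|qp] := eqVneq q p.
  by rewrite root_count_ram1 ?kD ?qp //; apply/esym; rewrite /leg dvdnn.
have qD : ~~ (q %| 4 * k - 1)%N by rewrite kD dvdn_prime2.
have co : coprime q p by rewrite prime_coprime // dvdn_prime2.
have [L cL HL] := exists_field_unity_roots pq co (prime_gt1 pp).
have [z zp z1] := HL p pp (dvdnn p).
have rt := gauss_period_root pp p3 zp z1; have fr := gauss_period_frob pp p3 zp z1 pq cL qp.
have := leg_val p q; rewrite leg_prime_eq0 // (negbTE qp) /=.
case: (boolP (leg p q == 1)) fr => [/eqP -> fr _|_ fr /eqP ->].
  by rewrite (root_count_split pq cL rt k0 qD fr).
by rewrite (root_count_inert pq cL rt k0 qD fr).
Qed.

(** The quadratic periods for 5; they are the roots of X^2 + X - 1, of discriminant 5. *)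
Lemma golden_root (L : fieldType) (w : L) : w ^+ 5 = 1 -> w != 1 ->
  (w + w ^+ 4) ^+ 2 + (w + w ^+ 4) = 1 /\ w ^+ 2 + w ^+ 3 = -1 - (w + w ^+ 4).
Proof.
move=> w5 w1.
have S : 1 + w + w ^+ 2 + w ^+ 3 + w ^+ 4 = 0.
  apply/eqP; have : (w - 1) * (1 + w + w ^+ 2 + w ^+ 3 + w ^+ 4) == 0.
    have -> : (w - 1) * (1 + w + w ^+ 2 + w ^+ 3 + w ^+ 4) = w ^+ 5 - 1 by ring.
    by rewrite w5 subrr.
  by rewrite mulf_eq0 subr_eq0 (negbTE w1).
split; last by apply/eqP; rewrite -subr_eq0; apply/eqP; rewrite -[RHS]S; ring.
transitivity (w ^+ 2 + 2 * w ^+ 5 + w ^+ 5 * w ^+ 3 + w + w ^+ 4); first ring.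
by rewrite w5 -[RHS]addr0 -[in RHS]S; ring.
Qed.

Lemma leg5_mod n : leg 5 n = nth 0 [:: 0; 1; -1; -1; 1] (n %% 5).
Proof.
rewrite -leg_mod //; have := ltn_pmod n (isT : (0 < 5)%N).
by case: (n %% 5)%N => [|[|[|[|[|i]]]]].
Qed.

(** For p congruent to 3 modulo 4 this is the character of Q(sqrt(-5p)), whose discriminant is - 5
    p. *)
Definition leg5p (p n : nat) : int := leg 5 n * leg p n.

Lemma root_count_leg5p p q : prime p -> (p %% 4 = 3)%N -> prime q ->
  (root_count ((5 * p + 1) %/ 4) q)%:Z = 1 + leg5p p q.
Proof.
move=> pp p3 pq; have p_odd : odd p by move: p3; clear; lia.
set k := ((5 * p + 1) %/ 4)%N; have k0 : (0 < k)%N by rewrite /k; move: p3; clear; lia.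
have kD : (4 * k - 1 = 5 * p)%N by rewrite /k; move: p3; clear; lia.
case: (boolP (q %| 5 * p)%N) => [qD|].
  rewrite root_count_ram1 ?kD //; move: qD; rewrite Euclid_dvdM // !dvdn_prime2 // /leg5p.
  by case/orP => /eqP ->; rewrite /leg !dvdnn ?mul0r ?mulr0.
rewrite -kD => qD; have := qD; rewrite kD Euclid_dvdM // !dvdn_prime2 // negb_or => /andP[q5 qp].
have co : coprime q (5 * p) by rewrite prime_coprime // -kD.
have [|L cL HL] := exists_field_unity_roots pq co; first by have := prime_gt1 pp; lia.
have [z zp z1] := HL p pp (dvdn_mull 5%N (dvdnn p)).
have [w w5 w1] := HL 5%N isT (dvdn_mulr p (dvdnn 5)).
have rt := gauss_period_root pp p3 zp z1; have fr := gauss_period_frob pp p3 zp z1 pq cL qp.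
set e1 := gauss_period p z in rt fr; have [g1 g2] := golden_root w5 w1; set e2 := w + w ^+ 4 in g1 g2.
(* Chosen so that 2 th + 1 = (2 e1 + 1) (2 e2 + 1), a square root of - 5 p. Conjugating one of the
   two periods changes its sign and so exchanges th and -1 - th. *)
pose th := 2 * e1 * e2 + e1 + e2.
have th_root : th ^+ 2 + th + k%:R = 0.
  have ek : k%:R = 5 * ((p + 1) %/ 4)%:R - 1 :> L.
    have -> : k = (5 * ((p + 1) %/ 4) - 1)%N by rewrite /k; move: p3; clear; lia.
    by rewrite natrB ?natrM //; move: p3; clear; lia.
  have ea : e1 ^+ 2 + e1 = - ((p + 1) %/ 4)%:R.
    by apply/eqP; rewrite -addr_eq0 rt.
  have -> : th ^+ 2 + th = 4 * (e1 ^+ 2 + e1) * (e2 ^+ 2 + e2) + (e1 ^+ 2 + e1) + (e2 ^+ 2 + e2).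
    by rewrite /th; ring.
  by rewrite ea g1 ek; ring.
have fr2 : e2 ^+ q = if leg 5 q == 1 then e2 else -1 - e2.
  have -> : e2 ^+ q = w ^+ q + w ^+ (4 * q).
    by rewrite -(pFrobenius_autE cL) rmorphD /= !pFrobenius_autE -exprM.
  rewrite -(expr_mod _ w5) -[w ^+ (4 * q)](expr_mod _ w5) leg5_mod.
  have : (q %% 5 != 0)%N by rewrite -/(5 %| q)%N dvdn_prime2 // eq_sym.
  rewrite -modnMmr; have := ltn_pmod q (isT : (0 < 5)%N).
  case: (q %% 5)%N => [|[|[|[|[|i]]]]] //= _ _; rewrite ?expr1 ?g2 //.
  - by rewrite addrC g2.
  - by rewrite addrC.
have thq : th ^+ q = 2 * e1 ^+ q * e2 ^+ q + e1 ^+ q + e2 ^+ q.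
  rewrite /th; move: (e1) (e2) => x y.
  by rewrite -(pFrobenius_autE cL) !rmorphD !rmorphM rmorph_nat /= !pFrobenius_autE.
have v1 := leg_val p q; have v2 := leg_val 5 q.
rewrite leg_prime_eq0 // (negbTE qp) /= in v1; rewrite leg_prime_eq0 // (negbTE q5) /= in v2.
rewrite /leg5p; rewrite fr fr2 in thq.
case/orP: v1 thq => /eqP ->; case/orP: v2 => /eqP ->; rewrite ?eqxx /= => thq.
- by rewrite (root_count_split pq cL th_root k0 qD thq).
- rewrite (root_count_inert pq cL th_root k0 qD) //; rewrite thq /th; ring.
- rewrite (root_count_inert pq cL th_root k0 qD) //; rewrite thq /th; ring.
- rewrite (root_count_split pq cL th_root k0 qD) //; rewrite thq /th; ring.
Qed.

(** * Ideals of the ring of integers and binary forms *)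

Lemma int_ideal_gen (P : set int) : (exists2 x, P x & x != 0) ->
  (forall x y u v, P x -> P y -> P (u * x + v * y)) ->
  exists2 g : nat, (0 < g)%N & forall x, P x <-> exists t, x = t * g%:Z.
Proof.
move=> [x0 Px0 x00] H.
have ex : exists n, `[< (0 < n)%N /\ P n%:Z >].
  exists `|x0|%N; apply/asboolP; split; first lia.
  have := H x0 x0 (Num.sg x0) 0 Px0 Px0; rewrite mul0r addr0 => H0.
  by rewrite abszE normrEsg.
case: (ex_minnP ex) => g /asboolP[g0 Pg] gmin; exists g => // x; split.
  move=> Px; exists (x %/ g)%Z; have := divz_eq x g.
  suff -> : (x %% g)%Z = 0 by rewrite addr0.
  have m0 : 0 <= (x %% g)%Z by rewrite modz_ge0 //; lia.
  have mg : (x %% g)%Z < g%:Z by rewrite ltz_pmod.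
  case: (eqVneq (x %% g)%Z 0) => // mn0.
  have Pm : P (x %% g)%Z.
    have := H x g%:Z 1 (- (x %/ g)%Z) Px Pg; rewrite mul1r mulNr.
    by congr P; rewrite {1}(divz_eq x g) addrAC subrr add0r.
  have := gmin `|(x %% g)%Z|%N; rewrite leqNgt => /(_ _)/negP; case; last lia.
  by apply/asboolP; split; [lia | rewrite gez0_abs].
by move=> [t ->]; have := H g%:Z g%:Z t 0 Pg Pg; rewrite mul0r addr0.
Qed.

(** One preimage for each value of [f]; this will select representatives of the ideal classes. *)
Lemma undup_map_preimage (T U : eqType) (f : T -> U) (s : seq T) :
  exists r : seq T, [/\ {subset r <= s}, map f r = undup (map f s) & {in r &, injective f}].
Proof.
elim: s => [|x s [r [rs e inj]]]; first by exists [::].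
rewrite /=; case: ifP => fx.
  by exists r; split=> // y /rs ys; rewrite inE ys orbT.
exists (x :: r); split.
- by move=> y; rewrite !inE => /orP[->//|/rs ->]; rewrite orbT.
- by rewrite /= e.
have nf y : y \in r -> f y != f x.
  move=> yr; apply: contraFneq fx => <-; rewrite -mem_undup -e; exact: map_f.
move=> y z; rewrite !inE => /orP[/eqP ->|yr] /orP[/eqP ->|zr] // h; last exact: inj.
  by have := nf _ zr; rewrite h eqxx.
by have := nf _ yr; rewrite h eqxx.
Qed.

(** * The maximal order of discriminant 1 - 4 k *)

Section QuadraticOrder.
Local Open Scope classical_set_scope.
Local Open Scope ring_scope.
Variable k : nat.
Hypothesis k_gt1 : (1 < k)%N.
Hypothesis sqfree : forall q, prime q -> ~~ (q ^ 2 %| 4 * k - 1)%N.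

Let d : nat := (4 * k - 1)%N.
Definition sqrt_disc : algC := sqrtC ((- (4 * k - 1)%N%:Z)%:~R).
Definition omega : algC := (1 + sqrt_disc) / 2.
Definition el (x y : int) : algC := x%:~R + y%:~R * omega.
Definition OK : set algC := ring_of_integers (quadratic_field (- (4 * k - 1)%N%:Z)).

Lemma dE : d%:R = 4 * k%:R - 1 :> algC.
Proof. by rewrite /d natrB ?natrM //; lia. Qed.

Lemma sqr_sqrt_disc : sqrt_disc ^+ 2 = 1 - 4 * k%:R.
Proof. by rewrite /sqrt_disc sqrtCK rmorphN /= -pmulrn -/d dE opprB. Qed.

Lemma omega_sqr : omega ^+ 2 = omega - k%:R.
Proof.
have -> : omega ^+ 2 = (1 + 2 * sqrt_disc + sqrt_disc ^+ 2) / 4 by rewrite /omega; field.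
by rewrite sqr_sqrt_disc /omega; field.
Qed.

Lemma conj_sqrt_disc : sqrt_disc^* = - sqrt_disc.
Proof.
have : (sqrt_disc^* ) ^+ 2 == sqrt_disc ^+ 2.
  by rewrite -rmorphXn /= sqr_sqrt_disc rmorphB rmorphM rmorph1 !rmorph_nat.
rewrite eqf_sqr => /orP[] /eqP // e.
have rr : sqrt_disc \is Num.real by apply/CrealP.
have : 0 <= sqrt_disc ^+ 2 by rewrite -realEsqr.
rewrite sqr_sqrt_disc subr_ge0 -natrM -[1]/(1%:R) ler_nat; lia.
Qed.

Lemma conj_omega : omega^* = 1 - omega.
Proof. by rewrite /omega rmorphM rmorphD rmorph1 fmorphV rmorph_nat /= conj_sqrt_disc; field. Qed.

Lemma conj_el x y : (el x y)^* = el (x + y) (- y).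
Proof.
rewrite /el rmorphD rmorphM /= !rmorph_int conj_omega intrD mulrNz; ring.
Qed.

Lemma elD x y u v : el x y + el u v = el (x + u) (y + v).
Proof. by rewrite /el !intrD; ring. Qed.

Lemma elN x y : - el x y = el (- x) (- y).
Proof. by rewrite /el !mulrNz; ring. Qed.

Lemma elM x y u v : el x y * el u v = el (x * u - k%:Z * y * v) (x * v + y * u + y * v).
Proof.
rewrite /el.
have -> : (x%:~R + y%:~R * omega) * (u%:~R + v%:~R * omega) =
  x%:~R * u%:~R + (x%:~R * v%:~R + y%:~R * u%:~R) * omega + y%:~R * v%:~R * omega ^+ 2 by ring.
rewrite omega_sqr !(intrD, mulrNz, intrM) -pmulrn; ring.
Qed.

Lemma el_int x : el x 0 = x%:~R.
Proof. by rewrite /el mul0r addr0. Qed.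

Lemma omega_nonreal : omega \isn't Num.real.
Proof.
apply/negP => /CrealP; rewrite conj_omega => e.
have e2 : 2 * omega = 1 by rewrite mulr2n mulrDl mul1r -{1}e; ring.
have : (2 * omega) ^+ 2 = 2 * (2 * omega) - 4 * k%:R by rewrite exprMn omega_sqr; ring.
rewrite e2 => /eqP; rewrite -subr_eq0.
have -> : 1 ^+ 2 - (2 * 1 - 4 * k%:R) = d%:R :> algC by rewrite dE; ring.
by rewrite pnatr_eq0 /d; lia.
Qed.

Lemma el_inj x y u v : el x y = el u v -> x = u /\ y = v.
Proof.
move=> e; have e1 : (y - v)%:~R * omega = (u - x)%:~R.
  rewrite !rmorphB /=.
  have -> : (y%:~R - v%:~R) * omega = (x%:~R + y%:~R * omega) - x%:~R - v%:~R * omega by ring.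
  by rewrite -/(el x y) e /el; ring.
have yv : y = v.
  apply/eqP; rewrite -subr_eq0; apply/negPn/negP => ne; case/negP: omega_nonreal.
  have -> : omega = (u - x)%:~R / (y - v)%:~R by rewrite -e1 mulrC mulKf // intr_eq0.
  by rewrite rpred_div // Rreal_int // intr_int.
split=> //; move: e1; rewrite yv subrr mul0r => /esym/eqP; rewrite intr_eq0 subr_eq0.
by move=> /eqP.
Qed.

Lemma Aint_omega : omega \in Aint.
Proof.
pose P : {poly algC} := 'X^2 - 'X + (k%:R)%:P.
have sP : size ('X^2 : {poly algC}) = 3 by rewrite size_polyXn.
have lt : leq (size (- 'X + (k%:R)%:P : {poly algC})).+1 (size ('X^2 : {poly algC})).
  rewrite sP ltnS; apply: leq_trans (size_polyD _ _) _.
  by rewrite geq_max size_polyN size_polyX (leq_trans (size_polyC_leq1 _)).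
apply: (@root_monic_Aint P).
- by rewrite /root /P !hornerE omega_sqr; apply/eqP; ring.
- by rewrite monicE /P -addrA lead_coefDl // lead_coefXn.
- apply/polyOverP => i; rewrite /P !coefE; apply: rpredD; last first.
    by case: ifP; rewrite ?rpred_nat ?rpred0.
  by apply: rpredB; exact: rpred_nat.
Qed.

Lemma sqfree_den (n : nat) : (n ^ 2 %| d)%N -> n = 1%N.
Proof.
move=> nd; case: (leqP n 1) => n1.
  have : n != 0%N by apply: contraTneq nd => ->; rewrite dvd0n /d; lia.
  by move: n1; case: n {nd} => [|[]].
have := sqfree (pdiv_prime n1); rewrite -/d (dvdn_trans _ nd) //.
by rewrite dvdn_exp2r // pdiv_dvd.
Qed.

(** Numerator and denominator being coprime, the square of the denominator divides the squarefree
    number d. *)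
Lemma rat_sqfree_int (B : rat) (n : int) : d%:R * B ^+ 2 = n%:~R -> exists y : int, B = y%:~R.
Proof.
move=> e.
have dn : (denq B)%:~R != 0 :> rat by rewrite intr_eq0 denq_neq0.
have e2 : d%:Z * numq B ^+ 2 = n * denq B ^+ 2.
  apply/eqP; rewrite -(eqr_int rat) !intrM -e -pmulrn.
  by rewrite !numqE; apply/eqP; ring.
have : (`|denq B| ^ 2 %| d * `|numq B| ^ 2)%N.
  apply/dvdnP; exists `|n|%N.
  by rewrite -!mulnn; have := congr1 absz e2; rewrite !abszM.
rewrite Gauss_dvdl; last by rewrite coprimeXl // coprimeXr // coprime_sym coprime_num_den.
move/sqfree_den => d1; exists (numq B).
rewrite -[LHS]divq_num_den; have -> : denq B = 1 by have := denq_gt0 B; lia.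
by rewrite divr1.
Qed.

(** Trace 2 a and norm of a + b sqrt(-d) are rational algebraic integers, hence integers. Then d (2
    b)^2 is an integer and so is 2 b; as d is odd, 2 a and 2 b have equal parity. *)
Lemma OKP z : OK z <-> exists x y, z = el x y.
Proof.
split=> [[[a [b zE]] zA]|[x [y ->]]]; last first.
  split; last first.
    by apply: rpredD; [exact: Aint_int | apply: rpredM; [exact: Aint_int | exact: Aint_omega]].
  exists (x%:~R + y%:~R / 2), (y%:~R / 2).
  by rewrite rmorphD fmorph_div /= !ratr_int rmorph_nat /el /omega -/sqrt_disc; field.
rewrite -/sqrt_disc in zE.
have cz : z^* = ratr a - ratr b * sqrt_disc.
  by rewrite zE rmorphD /= [(ratr b * sqrt_disc)^*]rmorphM /= conj_sqrt_disc !conj_Crat ?Crat_rat // mulrN.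
have czA : z^* \in Aint by rewrite Aint_aut.
have tr : z + z^* = ratr (2 * a).
  by rewrite cz zE rmorphM /= rmorph_nat; ring.
have nm : z * z^* = ratr (a ^+ 2 + d%:R * b ^+ 2).
  rewrite cz zE rmorphD rmorphM !rmorphXn /= rmorph_nat.
  have -> : (ratr a + ratr b * sqrt_disc) * (ratr a - ratr b * sqrt_disc) =
    ratr a ^+ 2 - ratr b ^+ 2 * sqrt_disc ^+ 2 :> algC by ring.
  by rewrite sqr_sqrt_disc dE; ring.
have i1 : z + z^* \is a Num.int.
  by apply: Cint_rat_Aint; [rewrite tr Crat_rat | exact: rpredD].
have i2 : z * z^* \is a Num.int.
  by apply: Cint_rat_Aint; [rewrite nm Crat_rat | exact: rpredM].
case/intrP: i1 => m; rewrite tr -(ratr_int _ m) => /fmorph_inj am.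
case/intrP: i2 => n; rewrite nm -(ratr_int _ n) => /fmorph_inj bn.
have e : d%:R * (2 * b) ^+ 2 = (4 * n - m ^+ 2)%:~R.
  rewrite rmorphB rmorphM rmorphXn /= -bn -am; ring.
have [y by_] := rat_sqfree_int e.
have e3 : d%:Z * y ^+ 2 = 4 * n - m ^+ 2.
  apply/eqP; rewrite -(eqr_int rat) -e by_ rmorphM rmorphXn /= -pmulrn; exact/eqP.
have [x hx] : exists x, m = 2 * x + y.
  exists ((m - y) %/ 2)%Z.
  have : odd d by rewrite /d; lia.
  have : (2 %| m - y)%Z.
    have : (2 %| d%:Z * y ^+ 2 + m ^+ 2)%Z by rewrite e3 subrK; lia.
    have -> : d%:Z * y ^+ 2 + m ^+ 2 = (m - y) ^+ 2 + 2 * (m * y) + (d.-1)%:Z * y ^+ 2.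
      by have -> : d%:Z = (d.-1)%:Z + 1; [rewrite /d; lia | ring].
    have [d2 ->] : exists d2 : nat, d.-1 = d2.*2 by exists (d.-1)./2; rewrite /d; lia.
    have [t [ht|ht]] : exists t, m - y = 2 * t \/ m - y = 2 * t + 1.
      by exists ((m - y) %/ 2)%Z; move: (m - y); clear; lia.
      by move=> _; rewrite ht dvdz_mulr.
    have -> : (m - y) ^+ 2 + 2 * (m * y) + d2.*2%:Z * y ^+ 2 =
      2 * (2 * t ^+ 2 + 2 * t + m * y + d2%:Z * y ^+ 2) + 1.
      by rewrite ht -mul2n PoszM; ring.
    by move: (_ + d2%:Z * _); clear; lia.
  lia.
exists x, y; rewrite zE.
have -> : a = x%:~R + y%:~R / 2.
  have -> : a = (2 * a) / 2 by field.
  by rewrite am hx rmorphD rmorphM /=; field.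
have -> : b = y%:~R / 2 by rewrite -by_; field.
by rewrite rmorphD fmorph_div /= !ratr_int rmorph_nat /el /omega; field.
Qed.

Lemma OK_el x y : OK (el x y). Proof. by apply/OKP; exists x, y. Qed.
Lemma OK_int x : OK x%:~R. Proof. by rewrite -el_int; exact: OK_el. Qed.
Lemma OK_nat n : OK n%:R. Proof. by rewrite pmulrn; exact: OK_int. Qed.
Lemma OK_omega : OK omega.
Proof. by apply/OKP; exists 0, 1; rewrite /el add0r mul1r. Qed.
Lemma OK_D z w : OK z -> OK w -> OK (z + w).
Proof. by move=> /OKP[x [y ->]] /OKP[u [v ->]]; rewrite elD; exact: OK_el. Qed.
Lemma OK_N z : OK z -> OK (- z).
Proof. by move=> /OKP[x [y ->]]; rewrite elN; exact: OK_el. Qed.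
Lemma OK_M z w : OK z -> OK w -> OK (z * w).
Proof. by move=> /OKP[x [y ->]] /OKP[u [v ->]]; rewrite elM; exact: OK_el. Qed.
Lemma OK_conj z : OK z -> OK z^*.
Proof. by move=> /OKP[x [y ->]]; rewrite conj_el; exact: OK_el. Qed.

Lemma el_norm x y : el x y * (el x y)^* = (x ^+ 2 + x * y + k%:Z * y ^+ 2)%:~R.
Proof.
rewrite conj_el elM -el_int; congr el; ring.
Qed.

(** The norm form represents 1 only by 1 and -1: 4 k - 1 is at least 7 since k > 1, which excludes
    the further units of Q(sqrt(-3)). *)
Lemma OK_unit z w : OK z -> OK w -> z * w = 1 -> z = 1 \/ z = -1.
Proof.
move=> /OKP[x [y ->]] /OKP[u [v ->]] e.
have : (el x y * (el x y)^* ) * (el u v * (el u v)^* ) = 1.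
  by rewrite mulrACA e -rmorphM /= e rmorph1 mulr1.
rewrite !el_norm -intrM => /eqP; rewrite -[1]/(1%:~R) eqr_int => /eqP.
set N := _ + _ + _; set N' := _ + _ + _ => NN.
have N4 : 4 * N = (2 * x + y) ^+ 2 + (4 * k%:Z - 1) * y ^+ 2 by rewrite /N; ring.
have N4' : 4 * N' = (2 * u + v) ^+ 2 + (4 * k%:Z - 1) * v ^+ 2 by rewrite /N'; ring.
have N0 : 0 <= N.
  have : 0 <= 4 * N by rewrite N4 addr_ge0 ?sqr_ge0 // mulr_ge0 ?sqr_ge0 //; lia.
  by rewrite pmulr_rge0.
have N1 : N = 1.
  have : (N %| 1)%Z by apply/dvdzP; exists N'; rewrite mulrC.
  rewrite dvdz1; lia.
rewrite N1 in N4.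
have y0 : y = 0.
  apply/eqP/negPn/negP => ny; have : 1 <= y ^+ 2 by rewrite -gtz0_ge1 exprn_even_gt0.
  move=> y1; have h7 : 7 * 1 <= (4 * k%:Z - 1) * y ^+ 2 by apply: ler_pM => //; move: k_gt1; clear; lia.
  have := sqr_ge0 (2 * x + y); move: N4 h7; move: ((2 * x + y) ^+ 2) (_ * y ^+ 2) => A B; clear; lia.
rewrite y0 in N4 *; rewrite !el_int.
have : x ^+ 2 == 1.
  by move: N4; rewrite addr0 expr0n /= mulr0 addr0 exprMn => h; apply/eqP; lia.
rewrite sqrf_eq1 => /orP[] /eqP ->; [by left | by right].
Qed.

(** * Hermite normal form of ideals, conjugation and norm *)

Definition idl (c a b : nat) : set algC :=
  [set z | exists x y : int, z = c%:R * (x%:~R * a%:R + y%:~R * (b%:R + omega))].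

Lemma idl_el (c a b : nat) (x y : int) : c%:R * (x%:~R * a%:R + y%:~R * (b%:R + omega)) =
  el (c%:Z * (x * a%:Z + y * b%:Z)) (c%:Z * y).
Proof. by rewrite /el !(intrM, intrD) -!pmulrn; ring. Qed.

Lemma idl_ideal c a b : (0 < c)%N -> (0 < a)%N -> is_root_mod k a b -> nonzero_ideal OK (idl c a b).
Proof.
move=> c0 a0 /dvdnP[e he]; split.
- by move=> z [x [y ->]]; rewrite idl_el; exact: OK_el.
- exists (c%:R * a%:R); last by rewrite mulf_neq0 // pnatr_eq0 -lt0n.
  by exists 1, 0; rewrite mul1r mul0r addr0.
- move=> _ _ [x [y ->]] [u [v ->]]; exists (x + u), (y + v).
  by rewrite !intrD; ring.
move=> _ _ /OKP[r [s ->]] [x [y ->]].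
exists (r * x - s * (b%:Z * x) - s * (y * e%:Z)), (r * y + s * (x * a%:Z) + s * y * (b%:Z + 1)).
have he' : (b%:R ^+ 2 + b%:R + k%:R : algC) = e%:R * a%:R by rewrite -natrM -he !natrD natrX.
rewrite /el !(intrD, intrM, mulrNz) -!pmulrn.
have o2 : omega ^+ 2 = omega - (e%:R * a%:R - b%:R ^+ 2 - b%:R).
  by rewrite omega_sqr -he'; ring.
have -> : (r%:~R + s%:~R * omega) * (c%:R * (x%:~R * a%:R + y%:~R * (b%:R + omega))) =
  c%:R * (r%:~R * (x%:~R * a%:R + y%:~R * (b%:R + omega)) + s%:~R * (x%:~R * a%:R * omega + y%:~R * b%:R * omega)
   + s%:~R * y%:~R * omega ^+ 2) :> algC by ring.
by rewrite o2; ring.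
Qed.

Lemma ideal_opp I x : nonzero_ideal OK I -> I x -> I (- x).
Proof. by case=> _ _ _ H Ix; rewrite -mulN1r; apply: H => //; rewrite -[-1]/((-1)%:~R); exact: OK_int. Qed.

Lemma ideal_comb I x y (u v : int) : nonzero_ideal OK I -> I x -> I y ->
  I (u%:~R * x + v%:~R * y).
Proof. by case=> _ _ A H Ix Iy; apply: A; apply: H => //; exact: OK_int. Qed.

(** Here m generates the integers in I, and c generates the omega-coordinates of the elements of I.
    Multiplication by omega shows that c divides m, and that it divides e for an element e + c omega
    of I; so c splits off. *)
Lemma ideal_hnf I : nonzero_ideal OK I ->
  exists c a b, [/\ (0 < c)%N, (0 < a)%N, (b < a)%N, is_root_mod k a b & I = idl c a b].
Proof.
move=> HI; have [IO [z0 Iz0 z00] IA IM] := HI.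
pose P1 := [set y : int | exists x, I (el x y)].
pose P2 := [set x : int | I (el x 0)].
have norm_in z : I z -> I (z * z^* ).
  by move=> Iz; rewrite mulrC; apply: IM => //; apply/OK_conj/IO.
have combE u v x y x' y' : u%:~R * el x y + v%:~R * el x' y' = el (u * x + v * x') (u * y + v * y').
  by rewrite /el !(intrD, intrM); ring.
have [m m0 Hm] : exists2 g : nat, (0 < g)%N & forall x, P2 x <-> exists t, x = t * g%:Z.
  apply: int_ideal_gen.
    have /OKP[x [y zE]] := IO _ Iz0.
    exists (x ^+ 2 + x * y + k%:Z * y ^+ 2).
      by rewrite /P2 /= el_int -el_norm -zE; exact: norm_in.
    have : z0 * z0^* != 0 by rewrite mulf_neq0 // fmorph_eq0.
    by rewrite zE el_norm intr_eq0.
  move=> x y u v Px Py; rewrite /P2 /=.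
  by have := ideal_comb u v HI Px Py; rewrite combE !mulr0 addr0.
have [c c0 Hc] : exists2 g : nat, (0 < g)%N & forall y, P1 y <-> exists t, y = t * g%:Z.
  apply: int_ideal_gen.
    exists m%:Z; last by lia.
    exists 0; have : I (el m%:Z 0) by apply/Hm; exists 1; rewrite mul1r.
    move=> /(IM _ _ OK_omega); rewrite (_ : omega * el m%:Z 0 = el 0 m%:Z) //.
    by rewrite /el; ring.
  move=> y y' u v [x Px] [x' Px']; exists (u * x + v * x').
  by have := ideal_comb u v HI Px Px'; rewrite combE.
have [e Ie] : P1 c%:Z by apply/Hc; exists 1; rewrite mul1r.
have [a ma] : exists a : int, m%:Z = a * c%:Z.
  apply/Hc; exists 0; have : I (el m%:Z 0) by apply/Hm; exists 1; rewrite mul1r.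
  move=> /(IM _ _ OK_omega); rewrite (_ : omega * el m%:Z 0 = el 0 m%:Z) //.
  by rewrite /el; ring.
have [b0 eb] : exists b0 : int, e = b0 * c%:Z.
  have [t ht] : exists t, e + c%:Z = t * c%:Z.
    apply/Hc; exists (- (k%:Z * c%:Z)).
    have := IM _ _ OK_omega Ie; congr I.
    have -> : omega = el 0 1 by rewrite /el add0r mul1r.
    by rewrite elM; congr el; ring.
  by exists (t - 1); rewrite mulrBl -ht; ring.
have a0 : 0 < a by nia.
pose b := `|(b0 %% a)%Z|%N.
have bE : b%:Z = b0 - (b0 %/ a)%Z * a.
  rewrite /b gez0_abs ?modz_ge0 ?gt_eqF // {2}(divz_eq b0 a); ring.
have aE : `|a|%N%:Z = a by rewrite gez0_abs // ltW.
have Ib : I (el (c%:Z * b%:Z) c%:Z).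
  have Im : I (el m%:Z 0) by apply/Hm; exists 1; rewrite mul1r.
  have := ideal_comb 1 (- (b0 %/ a)%Z) HI Ie Im; rewrite combE; congr (I (el _ _)); last by ring.
  by rewrite bE eb ma; ring.
have ba : (b < `|a|)%N by rewrite -ltz_nat aE /b gez0_abs ?modz_ge0 ?gt_eqF // ltz_pmod.
exists c, `|a|%N, b; split => //; first lia.
  (* Multiplying c (b + omega) by the conjugate of b + omega gives the integer c (b^2 + b + k) in I,
     which is therefore a multiple of m = c a. *)
  have := IM _ _ (OK_conj (OK_el b%:Z 1)) Ib.
  have -> : el (c%:Z * b%:Z) c%:Z = c%:Z%:~R * el b%:Z 1 by rewrite /el !intrM; ring.
  rewrite mulrCA [_^* * _]mulrC el_norm -intrM -el_int => /Hm[t].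
  have -> : b%:Z ^+ 2 + b%:Z * 1 + k%:Z * 1 ^+ 2 = (b ^ 2 + b + k)%N%:Z.
    by move: (b) => b'; clear; lia.
  rewrite ma -aE => h; rewrite /is_root_mod; apply/dvdnP; exists `|t|%N.
  have h2 : c%:Z * (b ^ 2 + b + k)%N%:Z = c%:Z * (t * `|a|%N%:Z) by rewrite h; ring.
  have cn : c%:Z != 0 by lia.
  by have := congr1 absz (mulfI cn h2); rewrite abszM !absz_nat.
have Im : I (el m%:Z 0) by apply/Hm; exists 1; rewrite mul1r.
apply/seteqP; split => z.
  move=> Iz; have /OKP[x [y zE]] := IO _ Iz.
  have [y' yE] : exists t, y = t * c%:Z by apply/Hc; exists x; rewrite -zE.
  have [t tE] : exists t, x - y' * (c%:Z * b%:Z) = t * m%:Z.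
    apply/Hm; have := ideal_comb 1 (- y') HI Iz Ib; rewrite zE combE.
    by rewrite /P2 /= yE; congr (I (el _ _)); ring.
  exists t, y'; rewrite zE idl_el aE; congr el; last by rewrite yE mulrC.
  have -> : x = t * m%:Z + y' * (c%:Z * b%:Z) by rewrite -tE subrK.
  by rewrite ma; ring.
move=> [x [y ->]]; rewrite idl_el aE.
have := ideal_comb x y HI Im Ib; rewrite combE; congr (I (el _ _)); last by ring.
by rewrite ma; ring.
Qed.

Definition scale_set (g : algC) (I : set algC) : set algC := [set g * x | x in I].
Definition conj_set (I : set algC) : set algC := [set x^* | x in I].

Lemma conj_setK I : conj_set (conj_set I) = I.
Proof.
apply/seteqP; split=> z; first by move=> [_ [x Ix <-] <-]; rewrite conjCK.
by move=> Iz; exists z^*; rewrite ?conjCK //; exists z.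
Qed.

Lemma idl_el_conj (c a b : nat) (u v : int) :
  (c%:R * (u%:~R * a%:R + v%:~R * (b%:R + omega)))^* =
   c%:R * (u%:~R * a%:R + v%:~R * (b%:R + 1 - omega)).
Proof.
rewrite rmorphM rmorph_nat rmorphD !rmorphM /= !rmorph_int rmorph_nat rmorphD /= rmorph_nat conj_omega.
by rewrite addrA.
Qed.

Lemma conj_idl c a b : (b < a)%N -> conj_set (idl c a b) = idl c a (a - 1 - b).
Proof.
move=> ba; have bE : (a - 1 - b)%:R = a%:R - 1 - b%:R :> algC.
  by rewrite !natrB //; lia.
apply/seteqP; split=> z.
  move=> [_ [x [y ->]] <-]; exists (x + y), (- y).
  by rewrite idl_el_conj bE intrD mulrNz; ring.
move=> [x [y ->]]; exists (c%:R * ((x + y)%:~R * a%:R + (- y)%:~R * (b%:R + omega))); first by exists (x + y), (- y).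
by rewrite idl_el_conj bE intrD mulrNz; ring.
Qed.

(* The product of [I] and its conjugate is the principal ideal [(n)]. *)
Definition ideal_norm (I : set algC) (n : nat) : Prop :=
  (forall z w, I z -> I w -> exists2 r, OK r & z * w^* = n%:R * r) /\
  (forall P : set algC, (forall x y, P x -> P y -> P (x + y)) -> (forall x, P x -> P (- x)) ->
     (forall z w, I z -> I w -> P (z * w^* )) -> P n%:R).

Lemma closed_int (P : set algC) x (u : int) :
  (forall x y, P x -> P y -> P (x + y)) -> (forall x, P x -> P (- x)) -> P x -> P (u%:~R * x).
Proof.
move=> PD PN Px.
have Pn (n : nat) : P (n%:R * x).
  elim: n => [|n IH]; first by rewrite mul0r -(subrr x); apply: PD => //; exact: PN.
  by rewrite -natr1 mulrDl mul1r; exact: PD.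
case: u => n; first by rewrite -pmulrn.
by rewrite NegzE mulrNz mulNr; apply: PN; rewrite -pmulrn.
Qed.

(** The square of a common prime factor would divide 4 a e - (2 b + 1)^2 = 4 k - 1. Thus the form
    (a, 2 b + 1, e) is primitive, which is what makes the ideal invertible. *)
Lemma bezout3 a b e : (b ^ 2 + b + k = e * a)%N ->
  exists u v w : int, u * a%:Z + v * b.*2.+1%:Z + w * e%:Z = 1.
Proof.
move=> he; have g1 : gcdn a (gcdn b.*2.+1 e) = 1%N.
  set g := gcdn _ _; case: (leqP g 1) => h.
    have : (0 < g)%N by rewrite !gcdn_gt0 orbT.
    by move: h; case: g => [|[]].
  have pq := pdiv_prime h; set q := pdiv g in pq.
  have qa : (q %| a)%N by apply: dvdn_trans (pdiv_dvd g) (dvdn_gcdl _ _).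
  have qb : (q %| b.*2.+1)%N.
    by apply: dvdn_trans (pdiv_dvd g) (dvdn_trans (dvdn_gcdr _ _) (dvdn_gcdl _ _)).
  have qe : (q %| e)%N.
    by apply: dvdn_trans (pdiv_dvd g) (dvdn_trans (dvdn_gcdr _ _) (dvdn_gcdr _ _)).
  case/negP: (sqfree pq).
  have -> : (4 * k - 1 = 4 * (e * a) - b.*2.+1 ^ 2)%N by rewrite -he; move: k_gt1; clear; lia.
  by apply: dvdn_sub; [rewrite dvdn_mull // -mulnn dvdn_mul | rewrite dvdn_exp2r].
have [u [v uv]] := Bezoutz a (gcdn b.*2.+1 e); have [u' [v' uv']] := Bezoutz b.*2.+1 e.
exists u, (v * u'), (v * v').
have : u * a%:Z + v * (gcdn b.*2.+1 e)%:Z = 1 by rewrite uv /gcdz !absz_nat g1.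
have -> : (gcdn b.*2.+1 e)%:Z = u' * b.*2.+1%:Z + v' * e%:Z by rewrite uv' /gcdz !absz_nat.
by move=> <-; ring.
Qed.

(** With b^2 + b + k = e a, the products of the generators yield c^2 a times a, 2 b + 1 and e, and
    [bezout3] combines these to c^2 a. *)
Lemma ideal_norm_idl c a b : is_root_mod k a b -> ideal_norm (idl c a b) (c ^ 2 * a).
Proof.
move=> /dvdnP[e he].
have he' : (b%:R ^+ 2 + b%:R + k%:R : algC) = e%:R * a%:R by rewrite -natrM -he !natrD natrX.
have wc := idl_el_conj c a b.
have nb : (b%:R + omega) * (b%:R + 1 - omega) = e%:R * a%:R.
  have -> : (b%:R + omega) * (b%:R + 1 - omega) = b%:R ^+ 2 + b%:R + omega - omega ^+ 2 by ring.
  by rewrite omega_sqr -he'; ring.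
split.
  move=> _ _ [x [y ->]] [u [v ->]]; rewrite wc.
  exists (x%:~R * u%:~R * a%:R + x%:~R * v%:~R * (b%:R + 1 - omega) + y%:~R * u%:~R * (b%:R + omega)
          + y%:~R * v%:~R * e%:R).
    have Oi := OK_int; have On := OK_nat; have Oo := OK_omega.
    have Ob : OK (b%:R + omega) by exact: OK_D.
    have Ob' : OK (b%:R + 1 - omega).
      by apply: OK_D; [apply: OK_D => //; exact: (On 1%N) | exact: OK_N].
    by do ?apply: OK_D; do ?apply: OK_M.
  rewrite natrM natrX.
  have -> : c%:R * (x%:~R * a%:R + y%:~R * (b%:R + omega)) * (c%:R * (u%:~R * a%:R + v%:~R * (b%:R + 1 - omega))) =
   c%:R ^+ 2 * (x%:~R * u%:~R * a%:R * a%:R + x%:~R * v%:~R * (b%:R + 1 - omega) * a%:R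
    + y%:~R * u%:~R * (b%:R + omega) * a%:R + y%:~R * v%:~R * ((b%:R + omega) * (b%:R + 1 - omega))) by ring.
  by rewrite nb; ring.
move=> P PD PN PP; have [u [v [w uvw]]] := bezout3 he.
have Ia : idl c a b (c%:R * (1%:~R * a%:R + 0%:~R * (b%:R + omega))) by exists 1, 0.
have Ib : idl c a b (c%:R * (0%:~R * a%:R + 1%:~R * (b%:R + omega))) by exists 0, 1.
have pA := closed_int u PD PN (PP _ _ Ia Ia).
have pB := closed_int v PD PN (PD _ _ (PP _ _ Ia Ib) (PP _ _ Ib Ia)).
have pC := closed_int w PD PN (PP _ _ Ib Ib).
have := PD _ _ (PD _ _ pA pB) pC; congr P; rewrite !wc natrM natrX.
have uvw' : u%:~R * a%:R + v%:~R * (2 * b%:R + 1) + w%:~R * e%:R = 1 :> algC.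
  transitivity ((1 : int)%:~R : algC) => //; rewrite -uvw !intrD !intrM -!pmulrn.
  by rewrite -[b.*2.+1%:R]natr1 -mul2n natrM.
rewrite [RHS](_ : _ = c%:R ^+ 2 * a%:R * (u%:~R * a%:R + v%:~R * (2 * b%:R + 1) + w%:~R * e%:R));
  last by rewrite uvw' mulr1.
have -> : w%:~R * (c%:R * (0%:~R * a%:R + 1%:~R * (b%:R + omega)) * (c%:R * (0%:~R * a%:R + 1%:~R * (b%:R + 1 - omega)))) =
  w%:~R * c%:R ^+ 2 * ((b%:R + omega) * (b%:R + 1 - omega)) by ring.
by rewrite nb; ring.
Qed.

Lemma int_mul_OK (n m : nat) r : (0 < n)%N -> OK r -> m%:R = n%:R * r -> (n %| m)%N.
Proof.
move=> n0 /OKP[x [y ->]]; have -> : n%:R * el x y = el (n%:Z * x) (n%:Z * y).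
  by rewrite /el !intrM -!pmulrn; ring.
rewrite pmulrn -el_int => /el_inj[e _]; apply/dvdnP; exists `|x|%N.
by have := congr1 absz e; rewrite abszM !absz_nat mulnC.
Qed.

Lemma ideal_norm_uniq I n m : (0 < n)%N -> (0 < m)%N -> ideal_norm I n -> ideal_norm I m -> n = m.
Proof.
have H n' m' : (0 < n')%N -> ideal_norm I n' -> ideal_norm I m' -> (n' %| m')%N.
  move=> n0 [h1 _] [_ h2].
  have [||z w Iz Iw|r Or e] := h2 [set x | exists2 r, OK r & x = n'%:R * r].
  - by move=> _ _ [r Or ->] [r' Or' ->]; exists (r + r'); [exact: OK_D | rewrite mulrDr].
  - by move=> _ [r Or ->]; exists (- r); [exact: OK_N | rewrite mulrN].
  - exact: h1.
  - exact: int_mul_OK Or e.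
by move=> n0 m0 h1 h2; apply/eqP; rewrite eqn_dvd !H.
Qed.

Lemma ideal_norm_scale I n m g : ideal_norm I n -> g * g^* * n%:R = m%:R -> ideal_norm (scale_set g I) m.
Proof.
move=> [h1 h2] e; split.
  move=> _ _ [z Iz <-] [w Iw <-]; have [r Or er] := h1 z w Iz Iw; exists r => //.
  by rewrite rmorphM /= mulrACA er mulrA e.
move=> P PD PN PP; have := h2 [set x | P (g * g^* * x)]; rewrite /= e; apply.
- by move=> x y Px Py; rewrite mulrDr; exact: PD.
- by move=> x Px; rewrite mulrN; exact: PN.
- move=> z w Iz Iw; rewrite -mulrACA -rmorphM; apply: PP; [by exists z | by exists w].
Qed.

Lemma ideal_norm_conj I n : ideal_norm I n -> ideal_norm (conj_set I) n.
Proof.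
move=> [h1 h2]; split.
  move=> _ _ [z Iz <-] [w Iw <-]; rewrite conjCK mulrC; exact: h1.
move=> P PD PN PP; apply: h2 => // z w Iz Iw.
by rewrite -{1}[z]conjCK mulrC; apply: PP; [exists w | exists z].
Qed.

Definition alpha (a b : nat) (x y : int) : algC := x%:~R * a%:R + y%:~R * (b%:R + omega).

Lemma idl1P a b z : idl 1 a b z <-> exists x y, z = alpha a b x y.
Proof. by split=> -[x [y ->]]; exists x, y; rewrite /alpha mul1r. Qed.

Lemma alpha_el a b x y : alpha a b x y = el (x * a%:Z + y * b%:Z) y.
Proof. by rewrite /alpha -[LHS]mul1r (idl_el 1) !mul1r. Qed.

Lemma alpha_inj a b x y u v : (0 < a)%N -> alpha a b x y = alpha a b u v -> x = u /\ y = v.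
Proof.
move=> a0; rewrite !alpha_el => /el_inj[e yv]; split => //; move: e; rewrite yv => /addIr.
by apply: mulIf; lia.
Qed.

(** The norm form N(x a + y (b + omega)) / a of the ideal, of discriminant 1 - 4 k when a divides
    b^2 + b + k. *)
Definition qf (a b : nat) := qform a b.*2.+1 ((b ^ 2 + b + k) %/ a).

Lemma alpha_norm a b x y : is_root_mod k a b ->
  alpha a b x y * (alpha a b x y)^* = a%:R * (qf a b x y)%:~R.
Proof.
move=> rt; rewrite alpha_el el_norm pmulrn -intrM; congr (_%:~R).
have := divnK rt; rewrite /qf /qform; move: (_ %/ a)%N => e he.
have -> : k%:Z = e%:Z * a%:Z - b%:Z ^+ 2 - b%:Z by move: he; clear; lia.
have -> : b.*2.+1%:Z = 2 * b%:Z + 1 by clear; lia.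
ring.
Qed.

Lemma qf_posdef a b : is_root_mod k a b -> (b.*2.+1 ^ 2 < 4 * a * ((b ^ 2 + b + k) %/ a))%N.
Proof.
move=> rt; have := divnK rt; move: (_ %/ a)%N => e; move: k_gt1; clear; nia.
Qed.

(** Let J be the ideal of (a, b). As J conj(J) = (a), the set (al / a) conj(J) is al J^-1, integral
    because al lies in J. *)
Lemma twist_ideal a b (al : algC) m : (0 < a)%N -> (0 < m)%N -> is_root_mod k a b ->
  idl 1 a b al -> al * al^* = a%:R * m%:R ->
  nonzero_ideal OK (scale_set (al / a%:R) (conj_set (idl 1 a b))) /\
  ideal_norm (scale_set (al / a%:R) (conj_set (idl 1 a b))) m.
Proof.
move=> a0 m0 rt Ial aln; have an : a%:R != 0 :> algC by rewrite pnatr_eq0 -lt0n.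
have HN := @ideal_norm_idl 1 a b rt; rewrite exp1n mul1n in HN.
have [IO [z0 Iz0 z00] IA IM] := @idl_ideal 1 a b isT a0 rt.
split; last first.
  apply: ideal_norm_scale (ideal_norm_conj HN) _.
  rewrite rmorphM fmorphV rmorph_nat /= mulrACA aln; field.
  exact: an.
have al0 : al != 0.
  apply/eqP => al0; move: aln; rewrite al0 mul0r => /esym/eqP.
  by rewrite mulf_eq0 !pnatr_eq0; move: a0 m0; clear; lia.
split.
- move=> _ [_ [w Iw <-] <-]; have [r Or e] := HN.1 _ _ Ial Iw.
  by rewrite mulrAC e mulrAC mulfV // mul1r.
- exists (al / a%:R * z0^* ); first by exists z0^* => //; exists z0.
  by rewrite !mulf_neq0 ?invr_eq0 ?fmorph_eq0.
- move=> _ _ [_ [x Ix <-] <-] [_ [y Iy <-] <-]; exists (x + y)^*; first by exists (x + y) => //; exact: IA.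
  by rewrite rmorphD /= mulrDr.
move=> r _ Or [_ [x Ix <-] <-]; exists (r^* * x)^*.
  by exists (r^* * x) => //; apply: IM => //; exact: OK_conj.
by rewrite rmorphM /= conjCK; ring.
Qed.

Lemma equiv_scaleP I J : ideal_equiv OK I J <->
  exists u v, [/\ OK u, u != 0, OK v, v != 0 & I = scale_set (u / v) J].
Proof.
split.
  move=> [a [b [[Oa a0] [Ob b0] e]]]; exists b, a; split=> //.
  apply/seteqP; split=> z.
    move=> Iz; have : [set a * x | x in I] (a * z) by exists z.
    rewrite e => -[y Jy h]; exists y => //.
    by apply: (mulfI a0); rewrite -h mulrA mulrCA mulfV // mulr1.
  move=> [y Jy <-]; have : [set b * y | y in J] (b * y) by exists y.
  rewrite -e => -[x Ix h]; have -> : b / a * y = x; last by [].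
  by apply: (mulfI a0); rewrite h mulrA mulrCA mulfV // mulr1.
move=> [u [v [Ou u0 Ov v0 ->]]]; exists v, u; split=> //.
apply/seteqP; split=> z.
  move=> [_ [y Jy <-] <-]; exists y => //.
  by rewrite mulrA mulrCA mulfV // mulr1.
move=> [y Jy <-]; exists (u / v * y); first by exists y.
by rewrite mulrA mulrCA mulfV // mulr1.
Qed.

Lemma scale_setA g h I : scale_set g (scale_set h I) = scale_set (g * h) I.
Proof.
apply/seteqP; split=> z.
  by move=> [_ [x Ix <-] <-]; exists x => //; rewrite mulrA.
by move=> [x Ix <-]; exists (h * x); [exists x | rewrite mulrA].
Qed.

Lemma scale_set1 I : scale_set 1 I = I.
Proof.
apply/seteqP; split=> z; first by move=> [x Ix <-]; rewrite mul1r.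
by move=> Iz; exists z; rewrite ?mul1r.
Qed.

Lemma conj_scale_set g I : conj_set (scale_set g I) = scale_set g^* (conj_set I).
Proof.
apply/seteqP; split=> z.
  by move=> [_ [x Ix <-] <-]; exists x^*; [exists x | rewrite rmorphM].
by move=> [_ [x Ix <-] <-]; exists (g * x); [exists x | rewrite rmorphM].
Qed.

Lemma equiv_refl I : ideal_equiv OK I I.
Proof.
apply/equiv_scaleP; exists 1, 1; have O1 := OK_nat 1.
by split; rewrite ?oner_eq0 // divr1 scale_set1.
Qed.

Lemma equiv_sym I J : ideal_equiv OK I J -> ideal_equiv OK J I.
Proof. by move=> [a [b [ha hb e]]]; exists b, a; split. Qed.

Lemma equiv_trans I J K : ideal_equiv OK I J -> ideal_equiv OK J K -> ideal_equiv OK I K.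
Proof.
move=> /equiv_scaleP[u [v [Ou u0 Ov v0 ->]]] /equiv_scaleP[u' [v' [Ou' u0' Ov' v0' ->]]].
apply/equiv_scaleP; exists (u * u'), (v * v'); split; try exact: OK_M; rewrite ?mulf_neq0 //.
by rewrite scale_setA; congr scale_set; rewrite invfM mulrACA.
Qed.

Lemma equiv_conj_set I J : ideal_equiv OK I J -> ideal_equiv OK (conj_set I) (conj_set J).
Proof.
move=> /equiv_scaleP[u [v [Ou u0 Ov v0 ->]]]; apply/equiv_scaleP; exists u^*, v^*.
split; try exact: OK_conj; rewrite ?fmorph_eq0 //.
by rewrite conj_scale_set rmorphM fmorphV.
Qed.

Lemma ideal_class_eq I J : nonzero_ideal OK I -> nonzero_ideal OK J ->
  (ideal_class OK I = ideal_class OK J) <-> ideal_equiv OK I J.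
Proof.
move=> HI HJ; split.
  move=> e; have : ideal_class OK J J by split=> //; exact: equiv_refl.
  by rewrite -e => -[].
move=> eIJ; apply/seteqP; split=> K [HK h]; split=> //.
  exact: equiv_trans (equiv_sym eIJ) h.
exact: equiv_trans eIJ h.
Qed.

Lemma idl_scale c a b : idl c a b = scale_set c%:R (idl 1 a b).
Proof.
apply/seteqP; split=> z.
  move=> [x [y ->]]; exists (alpha a b x y) => //; apply/idl1P; by exists x, y.
by move=> [_ /idl1P[x [y ->]] <-]; exists x, y.
Qed.

Lemma idl_equiv1 c a b : (0 < c)%N -> ideal_equiv OK (idl c a b) (idl 1 a b).
Proof.
move=> c0; apply/equiv_scaleP; exists c%:R, 1; split; rewrite ?oner_eq0 ?pnatr_eq0 -?lt0n //.
- exact: OK_nat.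
- exact: (OK_nat 1).
- by rewrite divr1 -idl_scale.
Qed.

Lemma twist_equiv a b (al : algC) : (0 < a)%N -> al != 0 -> idl 1 a b al ->
  ideal_equiv OK (scale_set (al / a%:R) (conj_set (idl 1 a b))) (conj_set (idl 1 a b)).
Proof.
move=> a0 al0 /idl1P[x [y alE]]; apply/equiv_scaleP; exists al, a%:R.
split; rewrite ?pnatr_eq0 -?lt0n //; last exact: OK_nat.
by rewrite alE alpha_el; exact: OK_el.
Qed.

(** * Reduction and representatives of the ideal classes *)

Lemma is_root_modC a b : (b < a)%N -> is_root_mod k a (a - 1 - b) = is_root_mod k a b.
Proof.
move=> ba; rewrite /is_root_mod.
have e : ((a - 1 - b) ^ 2 + (a - 1 - b) + k + a * (2 * b + 1) = (b ^ 2 + b + k) + a * a)%N.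
  have [t ->] : exists t, a = (b + t).+1 by exists (a - b.+1)%N; lia.
  have -> : ((b + t).+1 - 1 - b = t)%N by lia.
  lia.
have d1 : (a %| a * (2 * b + 1))%N by rewrite dvdn_mulr.
by rewrite -(dvdn_addl _ d1) e dvdn_addl // dvdn_mulr.
Qed.

(** A finite list meeting every class, possibly several times. The bound on a is far weaker than
    Gauss reduction; it is what the descent in [reduction] gives at once. *)
Definition reduced_pairs : seq (nat * nat) :=
  [seq ab <- [seq (a, b) | a <- iota 1 (4 * k - 1), b <- iota 0 a] | is_root_mod k ab.1 ab.2].

Lemma reduced_pairsP a b : (a, b) \in reduced_pairs =
  [&& (0 < a)%N, (a < 4 * k)%N, (b < a)%N & is_root_mod k a b].
Proof.
rewrite mem_filter /= andbC.
apply/andP/and4P.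
  move=> [/allpairsPdep[x [y [hx hy [-> ->]]]] h].
  by move: hx hy; rewrite !mem_iota => /andP[? ?] ?; split=> //; lia.
move=> [a0 ad ba h]; split=> //; apply/allpairsPdep; exists a, b.
by rewrite !mem_iota; split=> //; lia.
Qed.

(** Descent on the norm a. Twisting the conjugate ideal by an element of norm a m leads back to the
    class of the given ideal, at norm m < a; extracting the factor c of the normal form only lowers
    the norm. *)
Lemma reduction a b : (0 < a)%N -> (b < a)%N -> is_root_mod k a b ->
  exists2 ab, ab \in reduced_pairs & ideal_equiv OK (idl 1 a b) (idl 1 ab.1 ab.2).
Proof.
have [n] := ubnP a; elim: n a b => // n IH a b an a0 ba rt.
case: (ltnP a (4 * k)) => ad.
  by exists (a, b); [rewrite reduced_pairsP a0 ad ba | exact: equiv_refl].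
pose b' := (a - 1 - b)%N; have b'a : (b' < a)%N by rewrite /b'; lia.
have rt' : is_root_mod k a b' by rewrite is_root_modC.
have cjE : conj_set (idl 1 a b') = idl 1 a b.
  by rewrite conj_idl //; congr idl; rewrite /b'; lia.
(* Of b' + omega and b' + omega - a, this selects the one whose norm is e^2 + e + k with 2 e + 1 <=
   a; since 4 k <= a, dividing by a gives m < a. *)
pose t : int := if (2 * b' + 1 <= a)%N then 0 else -1.
pose e := if (2 * b' + 1 <= a)%N then b' else (a - 1 - b')%N.
have ea : (2 * e + 1 <= a)%N by rewrite /e; case: ifP; move: b'a; clear; lia.
have re : is_root_mod k a e by rewrite /e; case: ifP => // _; rewrite is_root_modC.
pose m := ((e ^ 2 + e + k) %/ a)%N.
have mE : (m * a = e ^ 2 + e + k)%N by rewrite divnK.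
have ma : (m < a)%N by move: mE ea ad; clear; nia.
have m0 : (0 < m)%N by move: mE k_gt1; case: m {ma} => //; clear; lia.
have aln : alpha a b' t 1 * (alpha a b' t 1)^* = a%:R * m%:R.
  rewrite alpha_el el_norm -natrM mulnC mE pmulrn; congr (_%:~R).
  rewrite /t /e; case: ifP => _; first by clear; lia.
  have [s ->] : exists s, a = (b' + s).+1 by exists (a - b'.+1)%N; lia.
  have -> : ((b' + s).+1 - 1 - b' = s)%N by clear; lia.
  by clear; lia.
have Ial : idl 1 a b' (alpha a b' t 1) by apply/idl1P; exists t, 1.
have [HI HN] := twist_ideal a0 m0 rt' Ial aln.
have al0 : alpha a b' t 1 != 0.
  apply/eqP => al0; move: aln; rewrite al0 mul0r => /esym/eqP.
  by rewrite mulf_eq0 !pnatr_eq0; move: a0 m0; clear; lia.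
have eq1 := twist_equiv a0 al0 Ial; rewrite cjE in HI HN eq1.
have [c1 [a1 [b1 [c10 a10 b1a1 rt1 IE]]]] := ideal_hnf HI.
rewrite IE in HI HN eq1.
have nE : (c1 ^ 2 * a1 = m)%N.
  apply: ideal_norm_uniq (ideal_norm_idl _ rt1) HN => //.
  by rewrite muln_gt0 expn_gt0 c10.
have a1m : (a1 < n)%N by move: nE c10 ma an; clear; nia.
have [ab hab eq2] := IH _ _ a1m a10 b1a1 rt1.
exists ab => //; apply: equiv_trans (equiv_sym eq1) _.
by apply: equiv_trans (idl_equiv1 _ _ c10) eq2.
Qed.

Definition pair_class (ab : nat * nat) : set (set algC) := ideal_class OK (idl 1 ab.1 ab.2).

Lemma reduced_ideal ab : ab \in reduced_pairs -> nonzero_ideal OK (idl 1 ab.1 ab.2).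
Proof.
by case: ab => a b; rewrite reduced_pairsP => /and4P[a0 _ _ rt]; exact: idl_ideal.
Qed.

Lemma ideal_reduced I : nonzero_ideal OK I ->
  exists2 ab, ab \in reduced_pairs & ideal_equiv OK I (idl 1 ab.1 ab.2).
Proof.
move=> HI; have [c [a [b [c0 a0 ba rt ->]]]] := ideal_hnf HI.
have [ab hab e] := reduction a0 ba rt; exists ab => //.
exact: equiv_trans (idl_equiv1 _ _ c0) e.
Qed.

Lemma ideal_classesE : ideal_classes OK = [set` [seq pair_class ab | ab <- reduced_pairs]].
Proof.
apply/seteqP; split=> C /=.
  move=> [I HI <-]; have [ab hab e] := ideal_reduced HI.
  by apply/mapP; exists ab => //; apply/ideal_class_eq => //; exact: reduced_ideal.
by move=> /mapP[ab hab ->]; exists (idl 1 ab.1 ab.2) => //; exact: reduced_ideal.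
Qed.

(** [fset_set] would be empty on an infinite set; the finite list [reduced_pairs] shows that
    [class_number] really counts the classes. *)
Lemma class_reps : exists reps : seq (nat * nat),
  [/\ size reps = class_number (quadratic_field (- (4 * k - 1)%N%:Z)),
      {subset reps <= reduced_pairs}, uniq reps,
      {in reps &, forall ab ab', ideal_equiv OK (idl 1 ab.1 ab.2) (idl 1 ab'.1 ab'.2) -> ab = ab'} &
      forall I, nonzero_ideal OK I -> exists2 ab, ab \in reps & ideal_equiv OK I (idl 1 ab.1 ab.2)].
Proof.
have [r [rs e inj]] := undup_map_preimage pair_class reduced_pairs.
exists r; split=> //.
- rewrite /class_number -/OK ideal_classesE.
  have -> : [set` [seq pair_class ab | ab <- reduced_pairs]] =
    [set` [fset x in [seq pair_class ab | ab <- reduced_pairs]]%fset].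
    by apply/seteqP; split=> C /=; rewrite in_fset.
  by rewrite set_fsetK card_fseq -e size_map.
- by apply: (map_uniq (f := pair_class)); rewrite e undup_uniq.
- move=> ab ab' hab hab' h; apply: inj => //.
  by apply/ideal_class_eq => //; apply: reduced_ideal; exact: rs.
move=> I HI; have [ab hab h] := ideal_reduced HI.
have : pair_class ab \in undup (map pair_class reduced_pairs) by rewrite mem_undup map_f.
rewrite -e => /mapP[ab' hab' h']; exists ab' => //; apply: equiv_trans h _.
by apply/ideal_class_eq; try (apply: reduced_ideal => //; exact: rs).
Qed.

(** * Ideals of norm n against representations of n *)

Definition ideal_triples (n : nat) : seq (nat * nat * nat) :=
  [seq (c, n %/ c ^ 2, b)%N | c <- [seq c <- divisors n | (c ^ 2 %| n)%N],
                             b <- [seq b <- iota 0 (n %/ c ^ 2) | is_root_mod k (n %/ c ^ 2) b]].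

Lemma size_ideal_triples n : size (ideal_triples n) = idealcount k n.
Proof.
rewrite size_allpairs_dep sumnE big_map big_filter.
by apply: eq_bigr => c _; rewrite size_filter.
Qed.

Lemma ideal_triplesP n c a b : (0 < n)%N -> (c, a, b) \in ideal_triples n =
  [&& (0 < c)%N, (0 < a)%N, (b < a)%N, is_root_mod k a b & (c ^ 2 * a == n)%N].
Proof.
move=> n0; apply/allpairsPdep/and5P.
  move=> [c' [b' [hc hb [-> -> ->]]]]; move: hc hb.
  rewrite !mem_filter mem_iota -dvdn_divisors // => /andP[c2 cn] /andP[rt /andP[_ ba]].
  have c0 := dvdn_gt0 n0 cn; split=> //; first by apply: leq_ltn_trans ba.
  by rewrite mulnC divnK.
move=> [c0 a0 ba rt /eqP e]; exists c, b.
have c20 : (0 < c ^ 2)%N by rewrite expn_gt0 c0.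
have -> : (n %/ c ^ 2 = a)%N by rewrite -e mulKn.
split=> //; rewrite mem_filter.
  rewrite -dvdn_divisors // -e dvdn_mulr //=; apply: dvdn_trans (dvdn_mulr a (dvdnn (c ^ 2))).
  by rewrite -mulnn dvdn_mulr.
by rewrite rt mem_iota.
Qed.

Lemma ideal_triples_uniq n : (0 < n)%N -> uniq (ideal_triples n).
Proof.
move=> n0; apply: allpairs_uniq_dep.
- by rewrite filter_uniq // divisors_uniq.
- by move=> c _; rewrite filter_uniq // iota_uniq.
by move=> [c b] [c' b'] _ _ [-> _ ->].
Qed.

Lemma idl_inj c a b c' a' b' : (0 < c)%N -> (0 < a)%N -> (b < a)%N -> (0 < c')%N -> (0 < a')%N -> (b' < a')%N ->
  idl c a b = idl c' a' b' -> (c, a, b) = (c', a', b').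
Proof.
have H (c1 a1 b1 c2 a2 b2 : nat) : (0 < c1)%N -> (0 < a1)%N -> (0 < c2)%N -> idl c1 a1 b1 `<=` idl c2 a2 b2 ->
   (c2 %| c1)%N.
  move=> c10 a10 c20 sub.
  have /sub[x [y]] : idl c1 a1 b1 (c1%:R * (0%:~R * a1%:R + 1%:~R * (b1%:R + omega))) by exists 0, 1.
  rewrite !idl_el mulr1 => /el_inj[_ h]; apply/dvdnP; exists `|y|%N.
  by have := congr1 absz h; rewrite abszM !absz_nat mulnC.
move=> c0 a0 ba c0' a0' ba' e.
have ec : c = c'.
  apply/eqP; rewrite eqn_dvd (H c' a' b' c a b) ?(H c a b c' a' b') //; by rewrite e.
subst c'.
have H2 (a1 b1 a2 b2 : nat) : (0 < a1)%N -> idl c a1 b1 `<=` idl c a2 b2 -> (a2 %| a1)%N.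
  move=> a10 sub.
  have /sub[x [y]] : idl c a1 b1 (c%:R * (1%:~R * a1%:R + 0%:~R * (b1%:R + omega))) by exists 1, 0.
  have cn : c%:Z != 0 by lia.
  rewrite !idl_el => /el_inj[h /(mulfI cn) y0]; move: h; rewrite -y0 !mul0r !addr0 mul1r => /(mulfI cn) h.
  apply/dvdnP; exists `|x|%N; by have := congr1 absz h; rewrite abszM !absz_nat.
have ea : a = a'.
  apply/eqP; rewrite eqn_dvd (H2 a' b' a b) ?(H2 a b a' b') //; by rewrite e.
subst a'; congr (_, _).
have : idl c a b' (c%:R * (0%:~R * a%:R + 1%:~R * (b%:R + omega))) by rewrite -e; exists 0, 1.
move=> [x [y]]; have cn : c%:Z != 0 by lia.
rewrite !idl_el => /el_inj[h /(mulfI cn) y1]; move: h; rewrite -y1 !mul0r !add0r !mul1r => /(mulfI cn) h.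
have [x0|[x1|x1]] : x = 0 \/ (1 <= x \/ x <= -1) by clear; lia.
- by move: h; rewrite x0 mul0r add0r => -[].
- by move: h ba ba' x1; clear; nia.
- by move: h ba ba' x1; clear; nia.
Qed.

(** Multiplication by the ideal itself turns the equality into one between the principal ideals of
    g1 a and g2 a. Used in both directions, it makes the ratio a unit. *)
Lemma scale_set_unit a b g1 g2 : (0 < a)%N -> is_root_mod k a b -> g2 != 0 ->
  scale_set g1 (conj_set (idl 1 a b)) = scale_set g2 (conj_set (idl 1 a b)) -> OK (g1 / g2).
Proof.
move=> a0 rt g20 e; have := @ideal_norm_idl 1 a b rt; rewrite exp1n mul1n => -[h1 h2].
have an : a%:R != 0 :> algC by rewrite pnatr_eq0 -lt0n.
have [||z w Iz Iw|r Or er] := h2 [set x | exists2 r, OK r & g1 / g2 * x = a%:R * r].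
- by move=> x y [r Or er] [r' Or' er']; exists (r + r'); [exact: OK_D | rewrite !mulrDr er er'].
- by move=> x [r Or er]; exists (- r); [exact: OK_N | rewrite !mulrN er].
- have : scale_set g1 (conj_set (idl 1 a b)) (g1 * w^* ) by exists w^* => //; exists w.
  rewrite e => -[_ [w' Iw' <-] hw]; have [r Or er] := h1 _ _ Iz Iw'; exists r => //.
  rewrite -er mulrCA; congr (_ * _); apply: (mulfI g20); rewrite hw.
  by rewrite mulrA [g2 * _]mulrC divfK.
- have -> : g1 / g2 = r; last by [].
  by apply: (mulfI an); rewrite -er mulrC.
Qed.

(* As [alpha] ranges over the ideal [J] of [ab], [(alpha / a) conj J] ranges
   over all ideals in the class of [conj J], each being hit by [alpha] and
   [- alpha] only. *)
Definition is_twist (ab : nat * nat) (x y : int) (t : nat * nat * nat) : Prop :=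
  idl t.1.1 t.1.2 t.2 = scale_set (alpha ab.1 ab.2 x y / ab.1%:R) (conj_set (idl 1 ab.1 ab.2)).

Lemma twist_neq0 ab x y t : (0 < t.1.1)%N -> (0 < t.1.2)%N -> is_twist ab x y t -> alpha ab.1 ab.2 x y != 0.
Proof.
move=> c0 a0 e; apply/eqP => al0.
have : idl t.1.1 t.1.2 t.2 (t.1.1%:R * t.1.2%:R) by exists 1, 0; rewrite mul1r mul0r addr0.
rewrite e al0 mul0r => -[z _]; rewrite mul0r => /esym/eqP.
by rewrite mulf_eq0 !pnatr_eq0; move: c0 a0; clear; lia.
Qed.

Lemma qf_gt0 a b x y : (0 < a)%N -> is_root_mod k a b -> alpha a b x y != 0 ->
  exists2 m : nat, (0 < m)%N & qf a b x y = m%:Z.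
Proof.
move=> a0 rt al0; have q0 := qform_ge0 (qf_posdef rt) x y; rewrite -/(qf a b x y) in q0.
exists `|qf a b x y|%N; last by rewrite gez0_abs.
rewrite absz_gt0; apply/eqP => q1; have := alpha_norm x y rt; rewrite q1 mulr0 => /eqP.
by rewrite mulf_eq0 fmorph_eq0 (negbTE al0).
Qed.

Lemma twist_norm ab x y n t : (0 < n)%N -> ab \in reduced_pairs -> t \in ideal_triples n ->
  is_twist ab x y t -> qf ab.1 ab.2 x y = n%:Z.
Proof.
case: ab t => a b [[c a'] b'] n0; rewrite reduced_pairsP ideal_triplesP //.
move=> /and4P[a0 _ ba rt] /and5P[c0 a0' ba' rt' /eqP nE] tw.
have al0 := @twist_neq0 (a, b) x y (c, a', b') c0 a0' tw.
have [m m0 qm] := qf_gt0 a0 rt al0; rewrite /= qm; congr Posz.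
have aln := alpha_norm x y rt; rewrite qm -pmulrn in aln.
have Ial : idl 1 a b (alpha a b x y) by apply/idl1P; exists x, y.
have [_ HN] := twist_ideal a0 m0 rt Ial aln; rewrite /is_twist /= in tw; rewrite -tw in HN.
have HN' := @ideal_norm_idl c a' b' rt'; rewrite nE in HN'.
exact: ideal_norm_uniq HN HN'.
Qed.

(** A representation of n determines an ideal of norm n, whose normal form is unique. Writing the
    indicator as a sum over ideals prepares the double counting in [rep_total]. *)
Lemma twist_unique ab x y n : (0 < n)%N -> ab \in reduced_pairs ->
  (if qf ab.1 ab.2 x y == n%:Z then 1 else 0) = \sum_(t <- ideal_triples n) (`[< is_twist ab x y t >] : nat)%:Z.
Proof.
move=> n0 hab; case: eqP => [qn|qn]; last first.
  rewrite big1_seq // => t /andP[_ ht]; case: asboolP => // tw.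
  by case: qn; exact: twist_norm tw.
case: ab hab qn => a b hab qn; have := hab; rewrite reduced_pairsP => /and4P[a0 _ ba rt].
have aln := alpha_norm x y rt; rewrite qn -pmulrn in aln.
have Ial : idl 1 a b (alpha a b x y) by apply/idl1P; exists x, y.
have [HI HN] := twist_ideal a0 n0 rt Ial aln.
have [c [a' [b' [c0 a0' ba' rt' IE]]]] := ideal_hnf HI.
have HN' := @ideal_norm_idl c a' b' rt'; rewrite -IE in HN'.
have nE : (c ^ 2 * a' = n)%N.
  by apply: ideal_norm_uniq HN' HN => //; rewrite muln_gt0 expn_gt0 c0.
have ht : (c, a', b') \in ideal_triples n by rewrite ideal_triplesP // c0 a0' ba' rt' nE eqxx.
rewrite (bigD1_seq _ ht) ?ideal_triples_uniq //= asboolT ?big1_seq //.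
move=> [[c1 a1] b1] /andP[ne ht1]; case: asboolP => // tw; case/eqP: ne.
move: ht1; rewrite ideal_triplesP // => /and5P[? ? ? _ _].
by apply: idl_inj => //; rewrite -IE.
Qed.

(** For an ideal I, exactly one representative J lies in the class of conj(I), the inverse of the
    class of I. Then I = (al / a) conj(J) determines al up to the units 1 and -1. *)
Lemma twist_pair reps n M t : (0 < n)%N ->
  {subset reps <= reduced_pairs} -> uniq reps ->
  {in reps &, forall ab ab', ideal_equiv OK (idl 1 ab.1 ab.2) (idl 1 ab'.1 ab'.2) -> ab = ab'} ->
  (forall I, nonzero_ideal OK I -> exists2 ab, ab \in reps & ideal_equiv OK I (idl 1 ab.1 ab.2)) ->
  (forall a b, (a, b) \in reps -> qscale a b.*2.+1 ((b ^ 2 + b + k) %/ a) * n < M ^ 2)%N ->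
  t \in ideal_triples n ->
  \sum_(ab <- reps) zsum2 M (fun x y => (`[< is_twist ab x y t >] : nat)%:Z) = 2.
Proof.
case: t => [[c a'] b'] n0 rs ru rinj rcov hM ht.
have := ht; rewrite ideal_triplesP // => /and5P[c0 a0' ba' rt' /eqP nE].
have HI := idl_ideal c0 a0' rt'.
have HcI : nonzero_ideal OK (conj_set (idl c a' b')).
  by rewrite conj_idl //; apply: idl_ideal => //; rewrite is_root_modC.
have [[a b] hab eqv] := rcov _ HcI.
have eqv' := equiv_conj_set eqv; rewrite conj_setK /= in eqv'.
have hab' := rs _ hab; have := hab'; rewrite reduced_pairsP => /and4P[a0 _ ba rt].
have Ial x y : idl 1 a b (alpha a b x y) by apply/idl1P; exists x, y.
rewrite (bigD1_seq _ hab) //= big1_seq ?addr0; last first.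
  move=> ab1 /andP[ne hab1]; apply: zsum0 => x; apply: zsum0 => y; case: asboolP => // tw.
  have al0 := @twist_neq0 ab1 x y (c, a', b') c0 a0' tw.
  have := rs _ hab1; case: ab1 ne hab1 tw al0 => a1 b1 ne hab1 tw al0.
  rewrite reduced_pairsP => /and4P[a10 _ _ _].
  have Ial1 : idl 1 a1 b1 (alpha a1 b1 x y) by apply/idl1P; exists x, y.
  have := twist_equiv a10 al0 Ial1; rewrite /is_twist /= in tw; rewrite -tw => eq1.
  have := equiv_conj_set (equiv_trans (equiv_sym eq1) eqv'); rewrite !conj_setK => eq2.
  by case/eqP: ne; apply: (rinj (a1, b1) (a, b)).
have [u [v [Ou u0 Ov v0 IE]]] := (equiv_scaleP _ _).1 eqv'.
set g := u / v in IE; have g0 : g != 0 by rewrite mulf_neq0 ?invr_eq0.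
have an : a%:R != 0 :> algC by rewrite pnatr_eq0 -lt0n.
have [IO _ IA IM] := @idl_ideal 1 a b isT a0 rt.
have HJ := @idl_ideal 1 a b isT a0 rt.
(* The integer a lies in the product of J and conj(J), so g a lies in the product of J and g conj(J)
   = I, which is contained in J. *)
have : idl 1 a b (g * a%:R).
  have := @ideal_norm_idl 1 a b rt; rewrite exp1n mul1n => -[_ h2].
  apply: (h2 [set x | idl 1 a b (g * x)]).
  - by move=> x y Px Py; rewrite /= mulrDr; exact: IA.
  - by move=> x Px; rewrite /= mulrN; exact: ideal_opp.
  - move=> z w Iz Iw /=; rewrite mulrCA mulrC; apply: IM => //.
    have [IO' _ _ _] := HI; apply: IO'; rewrite IE; exists w^* => //; by exists w.
move=> /idl1P[x0 [y0 alE]].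
have gE : g = alpha a b x0 y0 / a%:R by rewrite -alE mulfK.
have al0 : alpha a b x0 y0 != 0 by rewrite -alE mulf_neq0.
have tw0 : is_twist (a, b) x0 y0 (c, a', b') by rewrite /is_twist /= -gE.
have alN x y : alpha a b (- x) (- y) = - alpha a b x y by rewrite /alpha !mulrNz; ring.
have twE x y : is_twist (a, b) x y (c, a', b') <->
    ((x == x0) && (y == y0)) || ((x == - x0) && (y == - y0)).
  split.
    move=> tw; have al1 := @twist_neq0 (a, b) x y (c, a', b') c0 a0' tw; rewrite /= in al1.
    have e : scale_set (alpha a b x y / a%:R) (conj_set (idl 1 a b)) = scale_set (alpha a b x0 y0 / a%:R) (conj_set (idl 1 a b)).
      by rewrite -[LHS]tw -[RHS]tw0.
    have n1 : alpha a b x y / a%:R != 0 by rewrite mulf_neq0 ?invr_eq0.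
    have n2 : alpha a b x0 y0 / a%:R != 0 by rewrite mulf_neq0 ?invr_eq0.
    have O1 := scale_set_unit a0 rt n2 e; have O2 := scale_set_unit a0 rt n1 (esym e).
    have [|h|h] := OK_unit O1 O2.
    - by rewrite mulrA divfK // divff.
    - have : alpha a b x y = alpha a b x0 y0.
        by apply: (mulIf (x := (a%:R)^-1)); rewrite ?invr_eq0 // -[LHS](divfK n2) h mul1r.
      by move=> /(alpha_inj a0)[-> ->]; rewrite !eqxx.
    - have : alpha a b x y = alpha a b (- x0) (- y0).
        rewrite alN; apply: (mulIf (x := (a%:R)^-1)); rewrite ?invr_eq0 // -[LHS](divfK n2) h.
        by rewrite mulN1r mulNr.
      by move=> /(alpha_inj a0)[-> ->]; rewrite !eqxx orbT.
  case/orP => /andP[/eqP -> /eqP ->] //.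
  rewrite /is_twist /= alN mulNr -gE IE; apply/seteqP; split=> z.
    move=> [_ [w Iw <-] <-]; exists (- w)^*; last by rewrite rmorphN /= mulrNN.
    by exists (- w) => //; exact: ideal_opp.
  move=> [_ [w Iw <-] <-]; exists (- w)^*; last by rewrite rmorphN /= mulrN mulNr.
  by exists (- w) => //; exact: ideal_opp.
have qn : qf a b x0 y0 = n%:Z by exact: (@twist_norm (a, b) x0 y0 n (c, a', b')).
have [||hx hy] := @qform_small _ _ _ (qf_posdef rt) x0 y0 M n; [by rewrite -/(qf a b x0 y0) qn | exact: hM |].
rewrite -[RHS](@zsum2_pair M x0 y0); try exact: ltnW.
  apply: eq_zsum => x; apply: eq_zsum => y; congr (nat_of_bool _)%:Z.
  by apply/asboolP/idP => /twE.
apply/norP => -[/negPn/eqP x00 /negPn/eqP y00]; move: al0.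
by rewrite x00 y00 /alpha !mul0r addr0 eqxx.
Qed.

Lemma rep_total reps n : (0 < n)%N ->
  {subset reps <= reduced_pairs} -> uniq reps ->
  {in reps &, forall ab ab', ideal_equiv OK (idl 1 ab.1 ab.2) (idl 1 ab'.1 ab'.2) -> ab = ab'} ->
  (forall I, nonzero_ideal OK I -> exists2 ab, ab \in reps & ideal_equiv OK I (idl 1 ab.1 ab.2)) ->
  \sum_(ab <- reps) form_count ab.1 ab.2.*2.+1 ((ab.2 ^ 2 + ab.2 + k) %/ ab.1) n = 2 * (idealcount k n)%:Z.
Proof.
move=> n0 rs ru rinj rcov.
pose qs (ab : nat * nat) := (qscale ab.1 ab.2.*2.+1 ((ab.2 ^ 2 + ab.2 + k) %/ ab.1) * n)%N.
pose M := (\sum_(ab <- reps) qs ab).+1.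
have hM ab : ab \in reps -> (qs ab < M ^ 2)%N.
  move=> hab; have : (qs ab < M)%N by rewrite /M ltnS (bigD1_seq _ hab) //= leq_addr.
  by move/leq_trans; apply; rewrite -mulnn leq_pmulr.
transitivity (\sum_(ab <- reps) \sum_(t <- ideal_triples n)
    zsum2 M (fun x y => (`[< is_twist ab x y t >] : nat)%:Z)).
  rewrite big_seq [RHS]big_seq; apply: eq_bigr => ab hab.
  have := rs _ hab; case: ab hab => a b hab; rewrite reduced_pairsP => /and4P[a0 _ ba rt].
  rewrite /= -(form_countE (qf_posdef rt) (hM _ hab)).
  transitivity (zsum2 M (fun x y => \sum_(t <- ideal_triples n) (`[< is_twist (a, b) x y t >] : nat)%:Z)).
    by apply: eq_zsum => x; apply: eq_zsum => y; rewrite -twist_unique //; exact: rs.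
  rewrite /zsum2 /zsum [RHS]exchange_big /=; apply: eq_bigr => i _.
  by rewrite [RHS]exchange_big.
rewrite exchange_big /= (@eq_big_seq _ _ _ _ _ _ (fun=> 2)) => [|t ht]; last first.
  by apply: (@twist_pair reps n M t n0 rs ru rinj rcov) => // a b; exact: hM.
rewrite -size_ideal_triples; elim: (ideal_triples n) => [|t s IH]; first by rewrite big_nil.
by rewrite big_cons IH /=; lia.
Qed.

End QuadraticOrder.

(** * The class number formula *)

Lemma form_count0 A B C : (B ^ 2 < 4 * A * C)%N -> form_count A B C 0 = 1.
Proof.
move=> pd; rewrite -(@form_countE _ _ _ pd 1); last by rewrite muln0.
transitivity (zsum 1 (fun x => if x == 0 then zsum 1 (fun y => if y == 0 then 1 else 0 : int) else 0 : int)).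
  apply: eq_zsum => x; case: eqP => [->|x0].
    apply: eq_zsum => y; case: (eqVneq y 0) => [->|y0]; first by rewrite (_ : qform A B C 0 0 = 0) // /qform; ring.
    rewrite ifF //; apply/eqP => q0; have [||_] := @qform_small _ _ _ pd 0 y 1 0; rewrite ?q0 ?muln0 //.
    by move/eqP: y0; lia.
  apply: zsum0 => y; rewrite ifF //; apply/eqP => q0.
  by have [||h _] := @qform_small _ _ _ pd x y 1 0; rewrite ?q0 ?muln0 //; lia.
by rewrite !zsum_delta.
Qed.

Section ClassNumberFormula.
Variables (k : nat) (chi : nat -> int).
Hypothesis k_gt1 : (1 < k)%N.
Hypothesis sqfree : forall q, prime q -> ~~ (q ^ 2 %| 4 * k - 1)%N.
Hypothesis chi1 : chi 1 = 1.
Hypothesis chiM : forall m n, chi (m * n) = chi m * chi n.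
Hypothesis chi_split : forall q, prime q -> (root_count k q)%:Z = 1 + chi q.
Hypothesis chi_ram : forall q, prime q -> (chi q == 0) = (q %| 4 * k - 1)%N.
Hypothesis chi_val : forall n, [|| chi n == 0, chi n == 1 | chi n == -1].
Hypothesis chi_0 : chi 0 = 0.
Hypothesis chi_per : forall n, chi (4 * k - 1 + n)%N = chi n.
Hypothesis chi_sum : \sum_(r < 4 * k - 1) chi r = 0.

Let chiQ n : rat := (chi n)%:~R.

Let divs n : rat := (divsum chi n)%:~R.

Lemma divsE n : (0 < n)%N -> divs n = \sum_(1 <= m < n.+1 | (m %| n)%N) chiQ m.
Proof.
move=> n0; rewrite /divs /divsum rmorph_sum -[RHS]big_filter; apply: perm_big; apply: uniq_perm.
- exact: divisors_uniq.
- by rewrite filter_uniq // iota_uniq.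
- move=> m; rewrite mem_filter mem_index_iota -dvdn_divisors //.
  case: (boolP (m %| n)%N) => //= h; symmetry.
  by rewrite (dvdn_gt0 _ h) //= ltnS dvdn_leq.
Qed.

(** The sign (-1)^(j - 1) is 1, minus 2 if j is even: coefficientwise this is eta(s) = (1 - 2^(1 -
    s)) zeta(s). *)
Lemma eta_divsum n : (0 < n)%N ->
  eta_conv chiQ n = divs n - 2 * (if odd n then 0 else divs n./2).
Proof.
move=> n0; rewrite /eta_conv divsE //.
have -> : (if odd n then 0 else divs n./2) =
   \sum_(1 <= m < n.+1 | (m %| n)%N) (if odd (n %/ m) then 0 else chiQ m).
  case: ifP => on.
    rewrite big1 // => m /dvdnP[j jE]; rewrite ifT //.
    have m0 : (0 < m)%N by move: n0; rewrite jE muln_gt0 => /andP[].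
    by move: on; rewrite jE mulnK // oddM => /andP[].
  have nE : n = (n./2).*2 by rewrite -{1}(odd_double_half n) on.
  have h0 : (0 < n./2)%N by lia.
  rewrite divsE // (big_nat_widen _ _ n.+1) /=; last by lia.
  rewrite big_mkcond [RHS]big_mkcond /=; apply: eq_big_nat => m /andP[m0 mn].
  case: (boolP (m %| n)%N) => [/dvdnP[j jE]|nd].
    rewrite jE mulnK //; case: (boolP (odd j)) => oj.
      rewrite ifF //; apply/negP => /andP[/dvdnP[i iE] _].
      have : (j * m = i * m + i * m)%N by rewrite -iE addnn -jE.
      rewrite -mulnDl => /eqP; rewrite eqn_pmul2r // => /eqP ji.
      by move: oj; rewrite ji addnn odd_double.
    have jE2 : (j * m)./2 = (j./2 * m)%N.
      have := odd_double_half j; rewrite (negbTE oj) add0n => <-.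
      by rewrite doubleK -doubleMl doubleK.
    rewrite jE jE2 in h0; rewrite jE2 dvdn_mull //= ifT // ltnS.
    by apply: dvdn_leq h0 _; rewrite dvdn_mull.
  rewrite ifF //; apply: contraNF nd => /andP[/dvdn_trans h _]; apply: h.
  by rewrite {2}nE -muln2 dvdn_mulr.
rewrite mulr_sumr -sumrB; apply: eq_bigr => m md.
have j0 : (0 < n %/ m)%N by rewrite divn_gt0 ?(dvdn_leq n0 md) // (dvdn_gt0 n0 md).
rewrite -signr_odd; have -> : odd (n %/ m).-1 = ~~ odd (n %/ m).
  by case: (n %/ m)%N j0 => //= j _; rewrite negbK.
by case: odd; rewrite /= ?expr0 ?expr1; ring.
Qed.

Lemma chiQ_le1 n : `|chiQ n| <= 1.
Proof. by rewrite /chiQ; case/or3P: (chi_val n) => /eqP ->. Qed.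

(* With [r(n)] the number of representations of [n] by all reduced classes,
   [r(n) - 4 r(n / 4)] has Abel sum [0]. Its term at [0] is [- 3 h]; for [n > 0]
   it is [2 (e(n) + 2 e(n / 2))], [e] the coefficients with Abel sum [L(0) / 2]. *)
Lemma class_number_formula :
  (class_number (quadratic_field (- (4 * k - 1)%N%:Z)))%:R =
  - (\sum_(r < 4 * k - 1) r%:R * (chi r)%:~R) / (4 * k - 1)%N%:R :> rat.
Proof.
set h := class_number _; rewrite -[RHS]/(L_zero (4 * k - 1) chiQ).
have [reps [sz rs ru rinj rcov]] := class_reps k_gt1 sqfree.
have d0 : (0 < 4 * k - 1)%N by lia.
have ea : abel_sum (eta_conv chiQ) (L_zero (4 * k - 1) chiQ / 2).
  apply: eta_abel => //.
  - by move=> n; rewrite /chiQ chi_per.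
  - by rewrite /chiQ chi_0.
  - exact: chiQ_le1.
  - by rewrite /chiQ -rmorph_sum chi_sum.
have ea2 := abel_double ea.
have al0 : abel_sum (fun n => \sum_(ab <- reps)
   ((form_count ab.1 ab.2.*2.+1 ((ab.2 ^ 2 + ab.2 + k) %/ ab.1) n)%:~R
    - (if (4 %| n)%N then 4 * (form_count ab.1 ab.2.*2.+1 ((ab.2 ^ 2 + ab.2 + k) %/ ab.1) (n %/ 4))%:~R else 0) : rat))
   (\sum_(ab <- reps) 0).
  apply: (@abel_big _ _ reps _ (fun=> 0)) => ab /rs; case: ab => a b.
  by rewrite (reduced_pairsP k_gt1) => /and4P[a0 _ _ rt]; apply: form_count_abel; exact: (qf_posdef k_gt1 rt).
rewrite big1 // in al0.
(* Its Abel sum is - 3 h + 2 (L / 2 + 2 (L / 2)) = 3 (L - h), to be compared with 0. *)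
have al1 := abelD (abel_point (- 3 * h%:R : rat)) (abelZ 2 (abelD ea (abelZ 2 ea2))).
have tot n : \sum_(ab <- reps) (form_count ab.1 ab.2.*2.+1 ((ab.2 ^ 2 + ab.2 + k) %/ ab.1) n)%:~R =
    (if n is 0 then h%:R else 2 * divs n) :> rat.
  case: n => [|n].
    rewrite /h -sz; have : {subset reps <= reduced_pairs k} by [].
    elim: (reps) => [|[a b] r IH] rs'; first by rewrite big_nil.
    rewrite big_cons IH => [|x xr]; last by apply: rs'; rewrite inE xr orbT.
    have := rs' (a, b) (mem_head _ _); rewrite (reduced_pairsP k_gt1) => /and4P[a0 _ _ rt].
    by rewrite form_count0 ?(qf_posdef k_gt1 rt) //= -natr1 addrC.
  rewrite -rmorph_sum /= (rep_total k_gt1 sqfree _ rs ru rinj rcov) //.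
  by rewrite (idealcount_divsum _ sqfree chi1 chiM chi_split chi_ram chi_val) // ?intrM //; lia.
have al2 := abel_ext _ al1; have /al2 al3 : (fun n => (if n is 0 then - 3 * h%:R else 0) +
     2 * (eta_conv chiQ n + 2 * (if odd n then 0 else eta_conv chiQ n./2))) =1
   (fun n => \sum_(ab <- reps)
   ((form_count ab.1 ab.2.*2.+1 ((ab.2 ^ 2 + ab.2 + k) %/ ab.1) n)%:~R
    - (if (4 %| n)%N then 4 * (form_count ab.1 ab.2.*2.+1 ((ab.2 ^ 2 + ab.2 + k) %/ ab.1) (n %/ 4))%:~R else 0) : rat)).
  move=> n; rewrite sumrB tot.
  have -> : \sum_(ab <- reps) (if (4 %| n)%N then 4 * (form_count ab.1 ab.2.*2.+1 ((ab.2 ^ 2 + ab.2 + k) %/ ab.1) (n %/ 4))%:~R else 0)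
    = (if (4 %| n)%N then 4 * (if (n %/ 4)%N is 0 then h%:R else 2 * divs (n %/ 4)) else 0) :> rat.
    by case: ifP => _; rewrite -?mulr_sumr ?tot // big1.
  case: n => [|n].
    rewrite dvdn0 div0n /= [eta_conv chiQ 0]/eta_conv big_geq //; ring.
  rewrite eta_divsum //; case: ifP => on.
    by rewrite ifF; [ring | lia].
  have n20 : (0 < n.+1./2)%N by lia.
  rewrite eta_divsum //; case: (boolP (4 %| n.+1)%N) => n4; last first.
    by rewrite ifT; [ring | lia].
  rewrite ifF; last by lia.
  have -> : (n.+1 %/ 4 = n.+1./2./2)%N by lia.
  have : (0 < n.+1./2./2)%N by lia.
  by case: (n.+1./2./2) => // j _; ring.
have := abel_uniq al0 al3; move: (L_zero _ _) => L; lra.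
Qed.

End ClassNumberFormula.

(** * Character sums over tenths of the period *)

Lemma odd_char_sum0 (d : nat) (chi : nat -> int) : chi 0 = 0 ->
  (forall r, (r <= d)%N -> chi (d - r)%N = - chi r) -> \sum_(r < d) chi r = 0.
Proof.
move=> chi0 H.
have dz : chi d = 0 by have := H 0%N (leq0n d); rewrite subn0 chi0 oppr0.
have e : \sum_(r < d) chi r = \sum_(r < d.+1) chi r by rewrite big_ord_recr /= dz addr0.
have : \sum_(r < d.+1) chi r = - \sum_(r < d.+1) chi r.
  rewrite {1}(reindex_inj rev_ord_inj) /= -sumrN; apply: eq_bigr => r _.
  by rewrite subSS H // -ltnS.
by rewrite -e; lia.
Qed.

Lemma modn_cancel N p r s : coprime p N -> (N * r = N * s %[mod p])%N ->
  (r < p)%N -> (s < p)%N -> r = s.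
Proof.
move=> co; wlog rs : r s / (r <= s)%N => [H e rp sp|].
  by case: (leqP r s) => [|/ltnW] h; [exact: H | apply/esym; exact: H].
move=> /esym/eqP; rewrite eqn_mod_dvd ?leq_mul2l ?rs ?orbT // -mulnBr Gauss_dvdr // => h _ sp.
by case: (posnP (s - r)) => [|h0]; [lia | have := dvdn_leq h0 h; lia].
Qed.

Section CharacterSums.
Variable p : nat.
Hypotheses (p_prime : prime p) (p_mod4 : (p %% 4 = 3)%N).

Let p_odd : odd p. Proof. by move: p_mod4; clear; lia. Qed.
Let p_gt0 : (0 < p)%N. Proof. exact: prime_gt0. Qed.
Let p_neq5 : p != 5%N. Proof. by apply: contra_eqN p_mod4 => /eqP ->. Qed.

Notation c := (leg p).

Lemma leg0 : c 0 = 0. Proof. by rewrite /leg dvdn0. Qed.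

Lemma leg_opp r : (r <= p)%N -> c (p - r) = - c r.
Proof.
move=> rp; rewrite /leg; have -> : (p %| p - r)%N = (p %| r)%N by rewrite dvdn_subr.
case: ifP => pr //; have r0 : (r%:R : 'F_p) != 0 by rewrite Fp_nat_eq0 // pr.
have -> : ((p - r)%:R : 'F_p) = - r%:R.
  by rewrite natrB // (_ : p%:R = 0) ?sub0r //; apply/eqP; rewrite Fp_nat_eq0.
rewrite exprNn -signr_odd; have -> : odd p.-1./2 by move: p_mod4; clear; lia.
rewrite expr1 mulN1r eqr_oppLR; have f1 := Fp_m1 p_prime p_odd.
by case/orP: (Fp_half p_prime p_odd r0) => /eqP ->; rewrite ?eqxx ?(negbTE f1) // eq_sym (negbTE f1).
Qed.

Lemma leg_sum0 : \sum_(r < p) c r = 0.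
Proof. exact: odd_char_sum0 leg0 leg_opp. Qed.

Lemma leg_sqr n : ~~ (p %| n)%N -> c n * c n = 1.
Proof. by rewrite -leg_eq0; case/or3P: (leg_val p n) => /eqP ->. Qed.

Section Multiplier.
Variable N : nat.
Hypothesis copN : ~~ (p %| N)%N.

Definition mulp (r : 'I_p) : 'I_p := Ordinal (ltn_pmod (N * r) p_gt0).

Lemma mulp_inj : injective mulp.
Proof.
move=> r s /(congr1 val) /= e; apply: val_inj; apply: modn_cancel e _ _ => //.
by rewrite prime_coprime.
Qed.

Lemma leg_mulp (G : nat -> int) :
  \sum_(r < p) c r * G r = c N * \sum_(r < p) c r * G ((N * r) %% p)%N.
Proof.
rewrite (reindex_inj mulp_inj) /= mulr_sumr; apply: eq_bigr => r _.
by rewrite leg_mod // legM // mulrA.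
Qed.

(** N r is p times the quotient plus the remainder modulo p. Multiplication by N permutes the
    remainders and multiplies the symbol by [c N]. *)
Lemma leg_floor_sum :
  p%:Z * (\sum_(r < p) c r * ((N * r) %/ p)%N%:Z) = (N%:Z - c N) * \sum_(r < p) r%:Z * c r.
Proof.
have e1 : \sum_(r < p) c r * ((N * r) %% p)%N%:Z = c N * \sum_(r < p) r%:Z * c r.
  have -> : \sum_(r < p) r%:Z * c r = \sum_(r < p) c r * r%:Z.
    by apply: eq_bigr => r _; rewrite mulrC.
  by rewrite (leg_mulp (fun r => r%:Z)) mulrA leg_sqr // mul1r.
rewrite mulrBl -e1 !mulr_sumr -sumrB; apply: eq_bigr => r _.
have : (N * r)%N%:Z = ((N * r) %/ p)%N%:Z * p%:Z + ((N * r) %% p)%N%:Z.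
  by rewrite -PoszM -PoszD -divn_eq.
rewrite PoszM => E.
have -> : N%:Z * (r%:Z * c r) = c r * (N%:Z * r%:Z) by ring.
by rewrite E; ring.
Qed.

End Multiplier.

(** * The sums of the Legendre symbol over the ten intervals *)

Definition tenth (r : nat) : nat := ((10 * r) %/ p)%N.
Definition S10 (j : nat) : int := \sum_(r < p) c r * ((tenth r == j) : nat)%:Z.

Lemma tenth_lt (r : 'I_p) : (tenth r < 10)%N.
Proof. by rewrite /tenth ltn_divLR // ltn_pmul2l. Qed.

Lemma S10_sum (G : nat -> int) :
  \sum_(r < p) c r * G (tenth r) = \sum_(j < 10) G j * S10 j.
Proof.
transitivity (\sum_(r < p) \sum_(j < 10) G j * (c r * ((tenth r == j) : nat)%:Z)).
  apply: eq_bigr => r _; rewrite (bigD1 (Ordinal (tenth_lt r))) //= eqxx big1 => [|j /eqP ne].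
    by rewrite addr0 mulr1 mulrC.
  case: eqP => [e|_]; last by rewrite !mulr0.
  by case: ne; apply: val_inj; rewrite /= e.
by rewrite exchange_big /=; apply: eq_bigr => j _; rewrite mulr_sumr.
Qed.

Lemma S10_sum_nth (G : nat -> int) (s : seq int) :
  (forall j, (j < 10)%N -> G j = s`_j) ->
  \sum_(r < p) c r * G (tenth r) = \sum_(j < 10) s`_j * S10 j.
Proof. by move=> H; rewrite S10_sum; apply: eq_bigr => j _; rewrite H. Qed.

Hypothesis p_gt3 : (3 < p)%N.

Let p_cop10 : coprime p 10.
Proof.
rewrite (@coprimeMr p 2 5) !prime_coprime // !dvdn_prime2 //.
by rewrite p_neq5 andbT; apply: contra_eqN p_mod4 => /eqP ->.
Qed.

Lemma tenth_opp (r : nat) : (0 < r)%N -> (r < p)%N -> tenth (p - r) = (9 - tenth r)%N.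
Proof.
move=> r0 rp; rewrite /tenth.
have nd : ~~ (p %| 10 * r)%N by rewrite Gauss_dvdr // gtnNdvd.
have E := divn_eq (10 * r) p; have m0 : (0 < (10 * r) %% p)%N by rewrite lt0n.
have mp : ((10 * r) %% p < p)%N by rewrite ltn_mod.
move: E m0 mp; move: (_ %/ p)%N (_ %% p)%N => q t E m0 mp.
have q9 : (q <= 9)%N by move: E rp mp; clear; nia.
have -> : (10 * (p - r) = (9 - q) * p + (p - t))%N by move: E q9 rp mp; clear; nia.
by rewrite divnMDl // divn_small ?addn0 // ltn_subrL m0.
Qed.

Lemma S10_opp j : (j <= 9)%N -> S10 (9 - j) = - S10 j.
Proof.
move=> j9; rewrite /S10.
rewrite -sumrN.
have -> : \sum_(r < p) c r * ((tenth r == (9 - j)%N) : nat)%:Z =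
  \sum_(r < p.+1) c r * ((tenth r == (9 - j)%N) : nat)%:Z.
  by rewrite big_ord_recr /= -[c p]leg_mod // modnn leg0 mul0r addr0.
rewrite (reindex_inj rev_ord_inj) /= big_ord_recr /= !subSS subnn leg0 mul0r addr0.
apply: eq_bigr => r _; rewrite subSS leg_opp ?(ltnW (ltn_ord r)) // mulNr; congr (- _).
case: (posnP (r : nat)) => [->|r0]; first by rewrite leg0 !mul0r.
rewrite tenth_opp //; congr (_ * (nat_of_bool _)%:Z).
by have := tenth_lt r; move: (tenth r) j9; clear; lia.
Qed.

Variable h1 : rat.
Hypothesis h1E : h1 = - (\sum_(r < p) r%:R * (c r)%:~R) / p%:R.

Lemma weighted_leg_sum : (\sum_(r < p) r%:Z * c r)%:~R = - (p%:R * h1) :> rat.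
Proof.
rewrite h1E rmorph_sum /=; under eq_bigr do rewrite intrM -pmulrn.
by field; rewrite pnatr_eq0 -lt0n.
Qed.

Lemma floor_sum_h1 N : ~~ (p %| N)%N ->
  (\sum_(r < p) c r * ((N * r) %/ p)%N%:Z)%:~R = - (N%:R - (c N)%:~R) * h1 :> rat.
Proof.
move=> cop; have pn : p%:R != 0 :> rat by rewrite pnatr_eq0 -lt0n.
apply: (mulfI pn); have := congr1 (fun z : int => z%:~R : rat) (leg_floor_sum cop).
rewrite intrM -pmulrn => ->; rewrite intrM weighted_leg_sum rmorphB /= -pmulrn; ring.
Qed.

Lemma S10_opps : [/\ S10 5 = - S10 4, S10 6 = - S10 3, S10 7 = - S10 2, S10 8 = - S10 1 & S10 9 = - S10 0].
Proof. by split; rewrite -S10_opp. Qed.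

Lemma S10_half : (S10 0 + S10 1 + S10 2 + S10 3 + S10 4)%:~R = (2 - (c 2)%:~R) * h1 :> rat.
Proof.
have n2 : ~~ (p %| 2)%N by rewrite gtnNdvd // ltnW.
have := floor_sum_h1 n2.
have -> : \sum_(r < p) c r * ((2 * r) %/ p)%N%:Z = \sum_(r < p) c r * (tenth r %/ 5)%N%:Z.
  apply: eq_bigr => r _; congr (_ * _%:Z); rewrite /tenth -divnMA (mulnC p 5).
  by rewrite (_ : 10 * r = 5 * (2 * r))%N ?divnMl //; lia.
rewrite (@S10_sum_nth (fun j => (j %/ 5)%N%:Z) [:: 0; 0; 0; 0; 0; 1; 1; 1; 1; 1]); last first.
  by case=> [|[|[|[|[|[|[|[|[|[|j]]]]]]]]]].
have [e5 e6 e7 e8 e9] := S10_opps.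
rewrite !big_ord_recr big_ord0 /= e5 e6 e7 e8 e9 => H.
by apply: (@oppr_inj rat); rewrite -mulNr -H -rmorphN /=; congr (_%:~R); ring.
Qed.

Lemma S10_fifth : (4 * (S10 0 + S10 1) + 2 * (S10 2 + S10 3))%:~R = (5 - (c 5)%:~R) * h1 :> rat.
Proof.
have n5 : ~~ (p %| 5)%N by rewrite dvdn_prime2.
have := floor_sum_h1 n5.
have -> : \sum_(r < p) c r * ((5 * r) %/ p)%N%:Z = \sum_(r < p) c r * (tenth r %/ 2)%N%:Z.
  apply: eq_bigr => r _; congr (_ * _%:Z); rewrite /tenth -divnMA (mulnC p 2).
  by rewrite (_ : 10 * r = 2 * (5 * r))%N ?divnMl //; lia.
rewrite (@S10_sum_nth (fun j => (j %/ 2)%N%:Z) [:: 0; 0; 1; 1; 2; 2; 3; 3; 4; 4]); last first.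
  by case=> [|[|[|[|[|[|[|[|[|[|j]]]]]]]]]].
have [e5 e6 e7 e8 e9] := S10_opps.
rewrite !big_ord_recr big_ord0 /= e5 e6 e7 e8 e9 => H.
by apply: (@oppr_inj rat); rewrite -mulNr -H -rmorphN /=; congr (_%:~R); ring.
Qed.

(** Reducing 2 r modulo p changes 10 r / p by a multiple of 5, so the fifth containing 2 r mod p is
    the tenth of r taken modulo 5. *)
Lemma leg_double i :
  \sum_(r < p) c r * ((tenth r %/ 2 == i)%N : nat)%:Z =
  c 2 * \sum_(r < p) c r * ((tenth r %% 5 == i)%N : nat)%:Z.
Proof.
have n2 : ~~ (p %| 2)%N by rewrite gtnNdvd // ltnW.
rewrite (leg_mulp n2 (fun r => ((tenth r %/ 2 == i)%N : nat)%:Z)); congr (_ * _).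
apply: eq_bigr => r _; congr (_ * (nat_of_bool (_ == _))%:Z).
rewrite /tenth -divnMA (mulnC p 2) (_ : 10 * ((2 * r) %% p) = 2 * (5 * ((2 * r) %% p)))%N; last by lia.
rewrite divnMl // (_ : 10 * r = 5 * (2 * r))%N; last by lia.
have E := divn_eq (2 * r) p; have mp : ((2 * r) %% p < p)%N by rewrite ltn_mod.
have -> : (5 * (2 * r) = ((2 * r) %/ p * 5) * p + 5 * ((2 * r) %% p))%N.
  by rewrite {1}E; move: (_ %/ _)%N (_ %% _)%N; clear; lia.
rewrite divnMDl // modnMDl [RHS]modn_small //.
by rewrite ltn_divLR // ltn_pmul2l.
Qed.

Lemma S10_double0 : S10 0 + S10 1 = c 2 * (S10 0 + S10 5).
Proof.
have := leg_double 0.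
rewrite (@S10_sum_nth (fun j => ((j %/ 2 == 0)%N : nat)%:Z) [:: 1; 1; 0; 0; 0; 0; 0; 0; 0; 0]); last first.
  by case=> [|[|[|[|[|[|[|[|[|[|j]]]]]]]]]].
rewrite (@S10_sum_nth (fun j => ((j %% 5 == 0)%N : nat)%:Z) [:: 1; 0; 0; 0; 0; 1; 0; 0; 0; 0]); last first.
  by case=> [|[|[|[|[|[|[|[|[|[|j]]]]]]]]]].
by rewrite !big_ord_recr !big_ord0 /= !mul0r !mul1r ?add0r ?addr0.
Qed.

Lemma S10_double1 : S10 2 + S10 3 = c 2 * (S10 1 + S10 6).
Proof.
have := leg_double 1.
rewrite (@S10_sum_nth (fun j => ((j %/ 2 == 1)%N : nat)%:Z) [:: 0; 0; 1; 1; 0; 0; 0; 0; 0; 0]); last first.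
  by case=> [|[|[|[|[|[|[|[|[|[|j]]]]]]]]]].
rewrite (@S10_sum_nth (fun j => ((j %% 5 == 1)%N : nat)%:Z) [:: 0; 1; 0; 0; 0; 0; 1; 0; 0; 0]); last first.
  by case=> [|[|[|[|[|[|[|[|[|[|j]]]]]]]]]].
by rewrite !big_ord_recr !big_ord0 /= !mul0r !mul1r ?add0r ?addr0.
Qed.

(** X^2 + X + k has two roots modulo 2 for even k and none for odd k, and k = (p + 1) / 4 is odd
    exactly for p congruent to 3 modulo 8. *)
Lemma leg2 : c 2 = if (p %% 8 == 3)%N then -1 else 1.
Proof.
have := @root_count_leg p 2 p_prime p_mod4 isT; set k := ((p + 1) %/ 4)%N.
have -> : (root_count k 2 = if odd k then 0 else 2)%N.
  by rewrite /root_count /= /is_root_mod; case: ifP; clear; lia.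
have -> : odd k = (p %% 8 == 3)%N by rewrite /k; move: p_mod4; clear; lia.
by case: ifP => _; lia.
Qed.

Lemma leg5_recip : c 5 = leg 5 p.
Proof.
have := @root_count_leg p 5 p_prime p_mod4 isT; set k := ((p + 1) %/ 4)%N.
have pk : p = (4 * k - 1)%N by rewrite /k; move: p_mod4; clear; lia.
have k0 : (0 < k)%N by rewrite /k; move: p_mod4; clear; lia.
have p5 : (p %% 5 != 0)%N by rewrite -/(5 %| p)%N dvdn_prime2 // eq_sym.
rewrite leg5_mod.
have Ek := divn_eq k 5; have k5 : (k %% 5 < 5)%N by rewrite ltn_mod.
(* Modulo 5 the discriminant 1 - 4 k is k + 1: a nonzero square for k = 0, 3, a nonsquare for k = 1,
   2, and zero for k = 4. *)
have rhoE : root_count k 5 = nth 0%N [:: 2; 0; 0; 2; 1]%N (k %% 5).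
  rewrite {1}Ek /root_count /is_root_mod /=; move: (k %/ 5)%N (k %% 5)%N k5 => t i.
  by case: i => [|[|[|[|[|i]]]]] //= _; lia.
have pE : (p %% 5 = nth 0 [:: 4; 3; 2; 1; 0] (k %% 5))%N.
  rewrite pk; move: k0; rewrite Ek; move: (k %/ 5)%N (k %% 5)%N k5 => t i.
  by case: i => [|[|[|[|[|i]]]]] //= _; rewrite modnMDl /=; lia.
rewrite pE rhoE in p5 *; move: k5 p5; case: (k %% 5)%N => [|[|[|[|[|i]]]]] //= _ _; lia.
Qed.

(** * The class number of Q(sqrt(-5p)) in terms of sums over tenths *)

Section FiveP.
Variable h2 : rat.
Hypothesis h2E : h2 = - (\sum_(r < 5 * p) r%:R * (leg5p p r)%:~R) / (5 * p)%N%:R.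

Let p5_gt0 : (0 < 5 * p)%N. Proof. by rewrite muln_gt0. Qed.

Definition crt5 (uv : 'I_p * 'I_5) : 'I_(5 * p) := Ordinal (ltn_pmod (5 * uv.1 + p * uv.2) p5_gt0).

Lemma crt_bij : bijective crt5.
Proof.
apply: inj_card_bij; last by rewrite card_prod !card_ord mulnC.
move=> [u v] [u' v'] /(congr1 val) /= e.
have co : coprime 5 p by rewrite prime_coprime // dvdn_prime2 // eq_sym.
have eu : (5 * u = 5 * u' %[mod p])%N.
  have := congr1 (modn^~ p) e; rewrite !modn_dvdm ?dvdn_mull //.
  by rewrite -[(5 * u + _)%N]addnC -[(5 * u' + _)%N]addnC !(mulnC p) !modnMDl.
have ev : (p * v = p * v' %[mod 5])%N.
  have := congr1 (modn^~ 5%N) e; rewrite !modn_dvdm ?dvdn_mulr //.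
  by rewrite !(mulnC 5%N) !modnMDl.
congr (_, _); apply: val_inj.
  by apply: modn_cancel eu _ _; rewrite // coprime_sym.
by apply: modn_cancel ev _ _.
Qed.

(** Put r = 5 u + p v modulo 5 p. By reciprocity the character becomes (u / p) (v / 5). Both 1 and v
    sum to 0 against (v / 5), so the terms 5 u and p v drop out; there remains 5 p times the
    quotient by 5 p, which is the integer part of ([5 u / p] + v) / 5. *)
Lemma h2_fifths : h2 = (2 * (S10 2 + S10 3))%:~R.
Proof.
have T : \sum_(r < 5 * p) r%:Z * leg5p p r = - ((5 * p)%N%:Z * (2 * (S10 2 + S10 3))).
  rewrite (reindex crt5 (onW_bij _ crt_bij)) /=.
  rewrite -(pair_bigA _ (fun (u : 'I_p) (v : 'I_5) =>
    ((5 * u + p * v) %% (5 * p))%N%:Z * leg5p p ((5 * u + p * v) %% (5 * p)))) /=.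
  pose q j v := ((j %/ 2 + v) %/ 5)%N%:Z.
  pose G j := q j 1%N - q j 2%N - q j 3%N + q j 4%N.
  have term (u : 'I_p) (v : 'I_5) :
      ((5 * u + p * v) %% (5 * p))%N%:Z * leg5p p ((5 * u + p * v) %% (5 * p)) =
      c u * ((5 * u%:Z + p%:Z * v%:Z - 5 * p%:Z * q (tenth u) v) * leg 5 v).
    have -> : leg5p p ((5 * u + p * v) %% (5 * p)) = c u * leg 5 v.
      have d5 : (5 %| 5 * p)%N by rewrite dvdn_mulr.
      have dp : (p %| 5 * p)%N by rewrite dvdn_mull.
      rewrite /leg5p -[leg 5 _]leg_mod // -[c (_ %% _)]leg_mod // (modn_dvdm _ d5) (modn_dvdm _ dp).
      rewrite !leg_mod //; have -> : leg 5 (5 * u + p * v) = leg 5 p * leg 5 v.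
        by rewrite -leg_mod // mulnC modnMDl leg_mod // legM.
      have -> : c (5 * u + p * v) = c 5 * c u.
        by rewrite -leg_mod // addnC mulnC modnMDl leg_mod // legM.
      have c55 : c 5 * c 5 = 1 by apply: leg_sqr; rewrite dvdn_prime2.
      by rewrite -leg5_recip mulrACA c55 mul1r mulrC.
    have -> : ((5 * u + p * v) %% (5 * p))%N%:Z = 5 * u%:Z + p%:Z * v%:Z - 5 * p%:Z * q (tenth u) v.
      have -> : q (tenth u) v = ((5 * u + p * v) %/ (5 * p))%N%:Z.
        rewrite /q; congr Posz; have -> : (5 * u + p * v = v * p + 5 * u)%N by rewrite addnC (mulnC p).
        rewrite [(5 * p)%N]mulnC divnMA divnMDl // [in LHS]addnC.
        congr ((_ + _) %/ _)%N; rewrite /tenth -divnMA (mulnC p 2).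
        by rewrite (_ : 10 * u = 2 * (5 * u))%N ?divnMl //; clear; lia.
      have := divn_eq (5 * u + p * v) (5 * p); move: (_ %/ _)%N (_ %% _)%N => a b; clear; lia.
    ring.
  transitivity (- ((5 * p)%N%:Z * \sum_(u < p) c u * G (tenth u))).
    rewrite mulr_sumr -sumrN; apply: eq_bigr => u _.
    under eq_bigr do rewrite term; rewrite -mulr_sumr !big_ord_recr big_ord0 /= !leg5_mod /= PoszM /G.
    ring.
  (* For i = [5 u / p] the quotient is 1 if v >= 5 - i and 0 otherwise; the signs 1, -1, -1, 1 of v
     = 1, ..., 4 then add up to 0, 1, 0, -1, 0 for i = 0, ..., 4. *)
  rewrite (@S10_sum_nth G [:: 0; 0; 1; 1; 0; 0; -1; -1; 0; 0]); last first.
    by case=> [|[|[|[|[|[|[|[|[|[|j]]]]]]]]]].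
  have [e5 e6 e7 e8 e9] := S10_opps; rewrite !big_ord_recr big_ord0 /= e5 e6 e7 e8 e9.
  by congr (- (_ * _)); ring.
rewrite h2E; have -> : \sum_(r < 5 * p) r%:R * (leg5p p r)%:~R = (\sum_(r < 5 * p) r%:Z * leg5p p r)%:~R :> rat.
  by rewrite rmorph_sum /=; apply: eq_bigr => r _; rewrite intrM -pmulrn.
rewrite T mulrNz opprK intrM -pmulrn mulrC mulKf // pnatr_eq0 -lt0n //.
Qed.

End FiveP.

(** * Numbers of integers and of residues in each tenth *)

Definition residue_count (j : nat) : nat := count (fun r => (c r == 1) && (tenth r == j)) (iota 0 p).

Definition interval_count (j : nat) : nat := count (fun r => (0 < r)%N && (tenth r == j)) (iota 0 p).

Lemma count_iotaE (P : pred nat) : (count P (iota 0 p))%:Z = \sum_(r < p) (P r : nat)%:Z.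
Proof.
have -> : iota 0 p = index_iota 0 p by rewrite /index_iota subn0.
rewrite -sum1_count big_mkcond big_mkord.
by rewrite (big_morph Posz PoszD (erefl _)); apply: eq_bigr => r _; case: (P r).
Qed.

Lemma leg_ind (r : 'I_p) : 2 * ((c r == 1) : nat)%:Z = ((0 < r)%N : nat)%:Z + c r.
Proof.
case: (posnP (r : nat)) => [->|r0]; first by rewrite leg0.
have : c r != 0 by rewrite leg_eq0 gtnNdvd.
by case/or3P: (leg_val p r) => /eqP ->.
Qed.

Lemma residue_countE j : 2 * (residue_count j)%:Z = (interval_count j)%:Z + S10 j.
Proof.
rewrite /residue_count /interval_count !count_iotaE mulr_sumr /S10 -big_split /=; apply: eq_bigr => r _.
by have := leg_ind r; case: (tenth r == j); rewrite ?andbT ?andbF ?mulr1 ?mulr0.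
Qed.

Lemma interval_count_opp j : (j <= 9)%N -> interval_count (9 - j) = interval_count j.
Proof.
move=> j9; apply/eqP; rewrite -eqz_nat /interval_count !count_iotaE; apply/eqP.
have E i : \sum_(r < p) (((0 < r)%N && (tenth r == i)) : nat)%:Z =
   \sum_(r < p.+1) (((0 < r < p)%N && (tenth r == i)) : nat)%:Z.
  rewrite big_ord_recr /= ltnn andbF addr0; apply: eq_bigr => r _.
  by rewrite ltn_ord andbT.
rewrite !E (reindex_inj rev_ord_inj) /=; apply: eq_bigr => r _; rewrite subSS.
have rp : (r <= p)%N by rewrite -ltnS.
have -> : (0 < p - r < p)%N = (0 < r < p)%N by move: rp; clear; lia.
case: (boolP (0 < r < p)%N) => //= /andP[r0 r1]; rewrite tenth_opp //.
have := tenth_lt (Ordinal r1); rewrite /=; move: (tenth r) j9; clear; lia.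
Qed.

(** The strict bound 10 r < i p and the weak one agree: equality would make p divide 10 r, although
    p is prime to 10 and 0 < r < p. *)
Lemma tenth_ltE (r i : nat) : (0 < r)%N -> (r < p)%N -> (i <= 5)%N ->
  (tenth r < i)%N = (r <= (i * p) %/ 10)%N.
Proof.
move=> r0 rp i5; rewrite /tenth ltn_divLR // leq_divRL // (mulnC r).
rewrite [RHS]leq_eqVlt; case: eqP => // e.
have : (p %| 10 * r)%N by rewrite e dvdn_mull.
by rewrite Gauss_dvdr // gtnNdvd.
Qed.

Lemma count_le_iota X : (X < p)%N -> count (fun r => (0 < r)%N && (r <= X)%N) (iota 0 p) = X.
Proof.
move=> Xp; have -> : p = (X.+1 + (p - X.+1))%N by lia.
rewrite iotaD count_cat add0n /= -[RHS]addn0; congr (_ + _)%N.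
  rewrite add0n -[RHS](size_iota 1); apply/eqP; rewrite -all_count; apply/allP => r.
  by rewrite mem_iota; lia.
by apply/eqP; rewrite -leqn0 leqNgt -has_count; apply/hasPn => r; rewrite mem_iota; lia.
Qed.

Lemma interval_countE j : (j <= 4)%N ->
  (interval_count j)%:Z = ((j.+1 * p) %/ 10)%N%:Z - ((j * p) %/ 10)%N%:Z.
Proof.
move=> j4; have lt i : (i <= 5)%N -> ((i * p) %/ 10 < p)%N.
  by move=> i5; rewrite ltn_divLR //; move: p_gt0 i5; clear; nia.
rewrite -{1}(count_le_iota (lt j.+1 j4)) -{1}(count_le_iota (lt j (leqW j4))).
rewrite /interval_count !count_iotaE -sumrB; apply: eq_bigr => r _.
case: (posnP (r : nat)) => [->|r0] //=.
rewrite -!tenth_ltE //; last exact: leqW.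
by move: (tenth r); clear; lia.
Qed.

Lemma size_residues : (size [seq r <- iota 0 p | c r == 1] * 2 = p.-1)%N.
Proof.
apply/eqP; rewrite -eqz_nat size_filter PoszM count_iotaE mulrC mulr_sumr; apply/eqP.
under eq_bigr do rewrite leg_ind.
rewrite big_split /= leg_sum0 addr0 -count_iotaE.
case: p p_gt0 => // n _; rewrite /= add0n; congr Posz.
rewrite -[RHS](size_iota 1 n); apply/eqP; rewrite -all_count; apply/allP => r.
by rewrite mem_iota => /andP[].
Qed.

(** * The orbit of m under multiplication by 10 *)

Section Orbit.
Variable m : nat.
Hypotheses (ord10 : ((p.-1)./2).-primitive_root (10%:R : 'F_p)).
Hypotheses (m_range : (0 < m < p)%N) (m_qr : exists x : nat, (x ^ 2 = m %[mod p])%N).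

Let h := (p.-1)./2.

Lemma leg_qr : c m = 1.
Proof.
case: m_qr => x e; have pm : ~~ (p %| m)%N by case/andP: m_range => m0 mp; rewrite gtnNdvd.
have px : ~~ (p %| x)%N.
  apply: contra pm; rewrite /dvdn -e => /eqP px.
  by rewrite -modnXm px mod0n.
by rewrite -leg_mod // -e leg_mod // -mulnn legM // leg_sqr.
Qed.

Lemma leg10 : c 10 = 1.
Proof.
have p10 : ~~ (p %| 10)%N by rewrite -prime_coprime.
by rewrite /leg (negbTE p10) (prim_expr_order ord10) eqxx.
Qed.

Definition orbit10 (j : nat) : nat := ((10 ^ j * m) %% p)%N.

(** Both m and 10 are residues, the latter by Euler's criterion, so the orbit consists of residues.
    Its (p - 1) / 2 elements are distinct and therefore exhaust them. *)
Lemma perm_orbit10 : perm_eq [seq orbit10 j | j <- iota 0 h] [seq r <- iota 0 p | c r == 1].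
Proof.
have u1 : uniq [seq orbit10 j | j <- iota 0 h].
  rewrite map_inj_in_uniq ?iota_uniq // => i j; rewrite !mem_iota !add0n => /andP[_ hi] /andP[_ hj] e.
  have m0 : (m%:R : 'F_p) != 0.
    by rewrite Fp_nat_eq0 //; case/andP: m_range => m0 mp; rewrite gtnNdvd.
  have : (10%:R : 'F_p) ^+ i * m%:R = 10%:R ^+ j * m%:R.
    rewrite -!natrX -!natrM -[LHS]Fp_natE // -[RHS]Fp_natE // !Fp_val_nat //.
    by congr (_%:R); exact: e.
  move=> /(mulIf m0)/eqP; rewrite (eq_prim_root_expr ord10) !modn_small // => /eqP //.
have sub : {subset [seq orbit10 j | j <- iota 0 h] <= [seq r <- iota 0 p | c r == 1]}.
  move=> r /mapP[j _ ->]; rewrite mem_filter mem_iota add0n /orbit10 ltn_mod p_gt0 /= andbT.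
  rewrite leg_mod // legM // leg_qr mulr1; apply/eqP; elim: j => [|j IH]; first exact: leg1.
  by rewrite expnS legM // leg10 IH.
have sz : (size [seq r <- iota 0 p | c r == 1] <= size [seq orbit10 j | j <- iota 0 h])%N.
  by rewrite size_map size_iota /h; have := size_residues; clear; lia.
have [_ e] := uniq_min_size u1 sub sz.
by apply: uniq_perm => //; rewrite filter_uniq // iota_uniq.
Qed.

Lemma count_orbit10 j : count (fun i => tenth (orbit10 i) == j) (iota 0 h) = residue_count j.
Proof.
rewrite -(count_map orbit10 (fun r => tenth r == j)) (seq.permP perm_orbit10) /residue_count count_filter.
by apply: eq_count => r /=; rewrite andbC.
Qed.

End Orbit.
End CharacterSums.

(** * Digits *)

Section Digits.
Local Open Scope classical_set_scope.
Local Open Scope ring_scope.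
Variables (R : realType) (a : nat -> nat) (p m : nat).
Hypotheses (p_gt0 : (0 < p)%N) (nd : forall n, ~~ (p %| 10 ^ n * m)%N).
Hypothesis a_digits : decimal_expansion (m%:R / p%:R : R) a.

Fixpoint prefix_value (n : nat) : nat :=
  if n is n'.+1 then (10 * prefix_value n' + a n)%N else 0%N.

Let s (n : nat) : R := \sum_(1 <= j < n.+1) (a j)%:R / 10%:R ^+ j.

Lemma digit_sumE n : s n = (prefix_value n)%:R / 10 ^+ n.
Proof.
elim: n => [|n IH]; first by rewrite /s big_geq // mul0r.
rewrite /s big_nat_recr //= -/(s n) IH natrD natrM exprS; field.
by rewrite expf_neq0.
Qed.

Lemma prefix_value_bound n t :
  (prefix_value n * 10 ^ t <= prefix_value (n + t) < (prefix_value n).+1 * 10 ^ t)%N.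
Proof.
have [ad _] := a_digits; elim: t => [|t IH]; first by rewrite addn0 !muln1 leqnn ltnSn.
rewrite addnS /= expnS; have := ad (n + t).+1 isT.
by move: IH; move: (prefix_value (n + t)) (a _) (10 ^ t)%N (prefix_value n) => x y z w; nia.
Qed.

(** In the limit 10^n m / p lies between the prefix and its successor, both included. The upper end,
    a tail of nines, is impossible because p does not divide 10^n m. *)
Lemma prefix_valueE n : prefix_value n = ((10 ^ n * m) %/ p)%N.
Proof.
have [_ cv] := a_digits; rewrite -/s in cv.
have T0 (i : nat) : 0 < (10 ^+ i : R) by rewrite exprn_gt0.
have near_ge N : (n <= N)%N -> (prefix_value n)%:R / 10 ^+ n <= s N <= (prefix_value n).+1%:R / 10 ^+ n.
  move=> nN; have := prefix_value_bound n (N - n); rewrite subnKC // => /andP[b1 b2].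
  have eN : 10 ^+ N = 10 ^+ n * 10 ^+ (N - n) :> R by rewrite -exprD subnKC.
  rewrite digit_sumE eN.
  have e : (prefix_value N)%:R / (10 ^+ n * 10 ^+ (N - n)) =
     ((prefix_value N)%:R / 10 ^+ (N - n)) / 10 ^+ n :> R.
    by field; rewrite !gt_eqF.
  rewrite e !ler_pM2r ?invr_gt0 // ler_pdivlMr // ler_pdivrMr // -!natrX -!natrM !ler_nat b1 /=.
  exact: ltnW.
have cvs : cvgn s by apply/cvg_ex; exists (m%:R / p%:R).
have lim_s : limn s = m%:R / p%:R by apply/cvg_lim.
have lo : (prefix_value n)%:R / 10 ^+ n <= m%:R / p%:R :> R.
  by rewrite -lim_s; apply: limr_ge => //; exists n => // N /= nN; case/andP: (near_ge N nN).
have hi : m%:R / p%:R <= (prefix_value n).+1%:R / 10 ^+ n :> R.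
  by rewrite -lim_s; apply: limr_le => //; exists n => // N /= nN; case/andP: (near_ge N nN).
have pR : 0 < p%:R :> R by rewrite ltr0n.
move: lo hi; rewrite ler_pdivrMr // mulrAC ler_pdivlMr // ler_pdivrMr // mulrAC ler_pdivlMr //.
rewrite -!natrX -!natrM !ler_nat => lo hi.
have hi' : (m * 10 ^ n < (prefix_value n).+1 * p)%N.
  rewrite ltn_neqAle hi andbT; apply/eqP => e; case/negP: (nd n).
  by rewrite mulnC e dvdn_mull.
apply/eqP; rewrite eqn_leq (mulnC (10 ^ n)%N); apply/andP; split.
  by rewrite leq_divRL.
by rewrite -ltnS ltn_divLR.
Qed.

Lemma digitE n : a n.+1 = ((10 * ((10 ^ n * m) %% p)) %/ p)%N.
Proof.
have := prefix_valueE n.+1; rewrite /= prefix_valueE expnS -mulnA.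
rewrite {2}(divn_eq (10 ^ n * m) p) mulnDr mulnA divnMDl //.
by move/eqP; rewrite eqn_add2l => /eqP.
Qed.

End Digits.

(** * The two class numbers and the digit frequencies *)

Lemma class_number_p p : prime p -> (p %% 4 = 3)%N -> (3 < p)%N ->
  (class_number (quadratic_field (- p%:Z)))%:R =
  - (\sum_(r < p) r%:R * (leg p r)%:~R) / p%:R :> rat.
Proof.
move=> pp p3 p_gt3; have p_odd : odd p by move: p3; clear; lia.
pose k := ((p + 1) %/ 4)%N; have kE : (4 * k - 1 = p)%N by rewrite /k; move: p3; clear; lia.
have k1 : (1 < k)%N by move: kE p_gt3; clear; lia.
have sqf q : prime q -> ~~ (q ^ 2 %| 4 * k - 1)%N.
  move=> pq; rewrite kE; apply/negP => q2.
  have : (q %| p)%N by apply: dvdn_trans q2; rewrite dvdn_mulr.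
  rewrite dvdn_prime2 // => /eqP qp; move: q2; rewrite qp => /(dvdn_leq (prime_gt0 pp)).
  by move: p_gt3; clear; nia.
have := @class_number_formula k (leg p) k1 sqf (leg1 pp) (legM pp p_odd)
  (fun q pq => root_count_leg pp p3 pq) _ (leg_val p) (leg0 p) _ _.
rewrite kE; apply.
- by move=> q pq; rewrite leg_eq0 dvdn_prime2 // dvdn_prime2 // eq_sym.
- exact: legD.
- exact: leg_sum0.
Qed.

Lemma leg5_opp p r : (r <= 5 * p)%N -> leg 5 (5 * p - r) = leg 5 r.
Proof.
move=> rp; rewrite !leg5_mod.
have -> : ((5 * p - r) %% 5 = nth 0 [:: 0; 4; 3; 2; 1] (r %% 5))%N.
  have := ltn_pmod r (isT : (0 < 5)%N); move: rp; rewrite {1 3}(divn_eq r 5).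
  by move: (r %/ 5)%N; case: (r %% 5)%N => [|[|[|[|[|i]]]]] t //=; lia.
by have := ltn_pmod r (isT : (0 < 5)%N); case: (r %% 5)%N => [|[|[|[|[|i]]]]].
Qed.

(** The symbol (r / 5) is even and (r / p) is odd. *)
Lemma leg5p_opp p r : prime p -> (p %% 4 = 3)%N -> (r <= 5 * p)%N ->
  leg5p p (5 * p - r) = - leg5p p r.
Proof.
move=> pp p3 rp; rewrite /leg5p leg5_opp //.
suff -> : leg p (5 * p - r) = - leg p r by rewrite mulrN.
have p0 := prime_gt0 pp; have rm : (r %% p <= p)%N by rewrite ltnW // ltn_mod.
rewrite -[in RHS]leg_mod // -leg_opp //.
rewrite -[LHS]leg_mod // -[RHS]leg_mod //; congr (leg p _); apply/eqP.
rewrite -(eqn_modDr r) subnK // modnMl.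
rewrite {2}(divn_eq r p) addnCA [(p - _ + _)%N]subnK // -mulSnr modnMl //.
Qed.

Lemma class_number_5p p : prime p -> (p %% 4 = 3)%N -> (3 < p)%N ->
  (class_number (quadratic_field (- (5 * p)%N%:Z)))%:R =
  - (\sum_(r < 5 * p) r%:R * (leg5p p r)%:~R) / (5 * p)%N%:R :> rat.
Proof.
move=> pp p3 p_gt3; have p_odd : odd p by move: p3; clear; lia.
have p5 : p != 5%N by apply: contra_eqN p3 => /eqP ->.
pose k := ((5 * p + 1) %/ 4)%N; have kE : (4 * k - 1 = 5 * p)%N by rewrite /k; move: p3; clear; lia.
have k1 : (1 < k)%N by move: kE p_gt3; clear; lia.
have sqf q : prime q -> ~~ (q ^ 2 %| 4 * k - 1)%N.
  move=> pq; rewrite kE; apply/negP => q2.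
  have : (q %| 5 * p)%N by apply: dvdn_trans q2; rewrite dvdn_mulr.
  rewrite Euclid_dvdM // !dvdn_prime2 // => /orP[] /eqP qE; move: q2; rewrite qE -mulnn.
    by rewrite dvdn_pmul2l // dvdn_prime2 // eq_sym (negbTE p5).
  by rewrite dvdn_pmul2r ?prime_gt0 // dvdn_prime2 // (negbTE p5).
have := @class_number_formula k (leg5p p) k1 sqf _ _ (fun q pq => root_count_leg5p pp p3 pq) _ _ _ _ _.
rewrite kE; apply.
- by rewrite /leg5p !leg1.
- by move=> u v; rewrite /leg5p !legM // mulrACA.
- move=> q pq; rewrite /leg5p mulf_eq0 !leg_eq0 Euclid_dvdM // !dvdn_prime2 //.
  by rewrite ![_ == q]eq_sym.
- by move=> u; rewrite /leg5p; case/or3P: (leg_val 5 u) => /eqP ->; case/or3P: (leg_val p u) => /eqP ->.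
- by rewrite /leg5p leg0 mul0r.
- move=> u; rewrite /leg5p -[leg 5 (_ + _)]leg_mod // -[leg p (_ + _)]leg_mod //.
  by rewrite {1}mulnC !modnMDl !leg_mod.
- by apply: odd_char_sum0; [rewrite /leg5p leg0 mul0r | move=> r; exact: leg5p_opp].
Qed.

(** Since (10 / p) = 1, the symbols of 5 and 2 agree, and the latter is known from p modulo 8. The
    relations from halves, fifths, the two doublings and the second class number are then five
    linear equations that determine S_0, ..., S_4. *)
Lemma delta_S10 p : prime p -> (p %% 4 = 3)%N -> (3 < p)%N ->
  leg p 10 = 1 ->
  forall k, (k <= 4)%N ->
  delta p (class_number (quadratic_field (- p%:Z)))%:R
          (class_number (quadratic_field (- (5 * p)%N%:Z)))%:R k = (S10 p k)%:~R :> rat.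
Proof.
move=> pp p3 p_gt3 l10; have p_odd : odd p by move: p3; clear; lia.
have h1E := class_number_p pp p3 p_gt3; have h2E := class_number_5p pp p3 p_gt3.
move: h1E h2E; set h1 := (class_number _)%:R; set h2 := (class_number _)%:R => h1E h2E.
have E1 := S10_half pp p3 p_gt3 h1E; have E2 := S10_fifth pp p3 p_gt3 h1E.
have E3 := S10_double0 pp p3 p_gt3; have E4 := S10_double1 pp p3 p_gt3.
have E5 := h2_fifths pp p3 p_gt3 h2E.
have [e5 e6 _ _ _] := S10_opps pp p3; rewrite e5 e6 in E3 E4.
have l25 : leg p 2 * leg p 5 = 1 by rewrite -legM.
have l2 := leg2 pp p3 p_gt3.
move: E1 E2 E3 E4 E5; rewrite /delta; case: ifP l2 => _ l2; rewrite l2 in l25 *;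
  (have -> : leg p 5 = leg p 2 by rewrite l2; move: l25; clear; lia); rewrite l2;
  move=> E1 E2 /(congr1 (fun z : int => z%:~R : rat)) E3
    /(congr1 (fun z : int => z%:~R : rat)) E4 E5;
  case=> [|[|[|[|[|k]]]]] //= _;
  move: (S10 p 0) (S10 p 1) (S10 p 2) (S10 p 3) (S10 p 4) E1 E2 E3 E4 E5 => s0 s1 s2 s3 s4;
  rewrite !(intrD, intrM, mulrNz) => E1 E2 E3 E4 E5; lra.
Qed.

Theorem theorem1 (R : realType) (p m : nat) (a : nat -> nat)
  (p_prime : prime p) (p_mod4 : (p %% 4 = 3)%N) (p_gt3 : (3 < p)%N)
  (ord10 : ((p.-1)./2).-primitive_root (10%:R : 'F_p))
  (m_range : (0 < m < p)%N)
  (m_qr : exists x : nat, (x ^ 2 = m %[mod p])%N)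
  (a_digits : decimal_expansion (m%:R / p%:R : R) a) :
  let n := digit_count a (p.-1)./2 in
  let h1 := (class_number (quadratic_field (- p%:Z)))%:R : rat in
  let h2 := (class_number (quadratic_field (- (5 * p)%N%:Z)))%:R : rat in
  let d := delta p h1 h2 in
  forall k : nat, (k <= 4)%N ->
    (n k)%:R =
      2%:R^-1 * (((k.+1 * p) %/ 10)%N%:R - ((k * p) %/ 10)%N%:R + d k) :> rat
    /\ (n (9 - k)%N)%:R = (n k)%:R - d k :> rat.
Proof.
move=> n h1 h2 d k k4; have p0 := prime_gt0 p_prime.
have l10 := leg10 p_prime p_mod4 ord10.
have nd i : ~~ (p %| 10 ^ i * m)%N.
  rewrite -leg_eq0 // legM //; last by move: p_mod4; clear; lia.
  rewrite (leg_qr p_prime p_mod4 m_range m_qr) mulr1.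
  elim: i => [|i IH]; first by rewrite leg1.
  by rewrite expnS legM ?l10 ?mul1r //; move: p_mod4; clear; lia.
have nE j : n j = residue_count p j.
  rewrite -(count_orbit10 p_prime p_mod4 ord10 m_range m_qr) /n /digit_count.
  (* Digits are numbered from 1 and powers of 10 from 0: digit i + 1 belongs to 10^i m. *)
  rewrite /index_iota subSS subn0 -[1%N]addn0 iotaDl count_map; apply: eq_count => i /=.
  by rewrite add1n (digitE p0 nd a_digits).
have -> : d k = (S10 p k)%:~R by exact: delta_S10.
have e1 := residue_countE p k; have e2 := residue_countE p (9 - k).
have k9 : (k <= 9)%N by exact: leq_trans k4 _.
rewrite (interval_count_opp p_prime p_mod4 k9) (S10_opp p_prime p_mod4 k9) in e2.
rewrite (interval_countE p_prime p_mod4 p_gt3 k4) in e1 e2; rewrite !nE.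
have f1 := congr1 (fun z : int => z%:~R : rat) e1; have f2 := congr1 (fun z : int => z%:~R : rat) e2.
rewrite !(intrD, intrM, mulrNz) -?pmulrn in f1 f2.
by split; lra.
Qed.
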